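(* Let $A_1,A_2,A_3$ be three symmetric $(2\times 2)$-matrices with real algebraic number entries of bounded height $h(A_i)\le H$ for $i\in\{1,2,3\}$. Assume that the equation $$A_1^{k_1}A_2^{k_2}=A_3^{k_3}$$ has a solution in non-zero integers $k_1,k_2,k_3$. Then there is a constant $C$, effectively computable from the given data, and there are non-zero integers $k_1,k_2,k_3$ with $|k_1|,|k_2|,|k_3|\le C$ such that $A_1^{k_1}A_2^{k_2}=A_3^{k_3}$ holds. In other words: there is an algorithm which decides, for any given symmetric $(2\times 2)$-matrices $A_1,A_2,A_3$ with real algebraic number entries, whether the equation $A_1^{k_1}A_2^{k_2}=A_3^{k_3}$ has a solution in non-zero integers $k_1,k_2,k_3$ or not and, in case it has solutions, provides an explicit one.
   Context: For a matrix $A$ with algebraic entries, $h(A)$ denotes the (absolute) logarithmic height of the set of entries of $A$. A power $A^{k}$ with $k<0$ is only considered when $A$ is invertible. The matrices are given to the algorithm through (any standard exact representation of) their real algebraic entries. *)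

(* Defs.v *)
From HB Require Import structures.
From mathcomp Require Import all_boot all_order all_algebra all_field.
From mathcomp Require Import complex.
From mathcomp Require Import all_classical all_reals all_analysis.

Set Implicit Arguments.
Unset Strict Implicit.
Unset Printing Implicit Defensive.

Import Order.TTheory GRing.Theory Num.Theory.
Import numFieldNormedType.Exports.

Local Open Scope ring_scope.
Local Open Scope complex_scope.

(* Kleene's (total) recursive functions: minimization is only applied to
   regular functions, so every member is total, and the class consists exactly
   of the total computable functions. Primitive recursion and minimization are
   given by the equations that determine [f]. *)
Inductive recursive : forall n : nat, (n.-tuple nat -> nat) -> Prop :=
| recursive_zero n : recursive (fun _ : n.-tuple nat => 0%N)
| recursive_succ : recursive (fun x : 1.-tuple nat => (thead x).+1)
| recursive_proj n (i : 'I_n) : recursive (fun x : n.-tuple nat => tnth x i)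
| recursive_comp m n (f : m.-tuple nat -> nat)
    (g : 'I_m -> n.-tuple nat -> nat) :
    recursive f -> (forall i, recursive (g i)) ->
    recursive (fun x : n.-tuple nat => f [tuple g i x | i < m])
| recursive_primrec n (g : n.-tuple nat -> nat) (h : n.+2.-tuple nat -> nat)
    (f : n.+1.-tuple nat -> nat) :
    recursive g -> recursive h ->
    (forall x : n.-tuple nat, f [tuple of 0%N :: x] = g x) ->
    (forall (k : nat) (x : n.-tuple nat),
      f [tuple of k.+1 :: x] =
      h [tuple of k :: f [tuple of k :: x] :: x]) ->
    recursive f
| recursive_mu n (g : n.+1.-tuple nat -> nat) (f : n.-tuple nat -> nat) :
    recursive g ->
    (forall x : n.-tuple nat, g [tuple of f x :: x] = 0%N) ->
    (forall (x : n.-tuple nat) (k : nat),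
      (k < f x)%N -> g [tuple of k :: x] <> 0%N) ->
    recursive f.

(* [pickle] is an elementary explicit coding on all the types it is used for
   below (nat, int, rat, {poly int}, products and options); rationals are coded
   by their reduced fractions and polynomials by their coefficient lists. *)
Definition computable (X Y : countType) (f : X -> Y) : Prop :=
  exists F : nat -> nat,
    recursive (fun x : 1.-tuple nat => F (thead x)) /\
    forall x : X, F (pickle x) = pickle (f x).

(* An integer polynomial together with the end points of an isolating
   interval. *)
Definition algnum_code : countType := ({poly int} * (rat * rat))%type.

Definition algnum_repr (R : realType) (c : algnum_code) (x : R) : Prop :=
  let p := map_poly (intr : int -> R) c.1 in
  let I := [set y : R | ratr c.2.1 < y < ratr c.2.2]%classic in
  [/\ c.1 != 0, I x, root p x & forall y : R, I y -> root p y -> y = x].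

(* The two rows of the matrix. *)
Definition mx2_code : countType :=
  ((algnum_code * algnum_code) * (algnum_code * algnum_code))%type.

Definition mx2_repr (R : realType) (c : mx2_code) (A : 'M[R]_2) : Prop :=
  [/\ algnum_repr c.1.1 (A 0 0), algnum_repr c.1.2 (A 0 1),
      algnum_repr c.2.1 (A 1 0) & algnum_repr c.2.2 (A 1 1)].

Definition mx2_triple_code : countType := (mx2_code * mx2_code * mx2_code)%type.

(* An absolute value of K above the prime p, normalized by |p| = 1/p. *)
Definition is_padic_absval (R : realType) (K : fieldType) (p : nat)
    (v : K -> R) : Prop :=
  [/\ forall x, 0 <= v x,
      forall x, (v x == 0) = (x == 0),
      forall x y, v (x * y) = v x * v y,
      forall x y, v (x + y) <= Num.max (v x) (v y) &
      v p%:R = p%:R^-1].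

Definition padic_absval (R : realType) (K : fieldType) (p : nat) : K -> R :=
  xget (fun _ : K => 0) [set v : K -> R | is_padic_absval p v]%classic.

(* The absolute logarithmic height
     h(S) = 1/[K:Q] sum_v [K_v:Q_v] log max(1, max_{x in S} |x|_v)
   of a finite set S in a Galois number field K. The places v above a given
   place of Q are the |g(.)|_{v0}, with v0 one of them and g in Gal(K/Q), and
   each place v is obtained from exactly [K_v:Q_v] elements g. The complex
   embedding iota provides v0 at infinity. The sum over p has finitely many
   nonzero terms. *)
Definition log_height (R : realType) (K : splittingFieldType rat)
    (iota : {rmorphism K -> R[i]}) (S : seq K) : R :=
  #|('Gal({:K} / 1))%g|%:R^-1 *
  \sum_(g in 'Gal({:K} / 1)%g)
    (ln (\big[Num.max/1]_(x <- S) Normc.normc (iota (g x))) +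
     limn (fun n : nat => \sum_(0 <= p < n | prime p)
       ln (\big[Num.max/1]_(x <- S) padic_absval R p (g x)))).

(* The height does not depend on the Galois number field containing the
   entries; it has no meaning for a matrix with a transcendental entry. *)
Definition mx_log_height (R : realType) (m n : nat) (A : 'M[R]_(m, n)) : R :=
  xget 0 [set h : R | exists (K : splittingFieldType rat)
      (iota : {rmorphism K -> R[i]}) (B : 'M[K]_(m, n)),
    map_mx iota B = map_mx (fun x : R => x%:C) A /\
    h = log_height iota [seq B ij.1 ij.2 | ij : 'I_m * 'I_n]]%classic.

(* The sign conditions matter since A ^ k is a junk value when k < 0 and A is
   not invertible. *)
Definition power_relation (R : realType) (A1 A2 A3 : 'M[R]_2)
    (k1 k2 k3 : int) : Prop :=
  [/\ k1 != 0, k2 != 0 & k3 != 0] /\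
  [/\ k1 < 0 -> A1 \in unitmx, k2 < 0 -> A2 \in unitmx,
      k3 < 0 -> A3 \in unitmx & A1 ^ k1 *m A2 ^ k2 = A3 ^ k3].

(* Main.v *)
Require Import Defs.
From HB Require Import structures.
From mathcomp Require Import all_boot all_order all_algebra all_field.
From mathcomp Require Import complex.
From mathcomp Require Import all_classical all_reals all_analysis.
From mathcomp Require Import ring lra zify.

Set Implicit Arguments.
Unset Strict Implicit.
Unset Printing Implicit Defensive.

Import Order.TTheory GRing.Theory Num.Theory.
Import numFieldNormedType.Exports.

Local Open Scope ring_scope.

(** The matrix equation is a multiplicative relation between eigenvalues.
    Suppose that [A1 ^ k1 * A2 ^ k2 = A3 ^ k3]. As the three matrices are
    symmetric, transposition shows that the two factors on the left commute, and
    the squares [S1], [S2], [S3] of the matrices satisfy the same relation with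
    the same exponents. A square of a real symmetric matrix has nonnegative
    eigenvalues and is therefore a polynomial in each of its positive powers, so
    the [S_i] commute with each other ([power_relation_squares]). Conversely, a
    solution [k] for the squares is a solution [2 * k] for the matrices. In a
    common eigenbasis of the squares the equation turns into two equations
    [x1 ^ k1 * x2 ^ k2 = x3 ^ k3] between algebraic numbers.

    Solvable equations have small solutions ([small_relation]). Inverting some
    of the numbers and fixing the signs of the exponents, consider relations
    [x1 ^ b1 * x2 ^ b2 * x3 ^ b3 = 1] with natural exponents, and suppose that
    [b_l] is large. For [m = 0, 1, 2, ...] let [w] be the monomial in the [x_i]
    whose exponents are [- floor (m * b_i / b_l)]. In view of the relation, the
    power [w ^ b_l] is the monomial with the exponents [m * b_i mod b_l], all of
    them smaller than [b_l]. So a fixed multiple of [w] is an algebraic integer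
    whose conjugates are bounded independently of [m] and of the [b_i], and only
    finitely many numbers of a given number field have this property; an
    explicit bound [N] for their number comes from counting their
    characteristic polynomials. Among [N ^ 2 + 1] values of [m] there are
    two with the same [w] in both equations. The difference of their exponents
    is a relation that lies between [0] and [b] and cuts [b] into two
    smaller relations. Hence a minimal relation with a positive exponent at
    a given place has exponents at most [N ^ 2], and the sum of three of these
    has only positive exponents.

    The algorithm searches for a certificate. All numbers that matter are values
    of rational polynomials at one real algebraic number [t], which is given
    as a root of a polynomial in a small interval with rational end points.
    Equalities between such values are congruences of polynomials, and strict
    inequalities hold on the whole interval if it is small enough, which shows
    in the coefficients of a polynomial. A certificate gives either a
    solution for the eigenvalues, or squares that do not commute, or the failure
    of all exponents up to the bound. The search has to stop on every
    input, so there are also certificates for codes that represent no symmetric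
    matrices ([check_complete]). That the verification is a recursive function of
    the codes is shown by closing the computable functions under the
    operations of the arithmetic of rational polynomials. The bound for the
    exponents is then the size of the solution that is found. *)

(** * Recursive functions *)

Section Recursive.

Local Open Scope nat_scope.

Definition tbehead n (x : n.+1.-tuple nat) : n.-tuple nat := [tuple of behead x].

Lemma recursive_ext n (f g : n.-tuple nat -> nat) :
  recursive f -> f =1 g -> recursive g.
Proof. by move=> rf /funext <-. Qed.

Definition rec1 (h : nat -> nat) := recursive (fun x : 1.-tuple nat => h (thead x)).

Definition rec2 (h : nat -> nat -> nat) :=
  recursive (fun x : 2.-tuple nat => h (tnth x ord0) (tnth x ord_max)).

Lemma recursive_app1 n h (f : n.-tuple nat -> nat) :
  rec1 h -> recursive f -> recursive (fun x => h (f x)).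
Proof.
move=> rh rf; apply: recursive_ext (recursive_comp rh (fun _ => rf)) _ => x.
by rewrite /thead tnth_mktuple.
Qed.

Lemma recursive_app2 n h (f g : n.-tuple nat -> nat) :
  rec2 h -> recursive f -> recursive g -> recursive (fun x => h (f x) (g x)).
Proof.
move=> rh rf rg.
pose G (i : 'I_2) := if i == ord0 then f else g.
have rG i : recursive (G i) by rewrite /G; case: ifP.
by apply: recursive_ext (recursive_comp rh rG) _ => x; rewrite !tnth_mktuple.
Qed.

Lemma recursive_const n c : recursive (fun _ : n.-tuple nat => c).
Proof.
elim: c => [|c IH]; first exact: recursive_zero.
exact: (recursive_app1 (h := succn)) recursive_succ IH.
Qed.

Lemma recursive_behead n (f : n.-tuple nat -> nat) :
  recursive f -> recursive (fun x : n.+1.-tuple nat => f (tbehead x)).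
Proof.
move=> rf; apply: recursive_ext (recursive_comp rf _) _.
  by move=> i; apply: (recursive_proj (lift ord0 i)).
by move=> x /=; congr f; apply: eq_from_tnth => i; rewrite tnth_mktuple tnth_behead;
  congr tnth; apply: val_inj; rewrite /= inordK // ltnS ltn_ord.
Qed.

(** Primitive recursion on the value of a recursive function, with the
    arguments themselves as parameters: the form in which it is used below. *)
Lemma recursive_nat_rect n (c z : n.-tuple nat -> nat)
    (s : nat -> nat -> n.-tuple nat -> nat) :
    recursive c -> recursive z ->
    recursive (fun y : n.+2.-tuple nat =>
      s (thead y) (thead (tbehead y)) (tbehead (tbehead y))) ->
  recursive (fun x => nat_rect (fun=> nat) (z x) (fun k a => s k a x) (c x)).
Proof.
move=> rc rz rs.
pose F (y : n.+1.-tuple nat) := let x := (tbehead y) in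
  nat_rect (fun=> nat) (z x) (fun k a => s k a x) (thead y).
have rF : recursive F.
  apply: (recursive_primrec rz rs) => [x|k x]; rewrite /F /=.
    by congr z; apply: val_inj.
  have beheadK m a (t : m.-tuple nat) : tbehead [tuple of a :: t] = t.
    exact: val_inj.
  by rewrite !theadE !(beheadK n) /= (beheadK n.+1) theadE; congr s;
    apply: val_inj.
pose g i : n.-tuple nat -> nat :=
  if unlift (ord0 : 'I_n.+1) i is Some j then fun x => tnth x j else c.
have rg i : recursive (g i).
  by rewrite /g; case: unliftP => [j|] _ //; exact: recursive_proj.
apply: recursive_ext (recursive_comp rF rg) _ => x.
have -> : [tuple g i x | i < n.+1] = [tuple of c x :: x].
  apply: eq_from_tnth => i; rewrite tnth_mktuple /g.
  by case: unliftP => [j|] -> //; rewrite tnthS.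
rewrite /F theadE; by have -> : tbehead [tuple of c x :: x] = x by apply: val_inj.
Qed.

Lemma recursive_thead n : recursive (fun x : n.+1.-tuple nat => thead x).
Proof. exact: recursive_proj. Qed.

Lemma recursive_second n : recursive (fun x : n.+2.-tuple nat => thead (tbehead x)).
Proof. exact: recursive_behead (recursive_thead n). Qed.

Lemma recursive_third n :
  recursive (fun x : n.+3.-tuple nat => thead (tbehead (tbehead x))).
Proof. exact: recursive_behead (recursive_second n). Qed.

Lemma rec1_nat_rect z (s : nat -> nat -> nat) :
  rec2 s -> rec1 (fun n => nat_rect (fun=> nat) z s n).
Proof.
move=> rs; apply: (recursive_nat_rect (s := fun k a _ => s k a)).
- exact: recursive_thead.
- exact: recursive_const.
- apply: (recursive_app2 rs); first exact: recursive_thead.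
  exact: (recursive_behead (recursive_thead 1)).
Qed.

Lemma rec2_nat_rect (z : nat -> nat) (s : nat -> nat -> nat -> nat) :
    rec1 z ->
    recursive (fun y : 3.-tuple nat =>
      s (thead y) (thead (tbehead y)) (thead (tbehead (tbehead y)))) ->
  rec2 (fun x n => nat_rect (fun=> nat) (z x) (fun k a => s k a x) n).
Proof.
move=> rz rs; apply: (@recursive_nat_rect 2 _ (fun x => z (tnth x ord0))
  (fun k a x => s k a (tnth x ord0))).
- exact: recursive_proj.
- exact: (recursive_app1 rz (recursive_proj _)).
- have rg (i : 'I_3) : recursive (fun x : 4.-tuple nat => tnth x (widen_ord (leqnSn 3) i)).
    exact: recursive_proj.
  apply: recursive_ext (recursive_comp rs rg) _ => x.
  by congr s; rewrite /thead ?tnth_behead tnth_mktuple; congr tnth;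
    apply: val_inj; rewrite /= ?inordK.
Qed.

Lemma rec1_succ : rec1 succn. Proof. exact: recursive_succ. Qed.

Lemma rec2_fst (h : nat -> nat) : rec1 h -> rec2 (fun m _ => h m).
Proof. by move=> rh; apply: recursive_app1 rh (recursive_proj _). Qed.

Lemma rec2_snd (h : nat -> nat) : rec1 h -> rec2 (fun _ n => h n).
Proof. by move=> rh; apply: recursive_app1 rh (recursive_proj _). Qed.

Lemma rec2_add : rec2 addn.
Proof.
apply: recursive_ext (@rec2_nat_rect id (fun _ a _ => a.+1) _ _) _.
- exact: recursive_thead.
- exact: recursive_app1 rec1_succ (recursive_second _).
by move=> x; elim: (tnth _ ord_max) => [|n /= ->]; rewrite ?addn0 ?addnS.
Qed.

Lemma rec2_mul : rec2 muln.
Proof.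
apply: recursive_ext (@rec2_nat_rect (fun=> 0) (fun _ a x => a + x) _ _) _.
- exact: recursive_const.
- exact: recursive_app2 rec2_add (recursive_second _) (recursive_third _).
by move=> x; elim: (tnth _ ord_max) => [|n /= ->]; rewrite ?muln0 // mulnSr.
Qed.

Lemma rec1_pred : rec1 predn.
Proof.
apply: recursive_ext (@rec1_nat_rect 0 (fun k _ => k) _) _.
  exact: recursive_proj.
by move=> x; case: (thead x).
Qed.

Lemma rec2_sub : rec2 subn.
Proof.
apply: recursive_ext (@rec2_nat_rect id (fun _ a _ => a.-1) _ _) _.
- exact: recursive_thead.
- exact: recursive_app1 rec1_pred (recursive_second _).
by move=> x; elim: (tnth _ ord_max) => [|n /= ->]; rewrite ?subn0 // subnS.
Qed.

Lemma rec1_exp2 : rec1 (expn 2).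
Proof.
apply: recursive_ext (@rec1_nat_rect 1 (fun _ a => a + a) _) _.
  exact: recursive_app2 rec2_add (recursive_proj _) (recursive_proj _).
by move=> x; elim: (thead x) => [|n /= ->] //; rewrite expnS mul2n addnn.
Qed.

Lemma rec1_eq0 : rec1 (fun n => n == 0 : nat).
Proof.
apply: recursive_ext (recursive_app2 rec2_sub (recursive_const 1 1)
  (recursive_thead 0)) _ => x.
by case: (thead x) => [|[]].
Qed.

Lemma rec1_odd : rec1 (fun n => odd n : nat).
Proof.
apply: recursive_ext (@rec1_nat_rect 0 (fun _ a => a == 0) _) _.
  exact: rec2_snd rec1_eq0.
by move=> x; elim: (thead x) => [|n /= ->] //=; case: (odd n).
Qed.

Lemma rec1_half : rec1 half.
Proof.
apply: recursive_ext (@rec1_nat_rect 0 (fun k a => odd k + a) _) _.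
  exact: recursive_app2 rec2_add (rec2_fst rec1_odd) (recursive_proj _).
by move=> x; elim: (thead x) => [|n /= ->] //; rewrite uphalf_half.
Qed.

(** Halving until an odd number is reached: on a nonzero code of a sequence
    this strips the power of two that stands for the first entry. *)
Definition halve_even n := if odd n then n else n./2.

Lemma rec1_halve_even : rec1 halve_even.
Proof.
have rh : rec1 (fun n => odd n * n + (1 - odd n) * n./2).
  apply: recursive_app2 rec2_add _ _; apply: recursive_app2 rec2_mul _ _.
  - exact: rec1_odd.
  - exact: recursive_thead.
  - by apply: recursive_app2 rec2_sub (recursive_const _ _) _; exact: rec1_odd.
  - exact: rec1_half.
apply: recursive_ext rh _ => x; rewrite /halve_even.
by case: odd; rewrite ?mul1n ?mul0n ?addn0.
Qed.

Lemma rec2_iter (h : nat -> nat) : rec1 h -> rec2 (fun x n => iter n h x).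
Proof.
move=> rh; apply: recursive_ext (@rec2_nat_rect id (fun _ a _ => h a) _ _) _.
- exact: recursive_thead.
- exact: recursive_app1 rh (recursive_second _).
by move=> x; elim: (tnth _ ord_max) => [|n /= ->].
Qed.

Lemma iter_halve_even a m i :
  iter i halve_even (2 ^ a * m.*2.+1) = 2 ^ (a - i) * m.*2.+1.
Proof.
elim: i => [|i IH]; rewrite ?subn0 // iterS {}IH /halve_even subnS.
case: (a - i) => [|j]; first by rewrite mul1n /= odd_double.
by rewrite expnS -mulnA mul2n odd_double doubleK.
Qed.

(** The decomposition of the code of a nonempty sequence into its head and the
    code of its tail, by [n = 2 ^ head * (2 * tail + 1)]. Every entry is smaller
    than the code, so that [n] steps of halving are enough. *)
Definition code_tail n := (iter n halve_even n)./2.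

Definition code_head n :=
  nat_rect (fun=> nat) 0 (fun k a => a + (1 - odd (iter k halve_even n))) n.

Lemma code_tail_code s : code_tail (CodeSeq.code s) = CodeSeq.code (behead s).
Proof.
case: s => [|a s] //; rewrite /code_tail /= iter_halve_even (eqP (_ : a - _ == 0)).
  by rewrite mul1n /= uphalf_double.
by rewrite subn_eq0 (leq_trans (ltnW (ltn_expl a (ltnSn 1)))) // leq_pmulr.
Qed.

Lemma code_head_code s : code_head (CodeSeq.code s) = head 0 s.
Proof.
case: s => [|a s] //; rewrite /code_head /=; set m := CodeSeq.code s.
have E k : nat_rect (fun=> nat) 0 (fun k r =>
    r + (1 - odd (iter k halve_even (2 ^ a * m.*2.+1)))) k = minn k a.
  elim: k => [|k /= ->]; first by rewrite min0n.
  rewrite iter_halve_even oddM oddX /= odd_double andbT orbF subn_eq0.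
  by case: (ltnP k a) => h; rewrite ?(minn_idPl h) ?addn1 //
    (minn_idPr (leqW h)) addn0.
rewrite E; apply/minn_idPr.
by rewrite (leq_trans (ltnW (ltn_expl a (ltnSn 1)))) // leq_pmulr.
Qed.

Lemma rec1_code_tail : rec1 code_tail.
Proof.
apply: recursive_app1 rec1_half _.
by apply: recursive_app2 (rec2_iter rec1_halve_even) _ _; exact: recursive_thead.
Qed.

Lemma rec1_code_head : rec1 code_head.
Proof.
apply: (recursive_nat_rect
  (s := fun k a x => a + (1 - odd (iter k halve_even (thead x))))).
- exact: recursive_thead.
- exact: recursive_const.
apply: recursive_app2 rec2_add (recursive_behead (recursive_thead 1)) _.
apply: recursive_app2 rec2_sub (recursive_const _ _) _.
apply: recursive_app1 rec1_odd _.
apply: recursive_app2 (rec2_iter rec1_halve_even) _ (recursive_thead _).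
exact: (recursive_behead (recursive_behead (recursive_thead 0))).
Qed.

Definition code_cons a m := 2 ^ a * m.*2.+1.

Lemma rec2_code_cons : rec2 code_cons.
Proof.
apply: recursive_app2 rec2_mul _ _; first exact: rec2_fst rec1_exp2.
apply: recursive_app1 rec1_succ _.
apply: recursive_ext (recursive_app2 rec2_add (recursive_proj ord_max) (recursive_proj ord_max)) _.
by move=> x; rewrite addnn.
Qed.

End Recursive.
(** * Computable functions between countable types *)

Section Computable.

Implicit Types X Y Z : countType.

Lemma computable_id X : computable (fun x : X => x).
Proof. by exists id; split=> //; exact: (recursive_thead 0). Qed.

Lemma computable_comp X Y Z (g : Y -> Z) (f : X -> Y) :
  computable g -> computable f -> computable (fun x => g (f x)).
Proof.
move=> [G [rG GE]] [F [rF FE]]; exists (G \o F); split=> [|x]; last first.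
  by rewrite /= FE GE.
exact: (@recursive_app1 1 G _ rG rF).
Qed.

Lemma computable_const X Y (y : Y) : computable (fun _ : X => y).
Proof. by exists (fun=> pickle y); split=> //; exact: recursive_const. Qed.

(** Only codes are computed with, so that a function which keeps the code is
    free: in this way values enter and leave the structured types. *)
Lemma computable_recode X Y Z (f : X -> Y) (g : X -> Z) :
  (forall x, pickle (f x) = pickle (g x)) -> computable f -> computable g.
Proof. by move=> E [F [rF FE]]; exists F; split=> // x; rewrite FE E. Qed.

Lemma computable_pickle X Y (f : X -> Y) :
  computable f -> computable (fun x => pickle (f x)).
Proof. exact: computable_recode. Qed.

Lemma computable_unpickle X Y (f : X -> Y) :
  computable (fun x => pickle (f x)) -> computable f.
Proof. exact: computable_recode. Qed.

Lemma computable_ext X Y (f g : X -> Y) : f =1 g -> computable f -> computable g.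
Proof. by move=> /funext ->. Qed.

Lemma computable_rec1 X h (f : X -> nat) :
  rec1 h -> computable f -> computable (fun x => h (f x)).
Proof.
move=> rh cf; apply: (computable_comp (g := h) _ cf).
by exists h; split.
Qed.

Lemma computable_rec2 X h (f g : X -> nat) :
  rec2 h -> computable f -> computable g -> computable (fun x => h (f x) (g x)).
Proof.
move=> rh [F [rF FE]] [G [rG GE]]; exists (fun n => h (F n) (G n)).
by split=> [|x]; [exact: recursive_app2 | rewrite FE GE].
Qed.

Lemma computable_pair X Y Z (f : X -> Y) (g : X -> Z) :
  computable f -> computable g -> computable (fun x => (f x, g x)).
Proof.
move=> /computable_pickle cf /computable_pickle cg; apply: computable_unpickle.
apply: (computable_rec2 rec2_code_cons cf).
exact: (computable_rec2 rec2_code_cons cg (computable_const _ 0%N)).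
Qed.

Lemma computable_fst X Y Z (f : X -> Y * Z) :
  computable f -> computable (fun x => (f x).1).
Proof.
move=> /computable_pickle /(computable_rec1 rec1_code_head) cf.
apply: computable_recode cf => x.
exact: (code_head_code [:: pickle (f x).1; pickle (f x).2]).
Qed.

Lemma computable_snd X Y Z (f : X -> Y * Z) :
  computable f -> computable (fun x => (f x).2).
Proof.
move=> /computable_pickle /(computable_rec1 rec1_code_tail).
move=> /(computable_rec1 rec1_code_head) cf; apply: computable_recode cf => x.
rewrite (_ : pickle (f x) = CodeSeq.code [:: pickle (f x).1; pickle (f x).2]) //.
by rewrite code_tail_code code_head_code.
Qed.

Lemma computable_nat_rect X Y (n : X -> nat) (z : X -> Y) (s : X -> nat -> Y -> Y) :
    computable n -> computable z ->
    computable (fun p : X * (nat * Y) => s p.1 p.2.1 p.2.2) ->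
  computable (fun x => nat_rect (fun=> Y : Type) (z x) (s x) (n x)).
Proof.
move=> [N [rN NE]] [Z0 [rZ ZE]] [S [rS SE]].
pose s' k a m := S (code_cons m (code_cons (code_cons k (code_cons a 0)) 0)).
exists (fun m => nat_rect (fun=> nat) (Z0 m) (fun k a => s' k a m) (N m)).
split=> [|x].
  apply: (@recursive_nat_rect 1 (fun y => N (thead y)) (fun y => Z0 (thead y))
    (fun k a y => s' k a (thead y))) => //.
  apply: recursive_app1 rS _; apply: recursive_app2 rec2_code_cons _ _.
    exact: recursive_third.
  apply: recursive_app2 rec2_code_cons _ (recursive_const _ _).
  apply: recursive_app2 rec2_code_cons (recursive_thead _) _.
  exact: recursive_app2 rec2_code_cons (recursive_second _) (recursive_const _ _).
rewrite NE ZE -[pickle (n x)]/(n x); elim: (n x) => //= k ->.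
exact: (SE (x, (k, _))).
Qed.

Lemma computable_succn X (f : X -> nat) :
  computable f -> computable (fun x => (f x).+1).
Proof. exact: computable_rec1 rec1_succ. Qed.

Lemma computable_addn X (f g : X -> nat) :
  computable f -> computable g -> computable (fun x => (f x + g x)%N).
Proof. exact: computable_rec2 rec2_add. Qed.

Lemma computable_muln X (f g : X -> nat) :
  computable f -> computable g -> computable (fun x => (f x * g x)%N).
Proof. exact: computable_rec2 rec2_mul. Qed.

Lemma computable_subn X (f g : X -> nat) :
  computable f -> computable g -> computable (fun x => (f x - g x)%N).
Proof. exact: computable_rec2 rec2_sub. Qed.

Lemma computable_nat_of_bool X (f : X -> bool) :
  computable f -> computable (fun x => nat_of_bool (f x)).
Proof. exact: computable_recode. Qed.

Lemma computable_eq0n X (f : X -> nat) :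
  computable f -> computable (fun x => f x == 0%N).
Proof. by move=> /(computable_rec1 rec1_eq0); exact: computable_recode. Qed.

Lemma computable_leq X (f g : X -> nat) :
  computable f -> computable g -> computable (fun x => (f x <= g x)%N).
Proof. by move=> cf cg; apply: computable_eq0n; exact: computable_subn. Qed.

Lemma computable_neg X (f : X -> bool) :
  computable f -> computable (fun x => ~~ f x).
Proof.
move=> /computable_nat_of_bool /computable_eq0n.
by apply: computable_ext => x; case: (f x).
Qed.

Lemma computable_and X (f g : X -> bool) :
  computable f -> computable g -> computable (fun x => f x && g x).
Proof.
move=> /computable_nat_of_bool cf /computable_nat_of_bool cg.
apply: computable_recode (computable_muln cf cg) => x.
by case: (f x); case: (g x).
Qed.

Lemma computable_or X (f g : X -> bool) :
  computable f -> computable g -> computable (fun x => f x || g x).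
Proof.
move=> cf cg; apply: computable_ext
  (computable_neg (computable_and (computable_neg cf) (computable_neg cg))) => x.
by case: (f x); case: (g x).
Qed.

Lemma computable_eq X Y (f g : X -> Y) :
  computable f -> computable g -> computable (fun x => f x == g x).
Proof.
move=> /computable_pickle cf /computable_pickle cg.
apply: computable_ext (computable_and (computable_leq cf cg) (computable_leq cg cf)).
by move=> x; rewrite -eqn_leq (inj_eq (pcan_inj pickleK)).
Qed.

Lemma computable_if X Y (b : X -> bool) (f g : X -> Y) :
  computable b -> computable f -> computable g ->
  computable (fun x => if b x then f x else g x).
Proof.
move=> cb /computable_pickle cf /computable_pickle cg.
apply: computable_recode (computable_addn
  (computable_muln (computable_nat_of_bool cb) cf)
  (computable_muln (computable_nat_of_bool (computable_neg cb)) cg)) => x.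
by case: (b x); rewrite !(mul1n, mul0n, addn0).
Qed.

Lemma computable_expn X (f g : X -> nat) :
  computable f -> computable g -> computable (fun x => (f x ^ g x)%N).
Proof.
move=> cf cg; apply: computable_ext (computable_nat_rect (z := fun=> 1%N)
  (s := fun x _ a => (f x * a)%N) cg (computable_const _ _) _).
  by move=> x; elim: (g x) => //= n ->; rewrite expnS.
apply: computable_muln; last exact: computable_snd (computable_snd (computable_id _)).
exact: computable_comp cf (computable_fst (computable_id _)).
Qed.

Lemma computable_code_head X (f : X -> nat) :
  computable f -> computable (fun x => code_head (f x)).
Proof. exact: computable_rec1 rec1_code_head. Qed.

Lemma computable_code_tail X (f : X -> nat) :
  computable f -> computable (fun x => code_tail (f x)).
Proof. exact: computable_rec1 rec1_code_tail. Qed.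

(** Minimization yields a total function only if a witness exists for every
    natural number, also for one that codes nothing. A computable
    retraction onto the codes reduces the latter case to the former. *)
Definition decodable X :=
  exists2 r : nat -> X, computable r & forall x, r (pickle x) = x.

Lemma computable_search X Y (check : X -> Y -> bool) :
    decodable X -> decodable Y -> computable (fun p : X * Y => check p.1 p.2) ->
    (forall x, exists y, check x y) ->
  exists2 f : X -> Y, computable f & forall x, check x (f x).
Proof.
move=> [rX cX XK] [rY cY YK] cc ex.
have [G [rG GE]] : computable (fun p : nat * nat => ~~ check (rX p.2) (rY p.1)).
  apply: computable_neg; apply: (computable_comp (f := fun p => (rX p.2, rY p.1)) cc).
  by apply: computable_pair; [apply: (computable_comp cX); apply: computable_snd
    | apply: (computable_comp cY); apply: computable_fst]; exact: computable_id.
have wit n : exists m, check (rX n) (rY m).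
  by have [y xy] := ex (rX n); exists (pickle y); rewrite YK.
pose F n := ex_minn (wit n).
have FP n : check (rX n) (rY (F n)) /\
    forall m, check (rX n) (rY m) -> (F n <= m)%N.
  by rewrite /F; case: (ex_minnP (wit n)).
have rF : rec1 F.
  have rg : recursive (fun y : 2.-tuple nat =>
      G (code_cons (thead y) (code_cons (thead (tbehead y)) 0))).
    apply: recursive_app1 rG _.
    apply: recursive_app2 rec2_code_cons (recursive_thead _) _.
    exact: recursive_app2 rec2_code_cons (recursive_second _) (recursive_const _ _).
  have arg m (x : 1.-tuple nat) : thead (tbehead [tuple of m :: x]) = thead x.
    by congr thead; apply: val_inj.
  apply: (recursive_mu rg) => [x|x m]; rewrite theadE arg.
    by rewrite (GE (_, _)) /= (FP _).1.
  rewrite (GE (m, _)) /= => lt_m; case E: (check _ _) => // _.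
  by move: lt_m; rewrite ltnNge (FP _).2.
exists (fun x => rY (F (pickle x))) => [|x]; last first.
  by have [] := FP (pickle x); rewrite XK.
apply: (computable_comp cY); apply: computable_rec1 rF _.
exact: computable_pickle (computable_id _).
Qed.

End Computable.
Lemma computable_app2 (X Y Z W : countType) (h : Y -> Z -> W) (f : X -> Y) (g : X -> Z) :
  computable (fun p : Y * Z => h p.1 p.2) -> computable f -> computable g ->
  computable (fun x => h (f x) (g x)).
Proof. by move=> ch cf cg; exact: computable_comp ch (computable_pair cf cg). Qed.

Section Sequences.

Implicit Types X Y Z : countType.

Lemma computable_Some X Y (f : X -> Y) :
  computable f -> computable (fun x => Some (f x)).
Proof.
move=> /computable_pickle cf.
exact: computable_recode (computable_rec2 rec2_code_cons cf (computable_const _ 0%N)).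
Qed.

Lemma computable_obind X Y Z (o : X -> option Y) (g : X -> Y -> Z) (h : X -> Z) :
    computable o -> computable (fun p : X * Y => g p.1 p.2) -> computable h ->
  computable (fun x => if o x is Some y then g x y else h x).
Proof.
move=> /computable_pickle co [G [rG GE]] ch.
have cpo : computable (fun x => G (code_cons (pickle x)
    (code_cons (code_head (pickle (o x))) 0))).
  apply: (computable_rec1 rG).
  apply: (computable_rec2 rec2_code_cons (computable_pickle (computable_id _))).
  apply: (computable_rec2 rec2_code_cons _ (computable_const _ _)).
  exact: computable_code_head co.
apply: computable_recode (computable_if (computable_eq0n co) (computable_pickle ch) cpo).
move=> x; case: (o x) => [y|] //=.
rewrite -[pickle (Some y)]/(CodeSeq.code [:: pickle y]) code_head_code.
rewrite ifN -?(GE (x, y)) //.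
by rewrite -lt0n muln_gt0 expn_gt0.
Qed.

Lemma computable_cons X Y (f : X -> Y) (g : X -> seq Y) :
  computable f -> computable g -> computable (fun x => f x :: g x).
Proof.
move=> /computable_pickle cf /computable_pickle cg.
exact: computable_recode (computable_rec2 rec2_code_cons cf cg).
Qed.

Lemma computable_behead X Y (f : X -> seq Y) :
  computable f -> computable (fun x => behead (f x)).
Proof.
move=> /computable_pickle /computable_code_tail; apply: computable_recode => x.
by rewrite [pickle (f x)]/pickle /= /pickle_seq code_tail_code behead_map.
Qed.

Lemma computable_drop X Y (n : X -> nat) (f : X -> seq Y) :
  computable n -> computable f -> computable (fun x => drop (n x) (f x)).
Proof.
move=> cn cf; apply: computable_ext (computable_nat_rect
  (s := fun _ _ s => behead s) cn cf _) => [x|].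
  by elim: (n x) => [|k /= ->]; rewrite ?drop0 // -drop1 drop_drop add1n.
apply: computable_behead; apply: computable_snd; apply: computable_snd.
exact: computable_id.
Qed.

Lemma computable_nth X Y (d : Y) (f : X -> seq Y) (n : X -> nat) :
  computable f -> computable n -> computable (fun x => nth d (f x) (n x)).
Proof.
move=> cf cn; have cs := computable_drop cn cf.
have ch := computable_code_head (computable_pickle cs).
apply: computable_recode (computable_if
  (computable_eq cs (computable_const _ [::])) (computable_const _ (pickle d)) ch).
move=> x; rewrite -(addn0 (n x)) -nth_drop addn0; case: (drop _ _) => [|y s] //=.
by rewrite [pickle (y :: s)]/pickle /= /pickle_seq code_head_code.
Qed.

Lemma computable_size X Y (f : X -> seq Y) :
  computable f -> computable (fun x => size (f x)).
Proof.
move=> cf.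
have size_code (s : seq Y) : (size s <= pickle s)%N.
  rewrite [pickle s]/pickle /= /pickle_seq; elim: s => //= y s IH.
  by rewrite (leq_trans _ (leq_pmull _ _)) ?expn_gt0 // ltnS -addnn (leq_trans IH) ?leq_addr.
apply: computable_ext (computable_nat_rect (n := fun x => pickle (f x)) (z := fun=> 0%N)
  (s := fun x k a => if drop k (f x) == [::] then a else a.+1)
  (computable_pickle cf) (computable_const _ _) _) => [x|].
  have E n : nat_rect (fun=> nat) 0%N (fun k a =>
      if drop k (f x) == [::] then a else a.+1) n = minn n (size (f x)).
    elim: n => [|n /= ->]; rewrite ?min0n // -size_eq0 size_drop subn_eq0.
    by case: leqP => h; [rewrite (minn_idPr (leqW h))
      | rewrite (minn_idPl h)].
  by rewrite E; apply/minn_idPr.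
have ca : computable (fun p : X * (nat * nat) => p.2.2).
  by do 2!apply: computable_snd; exact: computable_id.
apply: computable_if (ca) (computable_succn ca).
apply: computable_eq (computable_const _ _); apply: computable_drop.
  by apply: computable_fst; apply: computable_snd; exact: computable_id.
exact: computable_comp cf (computable_fst (computable_id _)).
Qed.

Lemma computable_mkseq X Y (F : X -> nat -> Y) (n : X -> nat) :
  computable (fun p : X * nat => F p.1 p.2) -> computable n ->
  computable (fun x => mkseq (F x) (n x)).
Proof.
move=> cF cn; apply: computable_ext (computable_nat_rect (z := fun=> [::])
  (s := fun x k s => F x (n x - k.+1)%N :: s) cn (computable_const _ _) _) => [x|].
  have E k : (k <= n x)%N ->
      nat_rect (fun=> seq Y) [::] (fun k s => F x (n x - k.+1)%N :: s) k =
      map (F x) (iota (n x - k) k).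
    by elim: k => //= k IH lt_k; rewrite IH 1?ltnW // subnSK.
  by rewrite E // subnn.
have c1 : computable (fun p : X * (nat * seq Y) => p.1).
  exact: computable_fst (computable_id _).
have c2 : computable (fun p : X * (nat * seq Y) => p.2.1).
  exact: computable_fst (computable_snd (computable_id _)).
apply: computable_cons; last by do 2!apply: computable_snd; exact: computable_id.
apply: (computable_app2 cF c1 _).
apply: computable_subn (computable_comp cn c1) _; exact: computable_succn.
Qed.

Lemma computable_all_lt X (P : X -> nat -> bool) (n : X -> nat) :
  computable (fun p : X * nat => P p.1 p.2) -> computable n ->
  computable (fun x => all (P x) (iota 0 (n x))).
Proof.
move=> cP cn; apply: computable_ext (computable_nat_rect (z := fun=> true)
  (s := fun x k b => b && P x k) cn (computable_const _ _) _) => [x|].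
  by elim: (n x) => // k IH; rewrite -addn1 iotaD all_cat -IH addn1 /= add0n andbT.
apply: computable_and; first by do 2!apply: computable_snd; exact: computable_id.
apply: (computable_app2 cP); first exact: computable_fst (computable_id _).
exact: computable_fst (computable_snd (computable_id _)).
Qed.

Lemma decodable_nat : decodable nat.
Proof. by exists id => //; exact: computable_id. Qed.

Lemma computable_decode : computable CodeSeq.decode.
Proof.
apply: computable_recode (computable_id _) => n.
by rewrite [RHS]/pickle /= /pickle_seq map_id CodeSeq.decodeK.
Qed.

Lemma decodable_pair X Y : decodable X -> decodable Y -> decodable (X * Y)%type.
Proof.
move=> [rX cX XK] [rY cY YK].
exists (fun n => (rX (nth 0 (CodeSeq.decode n) 0), rY (nth 0 (CodeSeq.decode n) 1)))%N.
  have cn i : computable (fun n => nth 0%N (CodeSeq.decode n) i).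
    exact: computable_nth computable_decode (computable_const _ _).
  exact: computable_pair (computable_comp cX (cn _)) (computable_comp cY (cn _)).
case=> x y; rewrite (_ : pickle (x, y) = CodeSeq.code [:: pickle x; pickle y]) //.
by rewrite CodeSeq.codeK /= XK YK.
Qed.

Lemma decodable_seq X : decodable X -> decodable (seq X).
Proof.
move=> [rX cX XK]; exists (fun n => mkseq (fun i => rX (nth 0%N (CodeSeq.decode n) i))
    (size (CodeSeq.decode n))) => [|s].
  apply: (@computable_mkseq nat X (fun n i => rX (nth 0%N (CodeSeq.decode n) i))).
    apply: computable_comp cX _; apply: computable_nth.
      exact: computable_comp computable_decode (computable_fst (computable_id _)).
    exact: computable_snd (computable_id _).
  exact: computable_size computable_decode.
rewrite [pickle s]/pickle /= /pickle_seq CodeSeq.codeK.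
rewrite size_map -[RHS](map_id s); apply: (@eq_from_nth _ (rX 0%N)) => [|i].
  by rewrite size_mkseq size_map.
rewrite size_mkseq => lt_i; rewrite nth_mkseq //.
by rewrite (nth_map (rX 0%N)) // (nth_map (rX 0%N)) // XK.
Qed.

Lemma decodable_option X : decodable X -> decodable (option X).
Proof.
move=> [rX cX XK]; exists (fun n => if n == 0%N then None else Some (rX (code_head n))).
  apply: computable_if (computable_const _ _) _.
    exact: computable_eq0n (computable_id _).
  apply: computable_Some; apply: computable_comp cX _.
  exact: computable_code_head (computable_id _).
case=> [x|] //; rewrite -[pickle (Some x)]/(CodeSeq.code [:: pickle x]) code_head_code.
by rewrite ifN ?XK // -lt0n muln_gt0 expn_gt0.
Qed.

Lemma decodable_recode X Y (e : Y -> X) (d : X -> Y) :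
  decodable X -> computable d -> (forall y, pickle (e y) = pickle y) -> cancel e d ->
  decodable Y.
Proof.
move=> [rX cX XK] cd pe ed; exists (fun n => d (rX n)); first exact: computable_comp.
by move=> y; rewrite -pe XK.
Qed.

End Sequences.
(** The goals [computable (fun x => E x)] below are settled by descending
    through the syntax of [E]; [computable_custom] is extended with the
    functions introduced later. *)
Ltac computable_custom := fail.

Ltac computability_step := lazymatch goal with
| |- computable (fun x => x) => exact: computable_id
| |- computable (fun _ => ?c) => exact: (computable_const _ c)
| |- computable (fun x => (@?f x).1) => apply: (@computable_fst _ _ _ f)
| |- computable (fun x => (@?f x).2) => apply: (@computable_snd _ _ _ f)
| |- computable (fun x => (@?f x, @?g x)) => apply: (@computable_pair _ _ _ f g)
| |- computable (fun x => (@?f x).+1) => apply: (@computable_succn _ f)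
| |- computable (fun x => addn (@?f x) (@?g x)) => apply: (@computable_addn _ f g)
| |- computable (fun x => muln (@?f x) (@?g x)) => apply: (@computable_muln _ f g)
| |- computable (fun x => subn (@?f x) (@?g x)) => apply: (@computable_subn _ f g)
| |- computable (fun x => expn (@?f x) (@?g x)) => apply: (@computable_expn _ f g)
| |- computable (fun x => nat_of_bool (@?f x)) => apply: (@computable_nat_of_bool _ f)
| |- computable (fun x => leq (@?f x) (@?g x)) => apply: (@computable_leq _ f g)
| |- computable (fun x => ~~ (@?f x)) => apply: (@computable_neg _ f)
| |- computable (fun x => (@?f x) && (@?g x)) => apply: (@computable_and _ f g)
| |- computable (fun x => (@?f x) || (@?g x)) => apply: (@computable_or _ f g)
| |- computable (fun x => (@?f x) == (@?g x)) => apply: (@computable_eq _ _ f g)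
| |- computable (fun x => Some (@?f x)) => apply: (@computable_Some _ _ f)
| |- computable (fun x => @?f x :: @?g x) => apply: (@computable_cons _ _ f g)
| |- computable (fun x => nth ?d (@?f x) (@?n x)) => apply: (@computable_nth _ _ d f n)
| |- computable (fun x => size (@?f x)) => apply: (@computable_size _ _ f)
| |- @computable ?X ?Y ?f => first
    [ assumption | computable_custom | simple apply computable_if
    | lazymatch f with
      | fun _ => _ => fail
      | _ => change (@computable X Y (fun x => f x))
      end ]
end.

Ltac computability := repeat (cbn beta; computability_step).

(** * Arithmetic is computable *)

Section Arithmetic.

Implicit Types X Y : countType.

Lemma computable_bigop X Y (idx : Y) (op : Monoid.law idx) (F : X -> nat -> Y)
    (n : X -> nat) :
    computable (fun p : Y * Y => op p.1 p.2) ->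
    computable (fun p : X * nat => F p.1 p.2) -> computable n ->
  computable (fun x => \big[op/idx]_(i < n x) F x i).
Proof.
move=> cop cF cn; apply: computable_ext (computable_nat_rect (z := fun=> idx)
  (s := fun x k s => op s (F x k)) cn (computable_const _ _) _) => [x|].
  by elim: (n x) => [|k /= ->]; rewrite ?big_ord0 // big_ord_recr.
apply: (computable_app2 cop); computability.
apply: (computable_app2 cF); computability.
Qed.

Lemma computable_nat_sum X (F : X -> nat -> nat) (n : X -> nat) :
  computable (fun p : X * nat => F p.1 p.2) -> computable n ->
  computable (fun x => \sum_(i < n x) F x i)%N.
Proof. by move=> cF cn; apply: computable_bigop => //=; computability. Qed.

(** The quotient counts the positive multiples of the divisor. *)
Lemma computable_divn X (f g : X -> nat) :
  computable f -> computable g -> computable (fun x => (f x %/ g x)%N).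
Proof.
move=> cf cg; apply: computable_ext (computable_nat_sum
  (F := fun x i => ((0 < g x) && (i.+1 * g x <= f x) : nat)%N) (n := f) _ cf) => [x|].
  case: (posnP (g x)) => [->|g0]; first by rewrite divn0 big1.
  under eq_bigr => i _ do rewrite -leq_divRL //=.
  have le : (f x %/ g x <= f x)%N by exact: leq_div.
  transitivity (\sum_(i < f x | i < f x %/ g x) 1)%N.
    by rewrite [RHS]big_mkcond; apply: eq_bigr => i _; case: ltnP.
  by rewrite -(big_ord_widen _ (fun=> 1%N)) // sum1_card card_ord.
by computability; [apply: computable_comp cg _ | apply: computable_comp cg _
  | apply: computable_comp cf _]; computability.
Qed.

Lemma computable_gcdn X (f g : X -> nat) :
  computable f -> computable g -> computable (fun x => gcdn (f x) (g x)).
Proof.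
move=> cf cg; apply: computable_ext (computable_nat_rect (z := fun=> 0%N)
  (n := fun x => (f x + g x)%N)
  (s := fun x k a => if (f x %/ k.+1 * k.+1 == f x)%N && (g x %/ k.+1 * k.+1 == g x)%N
                     then k.+1 else a) _ (computable_const _ _) _) => [x||].
- case: (posnP (f x + g x)%N) => [/eqP|fg_gt0].
    by rewrite addn_eq0 => /andP[/eqP-> /eqP->].
  have E n : (gcdn (f x) (g x) <= n)%N -> nat_rect (fun=> nat) 0%N (fun k a =>
      if (f x %/ k.+1 * k.+1 == f x)%N && (g x %/ k.+1 * k.+1 == g x)%N
      then k.+1 else a) n = gcdn (f x) (g x).
    elim: n => [|n IH] /=; first by rewrite leqn0 => /eqP.
    rewrite -!dvdn_eq -dvdn_gcd => le_n.
    case: ifP => [/dvdn_leq|ndvd].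
      by rewrite gcdn_gt0 -addn_gt0 => /(_ fg_gt0) le2; apply/eqP; rewrite eqn_leq le2.
    apply: IH; rewrite -ltnS ltn_neqAle le_n andbT.
    by apply: contraFneq ndvd => ->.
  apply: E; case: (posnP (f x)) fg_gt0 => [->|f0 _].
    by rewrite gcd0n.
  by rewrite (leq_trans (dvdn_leq f0 (dvdn_gcdl _ _))) ?leq_addr.
- by computability.
by computability; try apply: computable_divn; computability;
  try (apply: computable_comp cf _); try (apply: computable_comp cg _); computability.
Qed.

Definition int_pos (z : int) : nat := if z is Posz n then n else 0.
Definition int_neg (z : int) : nat := if z is Negz n then n.+1 else 0.

Lemma int_posneg z : z = (int_pos z)%:Z - (int_neg z)%:Z.
Proof. by case: z => n; rewrite ?subr0 // sub0r -NegzE. Qed.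

(** The code of an integer is the code of a pair of optional numbers, one for
    each constructor. *)
Lemma computable_int_pos X (f : X -> int) :
  computable f -> computable (fun x => int_pos (f x)).
Proof.
move=> cf; apply: computable_ext (computable_obind
  (o := fun x => if f x is Posz n then Some n else None) (g := fun _ n => n)
  (h := fun=> 0%N) _ _ _) => [x|||]; try by computability.
  by case: (f x).
apply: (@computable_recode _ _ _ (fun x => (if f x is Posz n then (Some n, None)
  else (None, Some (absz (f x)).-1)).1)) => [x|]; first by case: (f x).
apply: computable_fst; apply: computable_recode cf => x; by case: (f x).
Qed.

Lemma computable_int_neg X (f : X -> int) :
  computable f -> computable (fun x => int_neg (f x)).
Proof.
move=> cf; apply: computable_ext (computable_obind
  (o := fun x => if f x is Negz n then Some n else None) (g := fun _ n => n.+1)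
  (h := fun=> 0%N) _ _ _) => [x|||]; try by computability.
  by case: (f x).
apply: (@computable_recode _ _ _ (fun x => (if f x is Negz n then (None, Some n)
  else (Some (absz (f x)), None)).2)) => [x|]; first by case: (f x).
apply: computable_snd; apply: computable_recode cf => x; by case: (f x).
Qed.

Lemma computable_subz X (f g : X -> nat) :
  computable f -> computable g -> computable (fun x => (f x)%:Z - (g x)%:Z).
Proof.
move=> cf cg.
have cP : computable (fun n : nat => Posz n).
  by apply: (@computable_recode _ _ _ (fun n : nat => (Some n, None : option nat))) => //;
    computability.
have cN : computable (fun n : nat => Negz n).
  by apply: (@computable_recode _ _ _ (fun n : nat => (None : option nat, Some n))) => //;
    computability.
apply: (@computable_ext _ _ (fun x => if (g x <= f x)%N then Posz (f x - g x)%N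
    else Negz (g x - (f x).+1)%N)) => [x|].
  case: leqP => h; first by rewrite subzn.
  by rewrite NegzE subnSK // -subzn 1?ltnW // opprB.
computability; first by apply: (computable_comp cP); computability.
by apply: (computable_comp cN); computability.
Qed.

Lemma computable_addz X (f g : X -> int) :
  computable f -> computable g -> computable (fun x => f x + g x).
Proof.
move=> cf cg; apply: computable_ext (@computable_subz _
  (fun x => int_pos (f x) + int_pos (g x))%N (fun x => int_neg (f x) + int_neg (g x))%N _ _).
- by move=> x; rewrite [in RHS](int_posneg (f x)) [in RHS](int_posneg (g x)) !PoszD; ring.
- by computability; exact: computable_int_pos.
- by computability; exact: computable_int_neg.
Qed.

Lemma computable_oppz X (f : X -> int) : computable f -> computable (fun x => - f x).
Proof.
move=> cf; apply: computable_ext (@computable_subz _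
  (fun x => int_neg (f x)) (fun x => int_pos (f x)) _ _).
- by move=> x; rewrite [in RHS](int_posneg (f x)) opprB.
- exact: computable_int_neg.
- exact: computable_int_pos.
Qed.

Lemma computable_mulz X (f g : X -> int) :
  computable f -> computable g -> computable (fun x => f x * g x).
Proof.
move=> cf cg; apply: computable_ext (@computable_subz _
  (fun x => int_pos (f x) * int_pos (g x) + int_neg (f x) * int_neg (g x))%N
  (fun x => int_pos (f x) * int_neg (g x) + int_neg (f x) * int_pos (g x))%N _ _).
- move=> x; rewrite [in RHS](int_posneg (f x)) [in RHS](int_posneg (g x)).
  by rewrite !PoszD !PoszM; ring.
- by computability; try exact: computable_int_pos; exact: computable_int_neg.
- by computability; try exact: computable_int_pos; exact: computable_int_neg.
Qed.

Lemma computable_lez X (f g : X -> int) :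
  computable f -> computable g -> computable (fun x => f x <= g x).
Proof.
move=> cf cg; apply: (@computable_ext _ _ (fun x =>
  (int_pos (f x) + int_neg (g x) <= int_pos (g x) + int_neg (f x))%N)).
  move=> x; rewrite [in RHS](int_posneg (f x)) [in RHS](int_posneg (g x)).
  by rewrite lerBlDr addrAC lerBrDr -!PoszD lez_nat.
by computability; try exact: computable_int_pos; exact: computable_int_neg.
Qed.

End Arithmetic.
Section RatPoly.

Implicit Types X Y : countType.

Lemma computable_numq X (f : X -> rat) : computable f -> computable (fun x => numq (f x)).
Proof. by move=> cf; apply: computable_fst; apply: computable_recode cf. Qed.

Lemma computable_denq X (f : X -> rat) : computable f -> computable (fun x => denq (f x)).
Proof. by move=> cf; apply: computable_snd; apply: computable_recode cf. Qed.

(** The code of a rational number is that of its reduced fraction, so the common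
    divisor has to be removed. *)
Lemma computable_ratdiv X (n : X -> int) (d : X -> nat) :
  computable n -> computable d ->
  computable (fun x => (n x)%:~R / (d x).+1%:R : rat).
Proof.
move=> cn cd; pose g x := gcdn (int_pos (n x) + int_neg (n x)) (d x).+1.
pose n' x := (int_pos (n x) %/ g x)%:Z - (int_neg (n x) %/ g x)%:Z.
pose d' x := ((d x).+1 %/ g x)%N.
apply: (@computable_recode _ _ _ (fun x => (n' x, Posz (d' x)))) => [x|]; last first.
  have cg : computable g.
    by apply: computable_gcdn; computability;
      [exact: computable_int_pos | exact: computable_int_neg].
  have cn' : computable n'.
    by apply: computable_subz; apply: computable_divn => //;
      [exact: computable_int_pos | exact: computable_int_neg].
  have cd' : computable d' by apply: computable_divn => //; computability.
  apply: computable_pair cn' _.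
  apply: computable_ext (computable_subz cd' (computable_const _ 0%N)) => x.
  by rewrite subr0.
have g_gt0 : (0 < g x)%N by rewrite gcdn_gt0 orbT.
have absn : (int_pos (n x) + int_neg (n x))%N = absz (n x).
  by case: (n x) => k; rewrite /= ?addn0.
have nE : n x = n' x * (g x)%:Z.
  rewrite mulrBl -!PoszM !divnK -?int_posneg // (dvdn_trans (dvdn_gcdl _ _)) //.
    by case: (n x) => k /=; rewrite ?dvdn0 ?add0n.
  by case: (n x) => k /=; rewrite ?dvdn0 ?addn0.
have dE : (d x).+1 = (d' x * g x)%N by rewrite divnK // dvdn_gcdr.
have cop : coprime (absz (n' x)) (absz (d' x)%:Z).
  rewrite /coprime -(eqn_pmul2r g_gt0) muln_gcdl mul1n /= -dE.
  by rewrite {2}/g absn nE abszM.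
have d'_gt0 : (0 < d' x)%N by rewrite -(ltn_pmul2r g_gt0) mul0n -dE.
have -> : (n x)%:~R / (d x).+1%:R = (n' x)%:~R / (d' x)%:Z%:~R :> rat.
  rewrite {1}nE dE natrM intrM -!pmulrn -mulf_div divff ?mulr1 //.
  by rewrite pnatr_eq0 -lt0n.
rewrite [RHS](_ : _ = pickle (numq ((n' x)%:~R / (d' x)%:Z%:~R : rat),
                              denq ((n' x)%:~R / (d' x)%:Z%:~R))) //.
rewrite coprimeq_num // coprimeq_den // eqz_nat gtn_eqF //.
by rewrite gtr0_sg ?mul1r // ltz_nat.
Qed.

Lemma rat_div (a : rat) : a = (numq a)%:~R / (absz (denq a)).-1.+1%:R.
Proof. by rewrite prednK ?absz_gt0 ?denq_neq0 // pmulrn absz_denq divq_num_den. Qed.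

Lemma computable_absz X (f : X -> int) : computable f -> computable (fun x => absz (f x)).
Proof.
move=> cf; apply: computable_ext (computable_addn (computable_int_pos cf)
  (computable_int_neg cf)) => x.
by case: (f x) => k; rewrite /= ?addn0.
Qed.

Lemma computable_predn X (f : X -> nat) : computable f -> computable (fun x => (f x).-1).
Proof. exact: computable_rec1 rec1_pred. Qed.

Lemma computable_intr X (f : X -> int) :
  computable f -> computable (fun x => (f x)%:~R : rat).
Proof.
move=> cf; apply: computable_ext (computable_ratdiv cf (computable_const _ 0%N)) => x.
by rewrite divr1.
Qed.

Lemma computable_natr X (f : X -> nat) :
  computable f -> computable (fun x => (f x)%:R : rat).
Proof.
move=> cf; apply: computable_ext (computable_intr
  (computable_subz cf (computable_const _ 0%N))) => x.
by rewrite subr0.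
Qed.

(** A function of rational numbers whose value is computed from the reduced
    fractions of its arguments as a fraction with positive denominator. *)
Lemma computable_rat_fraction X (h : X -> rat) (n d : X -> int) :
    computable n -> computable d -> (forall x, 0 < d x) ->
    (forall x, h x = (n x)%:~R / (d x)%:~R) ->
  computable h.
Proof.
move=> cn cd d_gt0 hE; apply: computable_ext (computable_ratdiv cn
  (computable_predn (computable_absz cd))) => x.
by rewrite hE prednK ?absz_gt0 ?gt_eqF // pmulrn gtz0_abs.
Qed.

Lemma computable_addq X (f g : X -> rat) :
  computable f -> computable g -> computable (fun x => f x + g x).
Proof.
move=> cf cg; apply: (@computable_rat_fraction _ _
  (fun x => numq (f x) * denq (g x) + numq (g x) * denq (f x))
  (fun x => denq (f x) * denq (g x))) => [||x|x].
- by apply: computable_addz; apply: computable_mulz;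
    by [exact: computable_numq | exact: computable_denq].
- by apply: computable_mulz; exact: computable_denq.
- by rewrite mulr_gt0 ?denq_gt0.
by rewrite -{1}[f x]divq_num_den -{1}[g x]divq_num_den addf_div ?intr_eq0 ?denq_neq0 //
  intrD !intrM.
Qed.

Lemma computable_mulq X (f g : X -> rat) :
  computable f -> computable g -> computable (fun x => f x * g x).
Proof.
move=> cf cg; apply: (@computable_rat_fraction _ _
  (fun x => numq (f x) * numq (g x)) (fun x => denq (f x) * denq (g x))) => [||x|x].
- by apply: computable_mulz; exact: computable_numq.
- by apply: computable_mulz; exact: computable_denq.
- by rewrite mulr_gt0 ?denq_gt0.
by rewrite -{1}[f x]divq_num_den -{1}[g x]divq_num_den mulf_div !intrM.
Qed.

Lemma computable_oppq X (f : X -> rat) : computable f -> computable (fun x => - f x).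
Proof.
move=> cf; apply: (@computable_rat_fraction _ _
  (fun x => - numq (f x)) (fun x => denq (f x))) => [||x|x].
- by apply: computable_oppz; exact: computable_numq.
- exact: computable_denq.
- exact: denq_gt0.
by rewrite mulrNz mulNr divq_num_den.
Qed.

Lemma computable_leq_rat X (f g : X -> rat) :
  computable f -> computable g -> computable (fun x => f x <= g x).
Proof.
move=> cf cg; apply: (@computable_ext _ _
  (fun x => numq (f x) * denq (g x) <= numq (g x) * denq (f x))).
  by move=> x; rewrite -[f x in RHS]divq_num_den -[g x in RHS]divq_num_den
    ler_pdivrMr ?ltr0z ?denq_gt0 // mulrAC ler_pdivlMr ?ltr0z ?denq_gt0 // -!intrM ler_int.
by apply: computable_lez; apply: computable_mulz;
  by [exact: computable_numq | exact: computable_denq].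
Qed.

Lemma computable_ltq X (f g : X -> rat) :
  computable f -> computable g -> computable (fun x => f x < g x).
Proof.
move=> cf cg; apply: computable_ext (computable_neg (computable_leq_rat cg cf)) => x.
by rewrite -ltNge.
Qed.

Lemma computable_normq X (f : X -> rat) : computable f -> computable (fun x => `|f x|).
Proof.
move=> cf; apply: (@computable_ext _ _ (fun x => if 0 <= f x then f x else - f x)).
  by move=> x; case: ger0P.
by computability; [exact: computable_leq_rat (computable_const _ _) cf
  | exact: computable_oppq].
Qed.

End RatPoly.
Section Polynomials.

Implicit Types X Y : countType.

Lemma computable_polyseq X (T : countNzRingType) (f : X -> {poly T}) :
  computable f -> computable (fun x => polyseq (f x)).
Proof. exact: computable_recode. Qed.

(** A list of coefficients must not end in zeros, hence the case distinction. *)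
Lemma computable_cons_poly X (T : countNzRingType) (f : X -> T) (g : X -> {poly T}) :
  computable f -> computable g -> computable (fun x => cons_poly (f x) (g x)).
Proof.
move=> cf cg; apply: (@computable_recode _ _ _ (fun x =>
    if (g x == 0) && (f x == 0) then [::] else f x :: polyseq (g x))).
  move=> x; transitivity (pickle (polyseq (cons_poly (f x) (g x)))) => //.
  congr pickle; rewrite polyseq_cons nil_poly polyseqC.
  case: eqP => [->|] //=; rewrite polyseq0.
  by case: eqP.
by computability; exact: computable_polyseq.
Qed.

Lemma computable_poly X (T : countNzRingType) (F : X -> nat -> T) (n : X -> nat) :
  computable (fun p : X * nat => F p.1 p.2) -> computable n ->
  computable (fun x => \poly_(i < n x) F x i).
Proof.
move=> cF cn; apply: computable_ext (computable_nat_rect (z := fun=> 0 : {poly T})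
  (s := fun x k p => cons_poly (F x (n x - k.+1)%N) p) cn (computable_const _ _) _).
  move=> x; have E k : (k <= n x)%N -> nat_rect (fun=> {poly T} : Type) 0
      (fun k p => cons_poly (F x (n x - k.+1)%N) p) k =
      \poly_(i < k) F x (n x - k + i)%N.
    elim: k => [|k IH] le_k /=; first by apply/polyP => i; rewrite coef0 coef_poly.
    rewrite IH 1?ltnW //; apply/polyP => -[|i]; rewrite coef_cons !coef_poly ?addn0 //.
    by rewrite ltnS; case: ifP => // _; rewrite addnS -addSn subnSK.
  by rewrite E // subnn.
apply: computable_cons_poly; last by computability.
by apply: (computable_app2 cF); computability; apply: (computable_comp cn); computability.
Qed.

End Polynomials.

Ltac computable_rational := lazymatch goal with
| |- computable (fun x => polyseq (@?f x)) => apply: (@computable_polyseq _ _ f)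
| |- computable (fun x => numq (@?f x)) => apply: (@computable_numq _ f)
| |- computable (fun x => denq (@?f x)) => apply: (@computable_denq _ f)
| |- computable (fun x => (@?f x).-1) => apply: (@computable_predn _ f)
| |- computable (fun x => absz (@?f x)) => apply: (@computable_absz _ f)
| |- computable (fun x => (@?f x)%:~R) => apply: (@computable_intr _ f)
| |- computable (fun x => (@?f x)%:R) => apply: (@computable_natr _ f)
| |- computable (fun x => @?f x + @?g x) => apply: (@computable_addq _ f g)
| |- computable (fun x => @?f x * @?g x) => apply: (@computable_mulq _ f g)
| |- computable (fun x => - (@?f x)) => apply: (@computable_oppq _ f)
| |- computable (fun x => `|@?f x|) => apply: (@computable_normq _ f)
| |- computable (fun x => @?f x <= @?g x) => apply: (@computable_leq_rat _ f g)
| |- computable (fun x => @?f x < @?g x) => apply: (@computable_ltq _ f g)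
end.

Ltac computable_custom ::= computable_rational.

Section RatPolynomials.

Implicit Types X Y : countType.

Lemma computable_sumq X (F : X -> nat -> rat) (n : X -> nat) :
  computable (fun p : X * nat => F p.1 p.2) -> computable n ->
  computable (fun x => \sum_(i < n x) F x i).
Proof.
move=> cF cn; apply: (@computable_bigop _ rat 0 +%R F n _ cF cn).
by apply: (@computable_addq _ fst snd); computability.
Qed.

Lemma computable_maxn X (f g : X -> nat) :
  computable f -> computable g -> computable (fun x => maxn (f x) (g x)).
Proof.
move=> cf cg; apply: (@computable_ext _ _ (fun x => (f x + (g x - f x))%N)).
  by move=> x; rewrite maxnE.
by computability.
Qed.

Lemma computable_addp X (f g : X -> {poly rat}) :
  computable f -> computable g -> computable (fun x => f x + g x).
Proof.
move=> cf cg; apply: (@computable_ext _ _ (fun x =>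
  \poly_(i < maxn (size (f x)) (size (g x))) ((f x)`_i + (g x)`_i))).
  move=> x; apply/polyP => i; rewrite coef_poly coefD; case: ltnP => //.
  by rewrite geq_max => /andP[h1 h2]; rewrite !nth_default // addr0.
apply: computable_poly; last by apply: computable_maxn; computability.
by computability; [apply: (computable_comp cf) | apply: (computable_comp cg)];
  computability.
Qed.

Lemma computable_oppp X (f : X -> {poly rat}) :
  computable f -> computable (fun x => - f x).
Proof.
move=> cf; apply: (@computable_ext _ _ (fun x => \poly_(i < size (f x)) - (f x)`_i)).
  move=> x; apply/polyP => i; rewrite coef_poly coefN; case: ltnP => //.
  by move=> h; rewrite nth_default // oppr0.
apply: computable_poly; computability; apply: (computable_comp cf); computability.
Qed.

Lemma computable_mulp X (f g : X -> {poly rat}) :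
  computable f -> computable g -> computable (fun x => f x * g x).
Proof.
move=> cf cg; apply: (@computable_ext _ _ (fun x => \poly_(i < size (f x) + size (g x))
    \sum_(j < i.+1) (f x)`_j * (g x)`_(i - j))).
  move=> x; apply/polyP => i; rewrite coef_poly coefM; case: ltnP => // h.
  rewrite big1 // => j _; case: (ltnP j (size (f x))) => hj; last first.
    by rewrite nth_default ?mul0r.
  have le_ji : (j <= i)%N by rewrite -ltnS.
  by rewrite [X in _ * X]nth_default ?mulr0 // leq_subRL // (leq_trans _ h) // leq_add2r ltnW.
apply: computable_poly; last by computability.
apply: (@computable_sumq _ (fun (p : X * nat) j => (f p.1)`_j * (g p.1)`_(p.2 - j)));
  computability; (apply: (computable_comp cf) || apply: (computable_comp cg)); computability.
Qed.

Lemma computable_polyC X (f : X -> rat) : computable f -> computable (fun x => (f x)%:P).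
Proof.
move=> cf; apply: (@computable_ext _ _ (fun x => cons_poly (f x) 0)).
  by move=> x; rewrite cons_poly_def mul0r add0r.
by apply: computable_cons_poly; computability.
Qed.

Lemma computable_exprp X (f : X -> {poly rat}) (n : X -> nat) :
  computable f -> computable n -> computable (fun x => f x ^+ n x).
Proof.
move=> cf cn; apply: computable_ext (computable_nat_rect (z := fun=> 1 : {poly rat})
  (s := fun x _ p => f x * p) cn (computable_const _ _) _) => [x|].
  by elim: (n x) => //= k ->; rewrite exprS.
by apply: computable_mulp; computability; apply: (computable_comp cf); computability.
Qed.

Lemma computable_intr_poly X (f : X -> {poly int}) :
  computable f -> computable (fun x => map_poly (intr : int -> rat) (f x)).
Proof.
move=> cf; apply: (@computable_ext _ _ (fun x =>
    \poly_(i < size (f x)) (((f x)`_i)%:~R : rat))) => //.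
apply: (@computable_poly _ _ (fun x i => ((f x)`_i)%:~R : rat)); computability.
apply: (computable_comp cf); computability.
Qed.

Lemma computable_comp_poly X (f g : X -> {poly rat}) :
  computable f -> computable g -> computable (fun x => f x \Po g x).
Proof.
move=> cf cg; apply: (@computable_ext _ _ (fun x =>
    \sum_(i < size (f x)) ((f x)`_i)%:P * g x ^+ i)) => [x|].
  by rewrite comp_polyE; apply: eq_bigr => i _; rewrite mul_polyC.
apply: (@computable_bigop _ {poly rat} 0 +%R (fun x i => ((f x)`_i)%:P * g x ^+ i)).
- by apply: (@computable_addp _ fst snd); computability.
- apply: computable_mulp; [apply: computable_polyC | apply: computable_exprp];
    computability; (apply: (computable_comp cf) || apply: (computable_comp cg)); computability.
- by computability.
Qed.

(** The remainder of the division by a monic polynomial, computed by bringing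
    down the coefficients of the dividend one at a time. *)
Definition monic_rem (mu g : {poly rat}) : {poly rat} :=
  nat_rect (fun=> {poly rat} : Type) 0
    (fun k r => let t := cons_poly g`_(size g - k.+1) r in
       t - (t`_(size mu).-1)%:P * mu) (size g).

Lemma monic_remE (mu g : {poly rat}) : mu \is monic -> monic_rem mu g = g %% mu.
Proof.
move=> mon; have mu0 := monic_neq0 mon.
suff E k : (k <= size g)%N -> nat_rect (fun=> {poly rat} : Type) 0
    (fun k r => let t := cons_poly g`_(size g - k.+1) r in
       t - (t`_(size mu).-1)%:P * mu) k = (\poly_(i < k) g`_(size g - k + i)) %% mu.
  rewrite /monic_rem E // subnn; congr (_ %% _).
  by apply/polyP => i; rewrite coef_poly; case: ltnP => // h; rewrite nth_default.
elim: k => [|k IH] lek.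
  by rewrite (_ : \poly_(i < 0) _ = 0) ?mod0p //; apply/polyP => i; rewrite coef_poly coef0.
rewrite [LHS]/= IH 1?ltnW //; set P := \poly_(i < k) _; set c := g`_(size g - k.+1).
set t := cons_poly c (P %% mu).
have -> : \poly_(i < k.+1) g`_(size g - k.+1 + i) = P * 'X + c%:P.
  rewrite -cons_poly_def; apply/polyP => -[|i]; rewrite coef_cons !coef_poly ?addn0 //.
  by rewrite ltnS; case: ifP => // _; rewrite addnS -addSn subnSK.
have size_t : (size t <= size mu)%N.
  rewrite /t size_cons_poly; case: ifP => // _.
  by rewrite ltn_modp.
apply/esym; rewrite (_ : _ + _ = (P %/ mu * 'X + (t`_(size mu).-1)%:P) * mu
    + (t - (t`_(size mu).-1)%:P * mu)).
  rewrite modpD modp_mull add0r modp_small //.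
  have d_gt0 : (0 < size mu)%N by rewrite size_poly_gt0.
  rewrite -{2}(prednK d_gt0) ltnS; apply/leq_sizeP => j.
  rewrite leq_eqVlt => /predU1P[<-|lt_j].
    rewrite coefB coefCM -[X in _ * X]lead_coefE (monicP mon) mulr1 subrr //.
  have le_j : (size mu <= j)%N by rewrite -(prednK d_gt0).
  rewrite coefB coefCM (nth_default 0 (leq_trans size_t le_j)).
  by rewrite (nth_default 0 le_j) mulr0 subr0.
rewrite {1}(divp_eq P mu) /t cons_poly_def.
by ring.
Qed.

Lemma computable_monic_rem X (f g : X -> {poly rat}) :
  computable f -> computable g -> computable (fun x => monic_rem (f x) (g x)).
Proof.
move=> cf cg; have ct : computable (fun p : X * (nat * {poly rat}) =>
    cons_poly (g p.1)`_(size (g p.1) - p.2.1.+1) p.2.2).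
  by apply: computable_cons_poly; computability; apply: (computable_comp cg); computability.
apply: computable_nat_rect; computability.
apply: (computable_addp ct); apply: computable_oppp; apply: computable_mulp.
  by apply: computable_polyC; computability; apply: (computable_comp cf); computability.
by apply: (computable_comp cf); computability.
Qed.

Lemma decodable_int : decodable int.
Proof.
apply: (@decodable_recode (option nat * option nat)%type _
  (fun z => match z with Posz n => (Some n, None) | Negz n => (None, Some n) end)
  (fun o => (if o.1 is Some n then n else 0%N)%:Z -
            (if o.2 is Some n then n.+1 else 0%N)%:Z)).
- by apply: decodable_pair; apply: decodable_option; exact: decodable_nat.
- by apply: computable_subz; [apply: (@computable_obind _ _ _ _ (fun _ n => n)) |
    apply: (@computable_obind _ _ _ _ (fun _ n => n.+1))]; computability.
- by case.
by case=> n; rewrite ?subr0 // sub0r -NegzE.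
Qed.

Lemma decodable_rat : decodable rat.
Proof.
apply: (@decodable_recode (int * int)%type _ valq
  (fun o => o.1%:~R / (absz o.2).-1.+1%:R)) => [|||a].
- by apply: decodable_pair; exact: decodable_int.
- by apply: computable_ratdiv; [|apply: computable_predn; apply: computable_absz];
    computability.
- by [].
- by rewrite /= [RHS]rat_div /numq /denq; case: (valq a).
Qed.

Lemma decodable_poly (T : countNzRingType) : decodable T -> decodable {poly T}.
Proof.
move=> dT; apply: (@decodable_recode (seq T) _ (@polyseq T)
  (fun s => \poly_(i < size s) s`_i)) => // [||p].
- exact: decodable_seq.
- by apply: (@computable_poly _ T (fun s i => nth 0 s i)); computability.
- by apply/polyP => i; rewrite coef_poly; case: ltnP => // h; rewrite nth_default.
Qed.

End RatPolynomials.
(** * Rational polynomials at algebraic numbers and at their conjugates *)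

Definition qev (F : numFieldType) (t : F) : {poly rat} -> F :=
  horner_eval t \o map_poly (ratr : rat -> F).

HB.instance Definition _ (F : numFieldType) (t : F) :=
  GRing.RMorphism.copy (qev t) (horner_eval t \o map_poly (ratr : rat -> F)).

Section Evaluation.

Variables (F : numFieldType) (t : F).

Lemma qevC c : qev t c%:P = ratr c.
Proof. by rewrite /qev /= map_polyC /= /horner_eval hornerC. Qed.

Lemma qevX : qev t 'X = t.
Proof. by rewrite /qev /= map_polyX /horner_eval hornerX. Qed.

Lemma qevZ c p : qev t (c *: p) = ratr c * qev t p.
Proof. by rewrite -mul_polyC rmorphM /= qevC. Qed.

Lemma qev_comp p q : qev t (p \Po q) = qev (qev t q) p.
Proof. by rewrite /qev /= map_comp_poly /horner_eval horner_comp. Qed.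

Lemma qev_sum p : qev t p = \sum_(i < size p) ratr p`_i * t ^+ i.
Proof.
rewrite {1}/qev /= /horner_eval (@horner_coef_wide _ (size p)) ?size_poly //.
by apply: eq_bigr => i _; rewrite coef_map.
Qed.

Lemma qev_int (p : {poly int}) :
  qev t (map_poly intr p) = (map_poly intr p).[t].
Proof.
rewrite /qev /= /horner_eval -map_poly_comp; congr (_.[_]).
by apply: eq_map_poly => z /=; rewrite ratr_int.
Qed.

End Evaluation.

Lemma map_intr_neq0 (F : numDomainType) (p : {poly int}) :
  p != 0 -> map_poly (intr : int -> F) p != 0.
Proof. by move=> p0; rewrite map_poly_eq0_id0 // intr_eq0 lead_coef_eq0. Qed.

Definition is_minpoly (F : numFieldType) (t : F) (mu : {poly rat}) :=
  mu \is monic /\ forall g, (qev t g == 0) = (mu %| g).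

Lemma minpoly_exists (F : numFieldType) (t : F) :
  algebraicOver (ratr : rat -> F) t -> exists mu, is_minpoly t mu.
Proof.
case=> p p0 rp; pose P n := `[< exists q : {poly rat}, [/\ q != 0, size q = n & qev t q = 0] >].
have exP : exists n, P n by exists (size p); apply/asboolP; exists p; split=> //; apply/eqP.
case: (ex_minnP exP) => n /asboolP[q [q0 sq qt0]] nmin.
have lq0 : lead_coef q != 0 by rewrite lead_coef_eq0.
exists ((lead_coef q)^-1 *: q); split.
  by rewrite monicE lead_coefZ mulVf.
move=> g; rewrite dvdpZl ?invr_eq0 //; apply/eqP/idP => [gt0|/dvdpP[h ->]]; last first.
  by rewrite rmorphM /= qt0 mulr0.
rewrite /dvdp; apply: contraT => r0.
have : P (size (g %% q)).
  apply/asboolP; exists (g %% q); split=> //.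
  by move: gt0; rewrite {1}(divp_eq g q) rmorphD rmorphM /= qt0 mulr0 add0r.
by move/nmin; rewrite -sq leqNgt ltn_modp q0.
Qed.

(** Polynomial identities between values at [t] carry over to the conjugates of
    [t], which are taken in [algC]. *)
Lemma minpoly_conj (F : numFieldType) (t : F) (mu : {poly rat}) (z : algC) g :
  is_minpoly t mu -> qev z mu = 0 -> qev t g = 0 -> qev z g = 0.
Proof.
move=> [_ mumin] z0 /eqP; rewrite mumin => /dvdpP[h ->].
by rewrite rmorphM /= z0 mulr0.
Qed.

Lemma minpoly_size (F : numFieldType) (t : F) (mu : {poly rat}) :
  is_minpoly t mu -> (1 < size mu)%N.
Proof.
move=> [mon mumin]; rewrite ltnNge; apply/negP => /size1_polyC E.
have := mumin mu; rewrite dvdpp E qevC fmorph_eq0 => /eqP c0.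
by move: (monic_neq0 mon); rewrite E c0 eqxx.
Qed.

(** The polynomial is the characteristic polynomial of the multiplication by [g]
    on [Q[X]/(mu)]. An eigenvector of the multiplication by ['X] for the
    eigenvalue [z] is one of the multiplication by [g] for the value of [g] at
    [z], and all eigenvalues arise in this way: if [mu] and [g - x] had no common
    root, then [g - x] would be invertible modulo [mu]. *)
Lemma conjugate_poly (F : numFieldType) (t : F) (mu g : {poly rat}) :
    is_minpoly t mu ->
  exists f : {poly rat}, [/\ f \is monic, size f = size mu, qev (qev t g) f = 0 &
    forall x : algC, qev x f = 0 -> exists2 z : algC, qev z mu = 0 & x = qev z g].
Proof.
move=> mumin; have s1 := minpoly_size mumin; have [mon mudvd] := mumin.
have [n [A Amu]] : exists n, exists A : 'M[rat]_n.+1, char_poly A = mu.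
  exists (size mu).-2; have : exists A : 'M[rat]_((size mu).-1), char_poly A = mu.
    by exists (companionmx mu); exact: companionmxK.
  by have -> : (size mu).-1 = (size mu).-2.+1 by case: (size mu) s1 => [|[]].
have rootE (K : numFieldType) (B : 'M[rat]_n.+1) (x : K) :
    (qev x (char_poly B) == 0) = eigenvalue (map_mx ratr B) x.
  by rewrite eigenvalue_root_char -map_char_poly.
exists (char_poly (horner_mx A g)); split.
- exact: char_poly_monic.
- by rewrite -Amu !size_char_poly.
- apply/eqP; rewrite rootE; have /eqP : qev t mu = 0 by apply/eqP; rewrite mudvd.
  rewrite -Amu rootE => /eigenvalueP[v vA v0]; apply/eigenvalueP; exists v => //.
  rewrite map_horner_mx /qev /= /horner_eval; elim/poly_ind: (map_poly _ _) => [|p c IH].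
    by rewrite rmorph0 mulmx0 horner0 scale0r.
  rewrite rmorphD rmorphM /= horner_mx_X horner_mx_C mulmxDr mulmxA IH.
  by rewrite hornerMXaddC -scalemxAl vA scalerA mul_mx_scalar scalerDl.
move=> x /eqP; rewrite rootE map_horner_mx => /eigenvalueP[v vA v0].
set B := map_mx _ A in vA; set G := map_poly ratr g in vA.
have muB : horner_mx B (map_poly ratr mu) = 0.
  by rewrite -Amu map_char_poly Cayley_Hamilton.
have [z z1 z2] : exists2 z, root (map_poly ratr mu) z & root (G - x%:P) z.
  have /closed_rootP[z] : size (gcdp (map_poly ratr mu) (G - x%:P)) != 1%N.
    apply/negP => /(Bezout_coprimepP _ _)[[u w]] /= /eqpP[[c1 c2] /= /andP[c10 c20] E].
    have := congr1 (horner_mx B) E.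
    rewrite !linearZ /= rmorphD !rmorphM /= muB mulr0 add0r rmorphB /= horner_mx_C rmorph1.
    move/(congr1 (mulmx v)); rewrite -scalemxAr.
    have -> : v *m (horner_mx B w * (horner_mx B G - x%:M)) = 0.
      rewrite (_ : horner_mx B w * _ = (horner_mx B G - x%:M) *m horner_mx B w).
        by rewrite mulmxA mulmxBr vA mul_mx_scalar subrr mul0mx.
      rewrite -(horner_mx_C B x) -rmorphB /= -[RHS]/(_ * _) -!rmorphM /=.
      by rewrite mulrC.
    rewrite scaler0 -scalemxAr mulmx1 => /esym/eqP; rewrite scaler_eq0 (negPf v0) orbF.
    by rewrite (negPf c20).
  by rewrite root_gcd => /andP[]; exists z.
exists z; first exact/eqP.
by move: z2; rewrite /root !hornerE subr_eq0 => /eqP.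
Qed.
(** * Finiteness of bounded algebraic integers *)

Definition algint (x : algC) := integralOver (intr : int -> algC) x.

(** The image at [t] of [g] is an algebraic integer all of whose conjugates are
    bounded by [T], when [mu] is the minimal polynomial of [t]. *)
Definition conj_bounded (mu : {poly rat}) (T : nat) (g : {poly rat}) :=
  forall z : algC, qev z mu = 0 -> algint (qev z g) /\ `|qev z g| <= T%:R.

Definition int_poly_box (d M : nat) (f : {poly rat}) :=
  [/\ f \is monic, size f = d.+1 &
      forall i, f`_i \is a Num.int /\ `|f`_i| <= M%:R].

Lemma algint_rat (a : rat) : algint (ratr a) -> a \is a Num.int.
Proof.
case=> p mon r; rewrite -Cint_rat; apply: Cint_rat_Aint.
  by apply/CratP; exists a.
apply: root_monic_Aint r _ _; first exact: monic_map.
apply/polyOverP => i; rewrite coef_map /=; exact: intr_int.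
Qed.

Lemma algint_nat n : algint n%:R.
Proof. by rewrite -[n%:R]/(n%:Z%:~R); exact: integral_id. Qed.

Lemma algint_expr (x : algC) n : algint x -> algint (x ^+ n).
Proof.
by move=> ix; elim: n => [|n IH]; rewrite ?expr0 ?exprS; [exact: integral1 | exact: integral_mul].
Qed.

Lemma algint_expr_root (x : algC) n : (0 < n)%N -> algint (x ^+ n) -> algint x.
Proof.
move=> n_gt0 ix; have mon : 'X^n - (x ^+ n)%:P \is monic.
  by rewrite monicE lead_coefXnsubC.
apply: (integral_root_monic mon) => [|]; first by rewrite /root !hornerE subrr.
move=> y /(nthP 0)[i lti <-]; rewrite coefB coefXn coefC; apply: integral_sub.
  exact: algint_nat.
by case: eqP => // _; exact: (algint_nat 0).
Qed.

Lemma prod_XsubC_coef (s : seq algC) (T : nat) :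
    (forall z, z \in s -> algint z /\ `|z| <= T%:R) ->
  forall k, algint (\prod_(z <- s) ('X - z%:P))`_k /\
    `|(\prod_(z <- s) ('X - z%:P))`_k| <= ((1 + T) ^ size s)%:R.
Proof.
elim: s => [|z s IH] sT k.
  rewrite big_nil coef1; case: eqP => _.
    by split; [exact: integral1 | rewrite normr1].
  by split; [exact: (algint_nat 0) | rewrite normr0].
have [iz bz] := sT z (mem_head _ _).
have {}IH := IH (fun y ys => sT y (mem_behead (s := z :: s) ys)).
rewrite big_cons mulrBl coefB coefXM coefCM /=.
have [ik bk] := IH k; split.
  apply: integral_sub; last exact: integral_mul.
  by case: eqP => _; [exact: (algint_nat 0) | exact: (IH _).1].
rewrite expnS natrM natrD mulrDl mul1r (le_trans (ler_normB _ _)) // lerD //.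
  by case: eqP => _; [rewrite normr0 ler0n | exact: (IH _).2].
by rewrite normrM ler_pM.
Qed.

(** The coefficients of the characteristic polynomial are rational, and
    as symmetric functions of the conjugates they are bounded algebraic integers. *)
Lemma bounded_integer_poly (F : numFieldType) (t : F) (mu g : {poly rat}) (T : nat) :
    is_minpoly t mu -> conj_bounded mu T g ->
  exists2 f, int_poly_box (size mu).-1 ((1 + T) ^ (size mu).-1) f & qev (qev t g) f = 0.
Proof.
move=> mumin gT; have [f [mon sf f0 fconj]] := conjugate_poly g mumin.
have s1 := minpoly_size mumin.
exists f => //; split=> // [|i]; first by rewrite sf prednK // ltnW.
have [s] := closed_field_poly_normal (map_poly (ratr : rat -> algC) f).
rewrite lead_coef_map (monicP mon) rmorph1 scale1r => E.
have sT z : z \in s -> algint z /\ `|z| <= T%:R.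
  move=> zs; have : qev z f = 0.
    by apply/eqP; rewrite -/(root _ z) E root_prod_XsubC.
  by case/fconj => y y0 ->; exact: gT.
have ss : size s = (size mu).-1.
  by rewrite -sf -(size_map_poly (ratr : {rmorphism rat -> algC}) f) E size_prod_XsubC.
have [ii bi] := prod_XsubC_coef sT i; move: ii bi.
rewrite -E coef_map /= ss => ii; split; first exact: algint_rat.
by move: bi; rewrite -(ratr_nat algC) -ratr_norm ler_rat.
Qed.

Lemma count_box_roots (F : numFieldType) (d M : nat) (s : seq F) :
    uniq s -> (forall x, x \in s -> exists2 f, int_poly_box d M f & qev x f = 0) ->
  (size s <= d * (2 * M + 1) ^ d)%N.
Proof.
move=> us sbox.
pose poly_of (c : {ffun 'I_d -> 'I_(2 * M + 1)}) : {poly rat} :=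
  'X^d + \poly_(i < d) (if insub i is Some j then (c j)%:R - M%:R else 0).
pose roots c := [seq x <- s | root (map_poly (ratr : rat -> F) (poly_of c)) x].
have sizeP c : size (poly_of c) = d.+1.
  by rewrite size_polyDl size_polyXn // ltnS size_poly.
have sub : {subset s <= flatten [seq roots c | c : {ffun 'I_d -> 'I_(2 * M + 1)}]}.
  move=> x xs; have [f [mon sf fbox] fx] := sbox x xs.
  have cP (i : 'I_d) : (absz (numq (f`_i + M%:R)) < 2 * M + 1)%N.
    have [fi fM] := fbox i; have /intrP[k kE] := fi.
    rewrite kE -[M%:R]/(M%:Z%:~R) -intrD numq_int.
    move: fM; rewrite kE -[M%:R]/(M%:Z%:~R) -intr_norm ler_int; lia.
  apply/flattenP; exists (roots [ffun i => Ordinal (cP i)]); first exact: map_f (mem_enum _ _).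
  rewrite mem_filter xs andbT; suff -> : poly_of [ffun i => Ordinal (cP i)] = f.
    by apply/eqP.
  apply/polyP => i; rewrite coefD coefXn coef_poly; case: (ltngtP i d) => h.
  - rewrite add0r insubT ffunE /=; have [fi fM] := fbox i; have /intrP[k kE] := fi.
    rewrite kE -[M%:R]/(M%:Z%:~R) -intrD numq_int.
    move: fM; rewrite kE -[M%:R]/(M%:Z%:~R) -intr_norm ler_int => fM.
    by rewrite pmulrn -intrB gez0_abs ?addrK //; lia.
  - by rewrite nth_default ?addr0 // sf.
  - by rewrite addr0 h; move/monicP: mon; rewrite /lead_coef sf.
have {sub} := uniq_leq_size us sub; move/leq_trans; apply.
rewrite size_flatten /shape -map_comp sumnE big_map.
rewrite (@leq_trans (\sum_(c in {ffun 'I_d -> 'I_(2 * M + 1)}) d)) //.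
  rewrite big_enum /=; apply: leq_sum => c _ /=.
  have p0 : map_poly (ratr : rat -> F) (poly_of c) != 0.
    by rewrite map_poly_eq0 -size_poly_eq0 sizeP.
  by rewrite -ltnS -(sizeP c) -(size_map_poly (ratr : {rmorphism rat -> F}))
    max_poly_roots ?filter_uniq // filter_all.
by rewrite sum_nat_const card_ffun !card_ord mulnC.
Qed.
(** * Small exponents in multiplicative relations *)

Lemma qev_monomial (F : numFieldType) (t : F) n (q : 'I_n -> {poly rat}) (r : 'I_n -> nat) :
  qev t (\prod_i q i ^+ r i) = \prod_i qev t (q i) ^+ r i.
Proof. by rewrite rmorph_prod; apply: eq_bigr => i _; rewrite rmorphXn. Qed.

(** The number of roots of the polynomials in the box of [bounded_integer_poly],
    for a number of degree [d] that is a product of [n] factors. *)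
Definition relation_count (d n e T : nat) :=
  (d * (2 * (1 + (e * T) ^ n) ^ d + 1) ^ d)%N.

(** Squared, because two relations are to hold simultaneously. *)
Definition relation_bound (d n e T : nat) := (relation_count d n e T ^ 2)%N.

Section Relations.

Variables (F : numFieldType) (t : F) (mu : {poly rat}).
Hypothesis mumin : is_minpoly t mu.
Variables (n e T : nat).
Hypotheses (e_gt0 : (0 < e)%N) (T_gt0 : (0 < T)%N).

Definition bounded_unit (x : F) := exists q q' : {poly rat},
  [/\ x = qev t q, x * qev t q' = 1 & conj_bounded mu T (e%:R *: q)].

Lemma bounded_unit_neq0 x : bounded_unit x -> x != 0.
Proof.
by case=> q [q' [_ xq _]]; apply: contra_eqN xq => /eqP ->; rewrite mul0r eq_sym oner_neq0.
Qed.

(** Integrality and the size of the conjugates pass from the power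
    [w ^+ b] to [w]; as the exponents [r i] do not exceed [b], the bounds that
    come out do not depend on [b]. *)
Lemma conj_bounded_root (q : 'I_n -> {poly rat}) (g : {poly rat}) b (r : 'I_n -> nat) :
    (0 < b)%N -> (forall i, (r i <= b)%N) ->
    (forall i, conj_bounded mu T (e%:R *: q i)) ->
    qev t g ^+ b = \prod_i qev t (q i) ^+ r i ->
  conj_bounded mu ((e * T) ^ n) ((e ^ n)%:R *: g).
Proof.
move=> b_gt0 rb qT wE z z0.
(* The relation holds at the conjugate [z] as well; of the [b] factors [e]
   belonging to [q i], as many as there are factors [q i] make these integral. *)
have E : qev z ((e ^ n)%:R *: g) ^+ b =
    \prod_i (e%:R ^+ (b - r i) * qev z (e%:R *: q i) ^+ r i).
  have := minpoly_conj (g := g ^+ b - \prod_i q i ^+ r i) mumin z0.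
  rewrite !rmorphB /= !rmorphXn /= !qev_monomial wE subrr => /(_ erefl)/eqP; rewrite subr_eq0 => /eqP gE.
  transitivity (\prod_i (e%:R ^+ b * qev z (q i) ^+ r i)); last first.
    apply: eq_bigr => i _; rewrite qevZ (ratr_nat algC) exprMn mulrA -exprD subnK //.
  rewrite big_split /= -gE prodr_const card_ord qevZ -?natrX (ratr_nat algC) exprMn.
  by rewrite -!natrX -!expnM mulnC.
have bT i : `|qev z (e%:R *: q i)| <= T%:R by have [] := qT i z z0.
split.
  apply: (algint_expr_root b_gt0); rewrite E.
  apply: (big_ind algint) => [||i _]; [exact: (algint_nat 1) | exact: integral_mul |].
  apply: integral_mul; first by rewrite -natrX; exact: algint_nat.
  by apply: algint_expr; have [] := qT i z z0.
rewrite -(@ler_pXn2r _ b) ?nnegrE ?ler0n // -normrX E normr_prod.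
have -> : ((e * T) ^ n)%:R ^+ b = \prod_(i < n) ((e * T)%:R ^+ b) :> algC.
  by rewrite prodr_const card_ord natrX exprAC.
apply: ler_prod => i _; rewrite normr_ge0 /= normrM !normrX normr_nat.
rewrite -{2}(subnK (rb i)) exprD ler_pM ?exprn_ge0 ?normr_ge0 ?ler0n //.
  by rewrite lerXn2r ?nnegrE ?ler0n // ler_nat leq_pmulr.
rewrite lerXn2r ?nnegrE ?normr_ge0 ?ler0n // (le_trans (bT i)) // ler_nat.
by rewrite leq_pmull.
Qed.

(** Raised to the power [b l], this becomes a monomial in the [x i] with
    exponents smaller than [b l], if [b] is a relation. *)
Definition rounded_monomial (x : 'I_n -> F) (b : 'I_n -> nat) (l : 'I_n) (m : nat) :=
  \prod_i (x i)^-1 ^+ ((m * b i) %/ b l).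

Lemma rounded_monomial_count (x : 'I_n -> F) (b : 'I_n -> nat) l N :
    (forall i, bounded_unit (x i)) -> \prod_i x i ^+ b i = 1 -> (0 < b l)%N ->
  (size (undup (map (rounded_monomial x b l) (iota 0 N))) <= relation_count (size mu).-1 n e T)%N.
Proof.
move=> xu xb bl; set w := rounded_monomial x b l.
have en0 : (e ^ n)%:R != 0 :> F by rewrite pnatr_eq0 -lt0n expn_gt0 e_gt0.
rewrite -(size_map (fun y => (e ^ n)%:R * y)).
apply: count_box_roots => [|_ /mapP[y + ->]].
  by rewrite map_inj_uniq ?undup_uniq //; exact: mulfI.
rewrite mem_undup => /mapP[m _ ->] {y}.
have [q qP] := choice xu; have [q' qq'] := choice qP.
pose g := \prod_i q' i ^+ ((m * b i) %/ b l).
have xV i : (x i)^-1 = qev t (q' i).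
  have [_ E _] := qq' i; apply: (mulfI (bounded_unit_neq0 (xu i))).
  by rewrite E divff // bounded_unit_neq0.
have wg : w m = qev t g.
  by rewrite /w /g qev_monomial; apply: eq_bigr => i _; rewrite -xV.
have -> : (e ^ n)%:R * w m = qev t ((e ^ n)%:R *: g) by rewrite qevZ ratr_nat wg.
apply: (bounded_integer_poly mumin).
apply: (@conj_bounded_root q g (b l) (fun i => (m * b i) %% b l)%N) => //.
- by move=> i; rewrite ltnW // ltn_pmod.
- by move=> i; have [] := qq' i.
rewrite -wg /w /rounded_monomial -prodrXl.
have xbm : \prod_i (x i ^+ b i) ^+ m = 1 by rewrite prodrXl xb expr1n.
rewrite -[LHS]mulr1 -[X in _ * X = _]xbm -big_split /=; apply: eq_bigr => i _.
have [<- _ _] := qq' i; rewrite -!exprM [(b i * m)%N]mulnC {2}(divn_eq (m * b i) (b l)).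
by rewrite exprD mulrA -exprMn mulVf ?expr1n ?mul1r // bounded_unit_neq0.
Qed.

Lemma pigeonhole_pairs (w1 w2 : nat -> F) N :
    (forall N', size (undup (map w1 (iota 0 N'))) <= N)%N ->
    (forall N', size (undup (map w2 (iota 0 N'))) <= N)%N ->
  exists m m', [/\ (m < m')%N, (m' <= N ^ 2)%N, w1 m = w1 m' & w2 m = w2 m'].
Proof.
move=> h1 h2; pose s := [seq (w1 m, w2 m) | m <- iota 0 (N ^ 2).+1].
have ss : size s = (N ^ 2).+1 by rewrite size_map size_iota.
have : ~~ uniq s.
  apply/negP => us; pose u w := undup [seq w m | m <- iota 0 (N ^ 2).+1] : seq F.
  have : {subset s <= [seq (a, b) | a <- u w1, b <- u w2]}.
    move=> _ /mapP[m mN ->]; apply: allpairs_f; rewrite mem_undup; exact: map_f.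
  move/(uniq_leq_size us); rewrite ss size_allpairs; apply/negP.
  by rewrite -leqNgt -mulnn leq_mul // (h1, h2).
case/(uniqPn (w1 0, w2 0))%N => m [m' [lt]]; rewrite ss ltnS => le.
have lt' := leq_trans lt le.
rewrite !(nth_map 0%N) ?size_iota ?ltnS // 1?ltnW // !nth_iota ?ltnS // 1?ltnW // !add0n.
by case=> E1 E2; exists m, m'.
Qed.

Let bound := relation_bound (size mu).-1 n e T.

Section TwoRelations.

Variables x1 x2 : 'I_n -> F.
Hypotheses (u1 : forall i, bounded_unit (x1 i)) (u2 : forall i, bounded_unit (x2 i)).

Definition is_relation (b : 'I_n -> nat) :=
  \prod_i x1 i ^+ b i = 1 /\ \prod_i x2 i ^+ b i = 1.

Lemma relation_diff b k : (forall i, (k i <= b i)%N) ->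
  is_relation b -> is_relation k -> is_relation (fun i => b i - k i)%N.
Proof.
move=> kb [b1 b2] [k1 k2].
have key (x : 'I_n -> F) : \prod_i x i ^+ b i = 1 -> \prod_i x i ^+ k i = 1 ->
    \prod_i x i ^+ (b i - k i) = 1.
  move=> xb xk; rewrite -[LHS]mulr1 -[X in _ * X]xk -big_split -[RHS]xb.
  by apply: eq_bigr => i _ /=; rewrite -exprD subnK.
by split; exact: key.
Qed.

(** Rounding down is monotone, so the difference of two rounded multiples of
    [b / b l] is nonnegative, and it does not exceed [b] for multiples up to
    [b l]. *)
Lemma relation_split b l : is_relation b -> (bound < b l)%N ->
  exists k, [/\ is_relation k, forall i, (k i <= b i)%N & (0 < k l < b l)%N].
Proof.
move=> [b1 b2] lt_l; have bl : (0 < b l)%N by exact: leq_ltn_trans lt_l.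
have [m [m' [lt le E1 E2]]] := pigeonhole_pairs
  (fun N => rounded_monomial_count N u1 b1 bl) (fun N => rounded_monomial_count N u2 b2 bl).
have mb i : ((m * b i) %/ b l <= (m' * b i) %/ b l)%N.
  by rewrite leq_div2r // leq_mul2r ltnW ?orbT.
exists (fun i => (m' * b i) %/ b l - (m * b i) %/ b l)%N; split=> [|i|].
- have key (x : 'I_n -> F) : (forall i, bounded_unit (x i)) ->
      rounded_monomial x b l m = rounded_monomial x b l m' ->
      \prod_i x i ^+ ((m' * b i) %/ b l - (m * b i) %/ b l) = 1.
    move=> xu; rewrite /rounded_monomial; set A := \prod_i _; set B := \prod_i _ => AB.
    have B0 : B != 0.
      by apply/prodf_neq0 => i _; rewrite expf_neq0 ?invr_eq0 ?bounded_unit_neq0.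
    apply: (mulIf B0); rewrite mul1r -{2}AB -big_split; apply: eq_bigr => i _ /=.
    rewrite -{2}(subnK (mb i)) exprD mulrA -exprMn divff ?expr1n ?mul1r //.
    exact: bounded_unit_neq0.
  by split; exact: key.
- rewrite (leq_trans (leq_subr _ _)) // -[X in (_ <= X)%N](mulKn (b i) bl).
  by rewrite leq_div2r // leq_mul2r (leq_trans le) ?orbT // ltnW.
- rewrite /= !mulnK // subn_gt0 lt /= (leq_ltn_trans (leq_subr _ _)) //.
  exact: leq_ltn_trans lt_l.
Qed.

(** One of the two parts of a relation with a large exponent still has a
    positive exponent at [l]. *)
Lemma small_relation_at b l : is_relation b -> (0 < b l)%N ->
  exists k, [/\ is_relation k, (0 < k l)%N, forall i, (k i <= bound)%N
    & forall i, (k i <= b i)%N].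
Proof.
have [N] := ubnP (\sum_i b i); elim: N b => // N IH b sN rb bl.
have [small|/existsNP[i /negP]] := pselect (forall i, b i <= bound)%N.
  by exists b.
rewrite -ltnNge => big_i.
have [k [rk kb /andP[ki0 kib]]] := relation_split rb big_i.
have sum_lt c : (forall i, (c i <= b i)%N) -> (c i < b i)%N -> (\sum_i c i < \sum_i b i)%N.
  move=> cb ci; rewrite (bigD1 i) //= [X in (_ < X)%N](bigD1 i) //=.
  by rewrite -addSn leq_add // leq_sum.
case: (posnP (k l)) => kl.
  have [||c [rc cl cB cb]] := IH _ _ (relation_diff kb rb rk).
  - rewrite -ltnS; apply: leq_trans sN; apply: sum_lt => [j|]; first exact: leq_subr.
    by rewrite ltn_subrL ki0 (leq_ltn_trans _ kib).
  - by rewrite kl subn0.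
  by exists c; split=> // j; rewrite (leq_trans (cb j)) ?leq_subr.
have [||c [rc cl cB cb]] := IH k _ rk => //.
  by rewrite -ltnS; apply: leq_trans sN; exact: sum_lt.
by exists c; split=> // j; rewrite (leq_trans (cb j)).
Qed.

(** All exponents being natural numbers, nothing cancels when one small relation
    is added up for each coordinate. *)
Lemma small_relation b : is_relation b -> (forall i, 0 < b i)%N ->
  exists2 k, is_relation k & forall i, (0 < k i <= n * bound)%N.
Proof.
move=> rb b_gt0; have [k kP] := choice (fun l => small_relation_at rb (b_gt0 l)).
exists (fun i => \sum_l k l i)%N => [|i]; last first.
  apply/andP; split.
    by rewrite (bigD1 i) //= ltn_addr //; have [] := kP i.
  rewrite -[X in (_ <= X * _)%N](card_ord n) -sum_nat_const; apply: leq_sum => l _.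
  by have [] := kP l.
by split; under eq_bigr => i _ do rewrite -prodrXr;
  rewrite exchange_big big1 //= => l _; have [[]] := kP l.
Qed.

End TwoRelations.

End Relations.
(** * Real algebraic numbers given by isolating data *)

Section Taylor.

Variable R : realFieldType.

Lemma coef_comp_affine (p : {poly R}) u h i :
  (p \Po (u%:P + h *: 'X))`_i = p^`N(i).[u] * h ^+ i.
Proof.
have -> : p \Po (u%:P + h *: 'X) = \poly_(i < size p) (p^`N(i).[u] * h ^+ i).
  rewrite /comp_poly nderiv_taylor; last exact: mulrC.
  rewrite size_map_polyC poly_def; apply: eq_bigr => j _.
  by rewrite nderivn_map horner_map /= exprZn -scalerAr mul_polyC scalerA mulrC.
rewrite coef_poly; case: ltnP => // le_i.
by rewrite nderivn_poly0 // horner0 mul0r.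
Qed.

Definition coef_bound (p : {poly R}) B := \sum_(k < size p) `|p`_k| * B ^+ k.

Lemma coef_bound_ge0 p B : 0 <= B -> 0 <= coef_bound p B.
Proof. by move=> B0; apply: sumr_ge0 => k _; rewrite mulr_ge0 ?exprn_ge0. Qed.

Lemma horner_coef_bound (p : {poly R}) B u : `|u| <= B -> `|p.[u]| <= coef_bound p B.
Proof.
move=> uB; rewrite horner_coef (le_trans (ler_norm_sum _ _ _)) //.
apply: ler_sum => k _; rewrite normrM normrX ler_wpM2l //.
by rewrite lerXn2r ?nnegrE ?(le_trans _ uB).
Qed.

Definition taylor_bound (p : {poly R}) B := \sum_(i < size p) coef_bound p^`N(i) B.

Lemma taylor_tail_le (p : {poly R}) B u h : `|u| <= B -> 0 <= h <= 1 ->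
  \sum_(i < (size p).-1) `|p^`N(i.+1).[u]| * h ^+ i.+1 <= h * taylor_bound p B.
Proof.
move=> uB /andP[h0 h1]; have B0 : 0 <= B by rewrite (le_trans _ uB).
rewrite /taylor_bound; case: (size p) => [|n] /=.
  by rewrite !big_ord0 mulr0.
rewrite big_ord_recl mulrDr ler_wpDl ?mulr_ge0 ?coef_bound_ge0 // mulr_sumr.
apply: ler_sum => i _; rewrite exprS mulrCA ler_wpM2l //.
by rewrite (le_trans _ (horner_coef_bound _ uB)) // ler_piMr ?exprn_ile1.
Qed.

Lemma horner_shift_le (p : {poly R}) B u v h : `|u| <= B -> `|v - u| <= h -> h <= 1 ->
  `|p.[v] - p.[u]| <= h * taylor_bound p B.
Proof.
move=> uB vuh h1; have h0 : 0 <= h by rewrite (le_trans _ vuh).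
rewrite -[v](subrKC u) nderiv_taylor; last exact: mulrC.
apply: le_trans (taylor_tail_le p uB (introT andP (conj h0 h1))).
case E: (size p) => [|n].
  move/eqP: E; rewrite size_poly_eq0 => /eqP ->.
  by rewrite !big_ord0 horner0 subrr normr0.
rewrite big_ord_recl nderivn0 expr0 mulr1 addrC addKr.
apply: le_trans (ler_norm_sum _ _ _) _; apply: ler_sum => i _.
by rewrite normrM normrX ler_wpM2l // lerXn2r ?nnegrE.
Qed.

End Taylor.

(** A sufficient condition for the positivity of [g] on the unit interval, which
    becomes necessary under sufficiently fine subdivision. *)
Definition coef_pos (g : {poly rat}) :=
  \sum_(i < (size g).-1) `|g`_i.+1| < g`_0.

Definition positive_on (u h : rat) (g : {poly rat}) :=
  coef_pos (g \Po (u%:P + h%:P * 'X)).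

Lemma positive_onP (R : realFieldType) (u h : rat) (g : {poly rat}) (y : R) :
  positive_on u h g -> 0 <= y <= 1 -> 0 < qev (ratr u + ratr h * y) g.
Proof.
move=> + /andP[y0 y1]; rewrite /positive_on.
have -> : ratr u + ratr h * y = qev y (u%:P + h%:P * 'X).
  by rewrite rmorphD rmorphM /= !qevC qevX.
rewrite -qev_comp /coef_pos; set f := _ \Po _ => pf.
rewrite qev_sum; case sf : (size f) pf => [|n] /=.
  by move/eqP: sf; rewrite size_poly_eq0 => /eqP ->; rewrite big_ord0 coef0 ltxx.
rewrite -(@ltr_rat R) rmorph_sum /= big_ord_recl expr0 mulr1 => lt.
rewrite -ltrBlDl sub0r ltrNl -sumrN; apply: le_lt_trans lt.
apply: ler_sum => i _; rewrite ratr_norm.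
apply: le_trans (_ : `|- (ratr f`_i.+1 * y ^+ i.+1)| <= _); first exact: ler_norm.
by rewrite normrN normrM [X in _ * X]ger0_norm ?exprn_ge0 // ler_piMr ?exprn_ile1.
Qed.

(** By Taylor expansion at [u] all coefficients but the constant one are of
    the order of [h]. *)
Lemma positive_on_fine (R : realFieldType) (u h : rat) (g : {poly rat}) (B : R) :
    `|ratr u| <= B -> 0 <= h <= 1 ->
    ratr h * taylor_bound (map_poly ratr g) B < qev (ratr u) g ->
  positive_on u h g.
Proof.
move=> uB h01 lt; rewrite /positive_on /coef_pos; set f := _ \Po _.
have fE i : ratr f`_i = (map_poly (ratr : rat -> R) g)^`N(i).[ratr u] * ratr h ^+ i.
  rewrite -coef_comp_affine -coef_map map_comp_poly rmorphD /= map_polyC mul_polyC.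
  by rewrite map_polyZ map_polyX.
rewrite -(@ltr_rat R) fE expr0 mulr1 nderivn0; apply: le_lt_trans lt.
have h01R : 0 <= (ratr h : R) <= 1.
  by rewrite ler0q -(rmorph1 (ratr : rat -> R)) ler_rat.
apply: le_trans (taylor_tail_le (map_poly ratr g) uB h01R).
rewrite size_map_poly rmorph_sum /=.
have le_s : ((size f).-1 <= (size g).-1)%N.
  have := size_comp_poly_leq g (u%:P + h%:P * 'X); rewrite -/f => le.
  rewrite -subn1 leq_subLR add1n (leq_trans le) // ltnS.
  rewrite -[X in (_ <= X)%N]muln1 leq_mul // -subn1 leq_subLR addn1.
  rewrite (leq_trans (size_polyD _ _)) // geq_max size_polyC; apply/andP; split.
    by case: (u == 0).
  by rewrite mul_polyC (leq_trans (size_scale_leq _ _)) // size_polyX.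
rewrite [X in _ <= X](bigID (fun i : 'I_ _ => (i < (size f).-1)%N)) /=.
rewrite -[X in X <= _]addr0 lerD //; last first.
  by apply: sumr_ge0 => i _; rewrite mulr_ge0 ?exprn_ge0 //; case/andP: h01R.
rewrite -(big_ord_widen _ (fun i => `|(map_poly ratr g)^`N(i.+1).[ratr u]| * ratr h ^+ i.+1) le_s).
apply: ler_sum => i _; rewrite ratr_norm fE normrM normrX [`|ratr h|]ger0_norm //.
by case/andP: h01R.
Qed.
(** A rational polynomial [mu] together with [u] and [h], to stand for a root of
    [mu] between [u] and [u + h]. *)
Definition isolation : countType := ({poly rat} * (rat * rat))%type.

Definition isolates (c : isolation) :=
  [&& lead_coef c.1 == 1, 0 <= c.2.2 & c.1.[c.2.1] * c.1.[c.2.1 + c.2.2] <= 0].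

Definition vanishing (c : isolation) (g : {poly rat}) := monic_rem c.1 g == 0.

Definition positive (c : isolation) (g : {poly rat}) := positive_on c.2.1 c.2.2 g.

(** The root exists by the intermediate value theorem. *)
Lemma isolates_sound (R : rcfType) (c : isolation) : isolates c ->
  exists t : R, (forall g, vanishing c g -> qev t g = 0) /\
                (forall g, positive c g -> 0 < qev t g).
Proof.
case: c => mu [u h] /and3P[/= /eqP mon h0 sgn].
have h0R : 0 <= (ratr h : R) by rewrite ler0q.
pose f := map_poly ratr mu \Po ((ratr u : R)%:P + ratr h *: 'X).
have fE y : f.[y] = qev (ratr u + ratr h * y) mu.
  by rewrite horner_comp !hornerE mulrC.
have qE (a : rat) : qev (ratr a : R) mu = ratr mu.[a].
  by rewrite /qev /= /horner_eval horner_map.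
have f0 : f.[0] = ratr mu.[u] by rewrite fE mulr0 addr0 qE.
have f1 : f.[1] = ratr mu.[u + h] by rewrite fE mulr1 -rmorphD qE.
have fsgn : f.[0] * f.[1] <= 0 by rewrite f0 f1 -rmorphM /= lerq0.
have [y y01 fy] : exists2 y : R, 0 <= y <= 1 & f.[y] = 0.
  case: (leP f.[0] 0) => [f0le|f0gt].
    case: (leP 0 f.[1]) => [f1ge|f1lt].
      have [|y] := @poly_ivt R f 0 1 ler01; first by rewrite f0le f1ge.
      by move=> y01 /eqP; exists y.
    exists 0; first by rewrite lexx ler01.
    apply/eqP; rewrite eq_le f0le /=; rewrite leNgt; apply/negP => f0lt.
    by move: fsgn; rewrite leNgt nmulr_rgt0 ?f1lt.
  have f1le : f.[1] <= 0 by move: fsgn; rewrite pmulr_rle0.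
  have [|y] := @poly_ivt R (- f) 0 1 ler01.
    by rewrite !hornerN oppr_ge0 oppr_le0 f1le ltW.
  by move=> y01 /eqP; rewrite hornerN => /eqP; rewrite oppr_eq0 => /eqP; exists y.
exists (ratr u + ratr h * y); split=> g.
  rewrite /vanishing monic_remE /= ?monicE ?mon // => /eqP/modp_eq0P/dvdpP[k ->].
  by rewrite rmorphM /= -[X in _ * X]fE fy mulr0.
by move/positive_onP; apply.
Qed.

(** A root of [mu^`()] would make [mu] divide its derivative. *)
Lemma minpoly_simple (F : numFieldType) (t : F) mu :
  is_minpoly t mu -> qev t mu^`() != 0.
Proof.
move=> mumin; have s1 := minpoly_size mumin; have [mon mudvd] := mumin.
rewrite mudvd; apply/negP => dvd.
have mu0 : mu^`() != 0.
  have [n sn] : exists n, size mu = n.+2.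
    by exists (size mu).-2; case: (size mu) s1 => [|[]].
  apply/eqP => /(congr1 (fun p : {poly rat} => p`_n)).
  have := monicP mon; rewrite coef_deriv coef0 lead_coefE sn /= => -> /eqP.
  by rewrite pnatr_eq0.
have := dvdp_leq mu0 dvd; rewrite leqNgt lt_size_deriv //; exact: monic_neq0.
Qed.

Definition eventually_fine (R : realType) (t : R) (P : rat -> rat -> Prop) :=
  exists2 e : R, 0 < e & forall u h : rat, 0 < (ratr h : R) < e ->
    ratr u < t < ratr u + ratr h -> P u h.

Lemma eventually_fineI (R : realType) (t : R) P Q :
  eventually_fine t P -> eventually_fine t Q -> eventually_fine t (fun u h => P u h /\ Q u h).
Proof.
move=> [e1 e10 h1] [e2 e20 h2]; exists (Num.min e1 e2); first by rewrite lt_min e10.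
by move=> u h; rewrite lt_min => /and3P[h0 lt1 lt2] ut; split;
  [apply: h1; rewrite ?h0 | apply: h2; rewrite ?h0].
Qed.

Lemma eventually_fine_exists (R : realType) (t : R) P :
  eventually_fine t P -> exists u h, [/\ P u h, 0 < h & ratr u < t].
Proof.
move=> [e e0 eP]; have [h] := rat_in_itvoo e0; rewrite in_itv /= => hP.
have h0 : 0 < (ratr h : R) by case/andP: hP.
have lt_t : t - ratr h < t by rewrite ltrBlDr ltrDl.
have [u] := rat_in_itvoo lt_t.
rewrite in_itv /= => /andP[u1 u2]; exists u, h; split=> //.
  by apply: eP => //; rewrite u2 -ltrBlDr.
by rewrite -(ltr0q R).
Qed.

Lemma eventually_fine_near (R : realType) (t : R) (p : {poly R}) (e : R) : 0 < e ->
  eventually_fine t (fun u h => [/\ `|p.[t] - p.[ratr u]| < e,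
    ratr h * taylor_bound p (`|t| + 1) < e, `|ratr u : R| <= `|t| + 1 & h <= 1]).
Proof.
move=> e0; set K := taylor_bound p (`|t| + 1).
have K0 : 0 <= K.
  by apply: sumr_ge0 => i _; apply: coef_bound_ge0; rewrite addr_ge0.
have K1 : 0 < K + 1 by rewrite ltr_wpDl.
exists (Num.min 1 (e / (K + 1))); first by rewrite lt_min ltr01 divr_gt0.
move=> u h /andP[h0]; rewrite lt_min => /andP[h1 hK] /andP[ut th].
have uB : `|ratr u : R| <= `|t| + 1.
  rewrite -[ratr u](subrKC t) (le_trans (ler_normD _ _)) // lerD2l.
  by rewrite ler_norml; apply/andP; split; lra.
have hKe : ratr h * K < e.
  by move: hK; rewrite ltr_pdivlMr // mulrDr mulr1; apply: le_lt_trans; rewrite lerDl ltW.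
split=> //; last by rewrite -(@ler_rat R) rmorph1 ltW.
apply: le_lt_trans hKe; apply: horner_shift_le => //; last exact: ltW.
by rewrite ger0_norm; lra.
Qed.

Lemma eventually_fine_positive (R : realType) (t : R) (g : {poly rat}) :
  0 < qev t g -> eventually_fine t (fun u h => positive_on u h g).
Proof.
move=> gt0; have [|e e0 eP] := @eventually_fine_near R t (map_poly ratr g) (qev t g / 2).
  by rewrite divr_gt0.
exists e => // u h hP uP; have [d1 d2 uB h1] := eP u h hP uP.
apply: (positive_on_fine uB).
  by case/andP: hP; rewrite ltr0q => /ltW -> _.
apply: lt_trans d2 _; rewrite -/(qev t g) -[X in `|_ - X|]/(qev (ratr u) g) in d1.
move: d1; rewrite -[(map_poly ratr g).[t]]/(qev t g) ltr_norml => /andP[_]; lra.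
Qed.

(** As [t] is a simple root of [mu], the cofactor of ['X - t] keeps its sign near
    [t], and [mu] changes sign in every short interval around [t]. *)
Lemma isolates_complete (R : realType) (t : R) mu (G : seq {poly rat}) :
    is_minpoly t mu ->
  exists c : isolation, [/\ isolates c, forall g, vanishing c g <-> qev t g = 0 &
    forall g, g \in G -> 0 < qev t g -> positive c g].
Proof.
move=> mumin; have [mon mudvd] := mumin.
have mut : qev t mu = 0 by apply/eqP; rewrite mudvd.
have fineG : eventually_fine t (fun u h => forall g, g \in G -> 0 < qev t g -> positive_on u h g).
  elim: G => [|g G IH]; first by exists 1.
  have Hg : eventually_fine t (fun u h => 0 < qev t g -> positive_on u h g).
    have [gt0|ngt0] := boolP (0 < qev t g); last by exists 1.
    have [e e0 eP] := eventually_fine_positive gt0; exists e => // u h hP uP _.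
    exact: eP.
  have [e e0 eP] := eventually_fineI Hg IH; exists e => // u h hP uP g'.
  by have [h1 h2] := eP u h hP uP; rewrite inE => /predU1P[->|]; [exact: h1 | exact: h2].
have /factor_theorem[q qE] : root (map_poly (ratr : rat -> R) mu) t by apply/eqP.
have qt0 : q.[t] != 0.
  have := minpoly_simple mumin; rewrite /qev /= /horner_eval -deriv_map qE derivM.
  by rewrite hornerD !hornerM hornerXsubC subrr mulr0 add0r derivXsubC hornerC mulr1.
have fine_q : eventually_fine t (fun u h : rat => 0 <= h /\ (qev (ratr u : R) mu) * (qev (ratr u + ratr h : R) mu) <= 0).
  (* Both values of [q] differ from [q.[t]] by less than the size of the latter. *)
  have q2 : 0 < `|q.[t]| / 2 by rewrite divr_gt0 ?normr_gt0.
  have [e e0 eP] := @eventually_fine_near R t q _ q2.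
  exists e => // u h hP /andP[ut th]; have [||d1 d2 uB h1] := eP u h; rewrite ?ut //.
  have h0 : 0 < (ratr h : R) by case/andP: hP.
  split; first by rewrite -(ler0q R) ltW.
  have d3 : `|q.[ratr u + ratr h] - q.[ratr u]| < `|q.[t]| / 2.
    apply: le_lt_trans d2; apply: horner_shift_le => //.
      by rewrite addrC addKr ger0_norm // ltW.
    by rewrite -(rmorph1 (ratr : {rmorphism rat -> R})) ler_rat.
  rewrite -[qev (ratr u) mu]/((map_poly ratr mu).[ratr u]).
  rewrite -[qev (ratr u + _) mu]/((map_poly ratr mu).[_]) qE !hornerM !hornerXsubC.
  rewrite mulrACA mulrC mulr_le0_ge0 //; first by rewrite nmulr_rle0; lra.
  set a := q.[ratr u] in d1 d3 *; set b := q.[ratr u + ratr h] in d3 *.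
  set c := q.[t] in d1 d3 qt0 *.
  case: (ltP 0 c) => c0.
    have nc : `|c| = c by rewrite ger0_norm // ltW.
    move: d1 d3; rewrite nc !ltr_norml => /andP[l1 l2] /andP[l3 l4].
    by apply: mulr_ge0; lra.
  have nc : `|c| = - c by rewrite ler0_norm.
  move: d1 d3; rewrite nc !ltr_norml => /andP[l1 l2] /andP[l3 l4].
  by apply: mulr_le0; lra.
have [u [h [[hG [h0 sgn]] _ _]]] := eventually_fine_exists (eventually_fineI fineG fine_q).
exists (mu, (u, h)); split=> [|g|g]; last exact: hG.
  rewrite /isolates /= (monicP mon) eqxx h0 /=.
  have qE' (a : rat) : qev (ratr a : R) mu = ratr mu.[a].
    by rewrite /qev /= /horner_eval horner_map.
  by move: sgn; rewrite -rmorphD !qE' -rmorphM lerq0.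
by rewrite /vanishing monic_remE // (rwP eqP) mudvd.
Qed.
(** [p] divides the product of a power of [('X - a) ('X - b)] and the square of
    a polynomial [s] which is shown to have no root in the closed interval: in
    this way roots of [p] at the end points do no harm. *)
Definition rootless_witness (p : {poly rat}) (a b h : rat) (k N : nat) (r s : {poly rat}) :=
  [&& h * N%:R == b - a, p * r == (('X - a%:P) * ('X - b%:P)) ^+ k * s ^+ 2
    & all (fun i => positive_on (a + i%:R * h) h (s ^+ 2)) (iota 0 N)].

Lemma rootless_sound (R : realType) p a b h k N r s (y : R) :
  rootless_witness p a b h k N r s -> ratr a < y < ratr b -> qev y p != 0.
Proof.
move=> /and3P[/eqP hN /eqP prE /allP pos] /andP[ay yb].
have hNR : ratr h * N%:R = ratr b - ratr a :> R.
  by rewrite -(ratr_nat R) -rmorphM hN rmorphB.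
have h0 : 0 < (ratr h : R).
  rewrite ltNge; apply/negP => h0.
  by have := mulr_le0_ge0 h0 (ler0n R N); rewrite hNR; lra.
set z := (y - ratr a) / ratr h; have z0 : 0 <= z by rewrite divr_ge0 ?ltW // subr_gt0.
have [f1 f2] : (Num.floor z)%:~R <= z /\ z < (Num.floor z + 1)%:~R.
  by have /andP[] := floor_itv z.
have [i iE] : exists i : nat, Num.floor z = i.
  by exists (absz (Num.floor z)); rewrite gez0_abs // floor_ge0.
rewrite iE intrD in f1 f2; rewrite -pmulrn in f1 f2.
have zE : y = ratr a + ratr h * z by rewrite mulrC divfK ?gt_eqF // subrKC.
have lt_iN : (i < N)%N.
  rewrite -(ltr_nat R); apply: le_lt_trans f1 _.
  by rewrite /z ltr_pdivrMr // mulrC hNR ltrD2r.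
have /pos/(positive_onP (y := z - i%:R)) : i \in iota 0 N by rewrite mem_iota.
rewrite subr_ge0 f1 lerBlDl ltW // => /(_ isT).
have -> : ratr (a + i%:R * h) + ratr h * (z - i%:R) = y.
  by rewrite rmorphD rmorphM /= ratr_nat zE; ring.
move=> sp; apply/eqP => p0; move/(congr1 (qev y)): prE.
rewrite !rmorphM /= p0 mul0r !rmorphXn /= => /esym/eqP; rewrite mulf_eq0.
rewrite rmorphXn in sp; rewrite [X in _ || X]gt_eqF // orbF expf_eq0 => /andP[_].
rewrite rmorphM /= !rmorphB /= qevX !qevC mulf_eq0 !subr_eq0.
by rewrite [_ == ratr a]gt_eqF // [_ == ratr b]lt_eqF.
Qed.

(** On a compact interval [g] has a positive minimum and the Taylor coefficients
    are uniformly bounded, so that one mesh serves for all subintervals. *)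
Lemma positive_subdivision (R : realType) (a b : rat) (g : {poly rat}) : a < b ->
    (forall y : R, ratr a <= y <= ratr b -> 0 < qev y g) ->
  exists h N, h * N%:R = b - a /\
    all (fun i => positive_on (a + i%:R * h) h g) (iota 0 N).
Proof.
move=> ab gpos; have abR : (ratr a : R) <= ratr b by rewrite ler_rat ltW.
pose P := map_poly (ratr : rat -> R) g.
have [|c cab cmin] := @EVT_min R (horner P) (ratr a) (ratr b) abR.
  by apply: continuous_subspaceT => y; exact: continuous_horner.
have m0 : 0 < P.[c] by apply: gpos; move: cab; rewrite in_itv.
set B := `|ratr a| + `|ratr b| : R; set K := taylor_bound P B.
have K0 : 0 <= K by apply: sumr_ge0 => i _; apply: coef_bound_ge0; rewrite addr_ge0.
(* More than [L] subintervals make the mesh at most 1 and [K] times the mesh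
   smaller than the minimum of [g]. *)
pose L := ratr (b - a) * (1 + K / P.[c]) : R.
have [N0 N0L] : exists N0 : nat, L < N0.+1%:R.
  have L0 : 0 <= L.
    apply: mulr_ge0; first by rewrite ler0q subr_ge0 ltW.
    by apply: addr_ge0 => //; apply: divr_ge0 => //; exact: ltW.
  exists (Num.trunc L); by have /andP[] := truncn_itv L0.
set N := N0.+1; exists ((b - a) / N%:R), N; split; first by rewrite divfK ?pnatr_eq0.
have N0' : 0 < (N%:R : R) by rewrite ltr0n.
set h := (b - a) / N%:R.
have hR : ratr h = ratr (b - a) / N%:R :> R by rewrite fmorph_div /= ratr_nat.
have ba0 : 0 < (ratr (b - a) : R) by rewrite ltr0q subr_gt0.
have h0 : 0 < h by rewrite divr_gt0 ?subr_gt0 ?ltr0n.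
have h1 : (ratr h : R) <= 1.
  rewrite hR ler_pdivrMr // mul1r (le_trans _ (ltW N0L)) // /L ler_pMr //.
  by rewrite lerDl divr_ge0 // ltW.
have hK : ratr h * K < P.[c].
  rewrite hR mulrAC ltr_pdivrMr // -ltr_pdivrMl //; apply: le_lt_trans N0L.
  rewrite /L mulrCA; apply: ler_wpM2l; first exact: ltW.
  by rewrite mulrC lerDr.
apply/allP => i; rewrite mem_iota /= add0n => lt_i.
have uab : ratr a <= (ratr (a + i%:R * h) : R) <= ratr b.
  have ih : i%:R * h <= b - a.
    rewrite /h mulrCA; apply: ler_piMr; first by rewrite subr_ge0 ltW.
    by rewrite ler_pdivrMr ?ltr0n // mul1r ler_nat ltnW.
  rewrite !ler_rat lerDl mulr_ge0 ?ler0n ?(ltW h0) //=; lra.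
apply: (@positive_on_fine R _ _ _ B).
- case/andP: uab => l1 l2; rewrite /B ler_norml; apply/andP; split.
    by rewrite (le_trans _ l1) // lerNl (le_trans (ler_norm _)) // normrN lerDl.
  by rewrite (le_trans l2) // (le_trans (ler_norm _)) // lerDr.
- by rewrite (ltW h0) -(@ler_rat R) rmorph1.
apply: lt_le_trans hK _; apply: cmin; rewrite in_itv /=; exact: uab.
Qed.

Lemma rootless_complete (R : realType) (p : {poly rat}) (a b : rat) :
    p != 0 -> a < b -> (forall y : R, ratr a < y < ratr b -> qev y p != 0) ->
  exists h k N r s, rootless_witness p a b h k N r s.
Proof.
move=> p0 ab noroot.
have [i [q]] := multiplicity_XsubC p a; rewrite p0 /= => qa pq.
have [j [s]] := multiplicity_XsubC q b.
have -> /= : q != 0 by apply: contraNneq p0 => q0; rewrite pq q0 mul0r.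
move=> sb qs.
have sa : ~~ root s a by apply: contra qa => sa; rewrite qs rootM sa.
have rE (c : rat) : (qev (ratr c : R) s == 0) = root s c.
  by rewrite /qev /= /horner_eval horner_map fmorph_eq0.
have [|h [N [hN pos]]] := @positive_subdivision R a b (s ^+ 2) ab.
  move=> y /andP[]; rewrite le_eqVlt rmorphXn /= exprn_even_gt0 //= => /predU1P[<-|ay].
    by rewrite rE.
  rewrite le_eqVlt => /predU1P[->|yb]; first by rewrite rE.
  have := noroot y; rewrite ay yb => /(_ isT).
  by rewrite pq qs !rmorphM /= !mulf_eq0 !negb_or -andbA => /and3P[].
(* The exponent [i + j] is at least each of the multiplicities, and [s ^+ 2] contains the
   factor [s] of [p]. *)
exists h, (i + j)%N, N, (s * ('X - a%:P) ^+ j * ('X - b%:P) ^+ i), s.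
apply/and3P; split=> //; first by rewrite hN.
rewrite pq qs exprMn !exprD; apply/eqP; ring.
Qed.
Section PrimitiveElement.

Variable F : numFieldType.

Definition algebraic (x : F) := algebraicOver (ratr : rat -> F) x.

Lemma algebraic_nat n : algebraic n%:R.
Proof. by rewrite -(ratr_nat F); exact: algebraic_id. Qed.

Lemma primitive_element (s : seq F) : (forall x, x \in s -> algebraic x) ->
  exists2 t, algebraic t & forall x, x \in s -> exists q, x = qev t q.
Proof.
elim: s => [|x s IH] alg; first by exists 0 => //; exact: algebraic0.
have [t [p p0 pt] ts] := IH (fun y ys => alg y (mem_behead (s := x :: s) ys)).
have [q q0 qx] := alg x (mem_head _ _).
have [n] := pchar0_PET p0 pt q0 qx (pchar_num _).
set z := x *+ n - t => -[[f1 f1E] [f2 f2E]]; exists z.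
  apply: algebraic_sub; last by exists p.
  by rewrite -mulr_natl; apply: algebraic_mul; [exact: algebraic_nat|exists q].
move=> y; rewrite inE => /predU1P[->|/ts[g ->]]; first by exists f2.
by exists (g \Po f1); rewrite qev_comp; congr (qev _ _).
Qed.

(** If [t] is a root of an integral polynomial of degree [n] with leading
    coefficient [l], then [l ^+ n.-1] times this polynomial is monic in [l * t]. *)
Lemma integral_multiple (t : F) : algebraic t ->
  exists l : int, exists M : {poly int},
    [/\ l != 0, M \is monic & qev (l%:~R * t) (map_poly intr M) = 0].
Proof.
case=> p p0 pt; have [q [a a0 pq]] := rat_poly_scale p.
have q0 : q != 0 by apply: contraNneq p0 => q0; rewrite pq q0 rmorph0 scaler0.
have qt : (map_poly (intr : int -> F) q).[t] = 0.
  have : qev t p == 0 by exact: pt.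
  by rewrite -qev_int pq qevZ mulf_eq0 fmorph_eq0 invr_eq0 intr_eq0 (negPf a0) => /eqP.
set l := lead_coef q; exists l; have l0 : l != 0 by rewrite lead_coef_eq0.
case E : (size q) => [|[|n]].
- by move/eqP: E; rewrite size_poly_eq0 (negPf q0).
- move/eqP/size_poly1P: E => [c c0 qc].
  by move: qt; rewrite qc map_polyC hornerC => /eqP; rewrite intr_eq0 (negPf c0).
exists ('X^(n.+1) + \poly_(i < n.+1) (q`_i * l ^+ (n - i))); split=> //.
  by rewrite monicE lead_coefDl ?lead_coefXn // size_polyXn ltnS size_poly.
rewrite qev_int rmorphD /= map_polyXn hornerD hornerXn.
have -> : map_poly (intr : int -> F) (\poly_(i < n.+1) (q`_i * l ^+ (n - i))) =
    \poly_(i < n.+1) ((q`_i * l ^+ (n - i))%:~R).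
  by apply/polyP => i; rewrite coef_map !coef_poly; case: ifP.
rewrite horner_poly.
transitivity (l%:~R ^+ n * (map_poly (intr : int -> F) q).[t]); last by rewrite qt mulr0.
rewrite horner_coef size_map_poly_id0 ?intr_eq0 // E [in RHS]big_ord_recr /= mulrDr addrC.
congr (_ + _).
  rewrite mulr_sumr; apply: eq_bigr => i _; rewrite coef_map /= intrM exprMn.
  have le_in : (i <= n)%N by rewrite -ltnS.
  have -> : l%:~R ^+ n = l%:~R ^+ (n - i) * l%:~R ^+ i :> F by rewrite -exprD subnK.
  by rewrite rmorphXn /=; ring.
rewrite coef_map /= (_ : q`_n.+1 = l) ?exprMn; last by rewrite /l lead_coefE E.
by rewrite exprSr mulrA.
Qed.

Lemma monic_root_algebraic (t : F) (M : {poly int}) :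
  M \is monic -> qev t (map_poly intr M) = 0 -> algebraic t.
Proof.
move=> mon /eqP Mt; exists (map_poly intr M); last exact: Mt.
exact/map_intr_neq0/monic_neq0.
Qed.

Lemma integral_primitive_element (s : seq F) : (forall x, x \in s -> algebraic x) ->
  exists t mu, exists M : {poly int}, [/\ is_minpoly t mu, M \is monic,
    qev t (map_poly intr M) = 0 & forall x, x \in s -> exists q, x = qev t q].
Proof.
move=> /primitive_element[t algt ts]; have [l [M [l0 mon Mt]]] := integral_multiple algt.
have [mu mumin] : exists mu, is_minpoly (l%:~R * t) mu.
  by apply: minpoly_exists; exact: monic_root_algebraic Mt.
exists (l%:~R * t), mu, M; split=> // x /ts[q ->].
exists (q \Po (l%:~R^-1 *: 'X)); rewrite qev_comp qevZ qevX; congr (qev _ _).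
by rewrite fmorphV /= ratr_int mulKf // intr_eq0.
Qed.

End PrimitiveElement.
(** * Powers of symmetric 2 x 2 matrices *)

Section Matrices.

Variable R : rcfType.
Implicit Types (A B S P : 'M[R]_2) (d : 'rV[R]_2).

Lemma ord2P (Q : 'I_2 -> Prop) : Q 0 -> Q 1 -> forall i, Q i.
Proof.
move=> q0 q1 i; case: (unliftP 0 i) => [j|] -> //.
by rewrite (_ : lift 0 j = 1) //; apply: val_inj; rewrite /= (ord1 j).
Qed.

Lemma mx2P (A B : 'M[R]_2) : A 0 0 = B 0 0 -> A 0 1 = B 0 1 -> A 1 0 = B 1 0 ->
  A 1 1 = B 1 1 -> A = B.
Proof. by move=> *; apply/matrixP; apply: ord2P; apply: ord2P. Qed.

Lemma mulmx2E (A B : 'M[R]_2) i j : (A *m B) i j = A i 0 * B 0 j + A i 1 * B 1 j.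
Proof.
rewrite mxE !big_ord_recl big_ord0 addr0.
by rewrite (_ : lift _ _ = 1) //; apply: val_inj.
Qed.

Lemma det2E (A : 'M[R]_2) : \det A = A 0 0 * A 1 1 - A 0 1 * A 1 0.
Proof.
rewrite (expand_det_row _ 0) !big_ord_recl big_ord0 addr0 /cofactor !det_mx11 !mxE /=.
rewrite expr0 expr1 mul1r mulN1r mulrN.
by congr (_ * A _ _ - A _ _ * A _ _); apply: val_inj.
Qed.

Lemma algebraic_sqrt (x : R) : algebraic x -> algebraic (Num.sqrt x).
Proof.
case: (ltP x 0) => [/ltW/ler0_sqrtr-> _|x0]; first exact: algebraic0.
case=> p p0 px; exists (p \Po 'X^2).
  by rewrite comp_poly_eq0 ?size_polyXn.
by rewrite map_comp_poly map_polyXn /root horner_comp hornerXn sqr_sqrtr.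
Qed.

(** The eigenvectors are given by formulas in order to see that they are
    algebraic. *)
Lemma symmetric_diagonalizable A : A^T = A ->
  exists P d, [/\ P \in unitmx, A *m P = P *m diag_mx d &
    (forall i j, algebraic (A i j)) -> forall i j, algebraic (P i j)].
Proof.
move=> sym; have A10 : A 1 0 = A 0 1 by rewrite -{1}sym mxE.
have [b0|b0] := eqVneq (A 0 1) 0.
  exists 1%:M, (\row_j A j j); split; first exact: unitmx1.
    by rewrite mulmx1 mul1mx; apply: mx2P; rewrite !mxE ?A10 ?b0.
  by move=> _ i j; rewrite mxE; exact: algebraic_nat.
pose r := Num.sqrt ((A 0 0 - A 1 1) ^+ 2 + (A 0 1 *+ 2) ^+ 2).
have rE : r ^+ 2 = (A 0 0 - A 1 1) ^+ 2 + (A 0 1 *+ 2) ^+ 2.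
  by rewrite sqr_sqrtr // addr_ge0 ?sqr_ge0.
have r0 : r != 0.
  have : 0 < r ^+ 2.
    by rewrite rE ltr_wpDl ?sqr_ge0 // exprn_even_gt0 //= mulrn_eq0 negb_or.
  by apply: contraTneq => ->; rewrite expr0n ltxx.
pose l1 := (A 0 0 + A 1 1 + r) / 2; pose l2 := (A 0 0 + A 1 1 - r) / 2.
pose P : 'M[R]_2 := \matrix_(i, j) (if i == 0 then A 0 1 else
   (if j == 0 then l1 else l2) - A 0 0).
exists P, (\row_j (if j == 0 then l1 else l2)); split.
- rewrite unitmxE unitfE det2E !mxE /=.
  have -> : A 0 1 * (l2 - A 0 0) - A 0 1 * (l1 - A 0 0) = - (A 0 1 * r).
    by rewrite /l1 /l2; field.
  by rewrite oppr_eq0 mulf_neq0.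
- have key l e : (e = 1 \/ e = -1) -> l = (A 0 0 + A 1 1 + e * r) / 2 ->
      A 1 0 * A 0 1 + A 1 1 * (l - A 0 0) = (l - A 0 0) * l.
    move=> e1 ->; have e2 : e ^+ 2 = 1 by case: e1 => ->; rewrite ?expr1n ?sqrrN ?expr1n.
    rewrite A10; transitivity ((A 0 1 *+ 2) ^+ 2 / 4 + A 1 1 * ((A 0 0 + A 1 1 + e * r) / 2 - A 0 0)).
      by field.
    transitivity ((e ^+ 2 * r ^+ 2 - (A 0 0 - A 1 1) ^+ 2) / 4 +
        A 1 1 * ((A 0 0 + A 1 1 + e * r) / 2 - A 0 0)); last by field.
    by rewrite e2 mul1r rE; ring.
  rewrite mul_mx_diag; apply: mx2P; rewrite mulmx2E !mxE /=.
  + by ring.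
  + by ring.
  + by rewrite (key l1 1) //; [left | rewrite mul1r].
  + by rewrite (key l2 (-1)) //; [right | rewrite mulN1r].
- move=> alg; have algr : algebraic r.
    apply: algebraic_sqrt; rewrite !expr2 mulr2n.
    have alg1 : algebraic (A 0 0 - A 1 1) by apply: algebraic_sub; exact: alg.
    have alg2 : algebraic (A 0 1 + A 0 1) by apply: algebraic_add; exact: alg.
    by apply: algebraic_add; exact: algebraic_mul.
  have half (x : R) : algebraic x -> algebraic (x / 2).
    by move=> ax; exact: algebraic_div ax (algebraic_nat R 2).
  have algs : algebraic (A 0 0 + A 1 1) by apply: algebraic_add; exact: alg.
  have algl1 : algebraic l1 by apply: half; exact: algebraic_add.
  have algl2 : algebraic l2 by apply: half; exact: algebraic_sub.
  move=> i j; rewrite mxE; case: ifP => _; first exact: alg.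
  by case: ifP => _; apply: algebraic_sub => //; exact: alg.
Qed.

Section Diagonalized.

Variable P : 'M[R]_2.
Hypothesis uP : P \in unitmx.

Definition diagonalizes S d := S *m P = P *m diag_mx d.

Lemma diagonalizesM S S' d d' : diagonalizes S d -> diagonalizes S' d' ->
  diagonalizes (S *m S') (\row_j (d 0 j * d' 0 j)).
Proof.
move=> h h'; rewrite /diagonalizes -mulmxA h' mulmxA h -mulmxA mulmx_diag.
by [].
Qed.

Lemma diagonalizesX S d n : diagonalizes S d ->
  diagonalizes (S ^+ n) (\row_j (d 0 j ^+ n)).
Proof.
move=> h; elim: n => [|n IH].
  rewrite /diagonalizes expr0 mul1mx -[LHS]mulmx1; congr (_ *m _).
  by apply: mx2P; rewrite !mxE.
rewrite exprS (_ : \row_j _ = \row_j (d 0 j * (\row_j (d 0 j ^+ n) : 'rV_2) 0 j)).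
  exact: diagonalizesM.
by apply/rowP => j; rewrite !mxE exprS.
Qed.

Lemma diagonalizes_inj S S' d d' : diagonalizes S d -> diagonalizes S' d' ->
  S = S' <-> d = d'.
Proof.
move=> h h'; split=> [E|E]; last first.
  by apply: (can_inj (mulmxK uP)); rewrite h h' E.
have : P *m diag_mx d = P *m diag_mx d' by rewrite -h -h' E.
move/(can_inj (mulKmx uP)) => /matrixP dd; apply/rowP => j.
by have := dd j j; rewrite !mxE eqxx.
Qed.

Lemma diagonalizes_unit S d : diagonalizes S d ->
  (S \in unitmx) = (d 0 0 != 0) && (d 0 1 != 0).
Proof.
move=> h; have : (S *m P \in unitmx) = (P *m diag_mx d \in unitmx) by rewrite h.
rewrite !unitmx_mul uP andbT /= => ->; rewrite unitmxE unitfE det_diag.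
rewrite !big_ord_recl big_ord0 mulr1 mulf_eq0 negb_or.
by congr (_ && (d 0 _ != 0)); apply: val_inj.
Qed.

Lemma diagonalizesXz S d (k : int) : diagonalizes S d -> (k < 0 -> S \in unitmx) ->
  diagonalizes (S ^ k) (\row_j (d 0 j ^ k)).
Proof.
case: k => n h uS; first exact: diagonalizesX.
have {}uS : S \in unitmx by exact: uS.
have hn := diagonalizesX n.+1 h; rewrite NegzE -exprnN.
have uSn : S ^+ n.+1 \in unitmx by exact: unitrX.
rewrite /diagonalizes; apply: (can_inj (mulKmx uSn)).
rewrite -[X in X = _]/((S ^+ n.+1) *m (invmx (S ^+ n.+1) *m P)) (mulKVmx uSn) mulmxA hn.
rewrite -mulmxA mulmx_diag -[LHS]mulmx1; congr (_ *m _).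
move: uS; rewrite (diagonalizes_unit h) => /andP[d0 d1].
by apply: mx2P; rewrite !mxE //= -exprnN divff // expf_neq0.
Qed.

(** A matrix that commutes with a diagonal matrix with distinct entries is
    diagonal. *)
Lemma commuting_diagonalizes S S' d : diagonalizes S d -> d 0 0 != d 0 1 ->
  S *m S' = S' *m S -> exists d', diagonalizes S' d'.
Proof.
move=> h dd SS; have [B PB] : exists B, P *m B = S' *m P.
  by exists (invmx P *m S' *m P); rewrite !mulmxA mulmxV // mul1mx.
have : P *m (diag_mx d *m B) = P *m (B *m diag_mx d).
  transitivity (S *m S' *m P); first by rewrite mulmxA -h -mulmxA PB mulmxA.
  by rewrite SS [RHS]mulmxA PB -!mulmxA h.
move/(can_inj (mulKmx uP)) => E; exists (\row_j B j j).
rewrite /diagonalizes -PB; congr (_ *m _).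
have off i j : i != j -> d 0 i != d 0 j -> B i j = 0.
  move=> _ dij; move/matrixP/(_ i j): E; rewrite mul_diag_mx mul_mx_diag !mxE => /eqP.
  by rewrite mulrC -subr_eq0 -mulrBr mulf_eq0 subr_eq0 (negPf dij) orbF => /eqP.
by apply: mx2P; rewrite !mxE //= off // eq_sym.
Qed.

End Diagonalized.

(** Since the entries of [diag_mx d ^+ 2] are nonnegative, they are determined
    by their powers. *)
Lemma comm_square_root A B n : A^T = A -> (0 < n)%N ->
  GRing.comm B ((A *m A) ^+ n) -> GRing.comm B (A *m A).
Proof.
move=> sym n0 BA; have [P [d [uP h _]]] := symmetric_diagonalizable sym.
have hS := diagonalizesM h h; have hSn := diagonalizesX n hS.
have [C PC] : exists C, P *m C = B *m P.
  by exists (invmx P *m B *m P); rewrite !mulmxA mulmxV // mul1mx.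
have comm_diag S e : diagonalizes P S e ->
    (B *m S = S *m B) <-> (C *m diag_mx e = diag_mx e *m C).
  move=> hS'; split=> E.
    apply: (can_inj (mulKmx uP)); rewrite !mulmxA PC -hS' -!mulmxA PC -hS' !mulmxA.
    by rewrite E.
  by apply: (can_inj (mulmxK uP)); rewrite -!mulmxA hS' -PC !mulmxA hS' -PC -!mulmxA E.
move/(comm_diag _ _ hSn): BA => E; apply/(comm_diag _ _ hS).
rewrite mul_mx_diag mul_diag_mx; apply/matrixP => i j.
move/matrixP/(_ i j): E; rewrite mul_mx_diag mul_diag_mx !mxE.
rewrite mulrC => /eqP; rewrite -subr_eq0 -mulrBl mulf_eq0 subr_eq0 mulrC.
case/orP => [/eqP/(pexpIrn n0)|/eqP->]; last by rewrite !(mulr0, mul0r).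
by rewrite !nnegrE -!expr2 !sqr_ge0 => /(_ isT isT) ->; rewrite mulrC.
Qed.

Lemma comm_square_rootz A B (k : int) : A^T = A -> k != 0 -> (k < 0 -> A *m A \in unitmx) ->
  GRing.comm B ((A *m A) ^ k) -> GRing.comm B (A *m A).
Proof.
move=> sym; case: k => n k0 uA cB.
  by apply: comm_square_root sym _ cB; rewrite lt0n.
apply: (comm_square_root (n := n.+1) sym) => //.
by move/commrV: cB; rewrite NegzE -exprnN invrK.
Qed.

Lemma trmxX A n : (A ^+ n)^T = A^T ^+ n.
Proof.
elim: n => [|n IH]; first by rewrite !expr0; exact: trmx1.
by rewrite exprSr exprS -IH; exact: trmx_mul.
Qed.

Lemma symmetricXz A (k : int) : A^T = A -> (A ^ k)^T = A ^ k.
Proof.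
move=> sym; case: k => n; first by rewrite -exprnP trmxX sym.
rewrite NegzE -exprnN; have : (A ^+ n.+1)^T = A ^+ n.+1 by rewrite trmxX sym.
by rewrite -[in X in _ -> X = _]/(invmx (A ^+ n.+1)) trmx_inv => ->.
Qed.

Lemma squareXz A (k : int) : (k < 0 -> A \in unitmx) ->
  (A *m A) ^ k = A ^ k * A ^ k.
Proof.
have nat n : (A *m A) ^+ n = A ^+ n * A ^+ n.
  by rewrite -[A *m A]/(A ^+ 2) -exprM -exprD mul2n addnn.
case: k => n uA; first exact: nat.
rewrite NegzE -!exprnN nat invrM //; apply: unitrX; exact: uA.
Qed.

(** The product of two symmetric matrices is symmetric only if they commute. *)
Lemma power_relation_comm A1 A2 A3 k1 k2 k3 :
  A1^T = A1 -> A2^T = A2 -> A3^T = A3 -> A1 ^ k1 *m A2 ^ k2 = A3 ^ k3 ->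
  GRing.comm (A1 ^ k1) (A2 ^ k2).
Proof.
move=> s1 s2 s3 E; rewrite /GRing.comm -[LHS]/(A1 ^ k1 *m A2 ^ k2) E.
rewrite -(symmetricXz k3 s3) -E trmx_mul.
by rewrite (symmetricXz k1 s1) (symmetricXz k2 s2).
Qed.

Lemma unitmx_square A : (A *m A \in unitmx) = (A \in unitmx).
Proof. by rewrite unitmx_mul andbb. Qed.

End Matrices.

Section PowerRelations.

Variable R : realType.
Implicit Types A P : 'M[R]_2.

Lemma power_relation_squares A1 A2 A3 k1 k2 k3 :
    A1^T = A1 -> A2^T = A2 -> A3^T = A3 -> power_relation A1 A2 A3 k1 k2 k3 ->
  power_relation (A1 *m A1) (A2 *m A2) (A3 *m A3) k1 k2 k3 /\
  [/\ GRing.comm (A1 *m A1) (A2 *m A2), GRing.comm (A1 *m A1) (A3 *m A3) &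
      GRing.comm (A2 *m A2) (A3 *m A3)].
Proof.
move=> s1 s2 s3 [nz [u1 u2 u3 E]]; have [n1 n2 n3] := nz.
have XY := power_relation_comm s1 s2 s3 E.
have E2 : (A1 *m A1) ^ k1 *m (A2 *m A2) ^ k2 = (A3 *m A3) ^ k3.
  rewrite !squareXz // -E -[LHS]/(A1 ^ k1 * A1 ^ k1 * (A2 ^ k2 * A2 ^ k2)).
  rewrite -[RHS]/(A1 ^ k1 * A2 ^ k2 * (A1 ^ k1 * A2 ^ k2)).
  by rewrite -!mulrA; congr (_ * _); rewrite !mulrA XY.
have rel : power_relation (A1 *m A1) (A2 *m A2) (A3 *m A3) k1 k2 k3.
  by split=> //; split; rewrite ?unitmx_square.
have [_ [v1 v2 v3 _]] := rel.
have c12 : GRing.comm (A1 *m A1) (A2 *m A2).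
  apply: (comm_square_rootz s2 n2 v2); apply/commr_sym.
  apply: (comm_square_rootz s1 n1 v1); rewrite !squareXz //.
  by apply: commrM; apply/commr_sym; apply: commrM.
split=> //; split=> //.
  apply: (comm_square_rootz s3 n3 v3); rewrite -E2.
  by apply: commrM; apply: commrXz.
apply: (comm_square_rootz s3 n3 v3); rewrite -E2.
by apply: commrM; apply: commrXz => //; apply/commr_sym.
Qed.

Lemma squares_power_relation A1 A2 A3 k1 k2 k3 :
    power_relation (A1 *m A1) (A2 *m A2) (A3 *m A3) k1 k2 k3 ->
  power_relation A1 A2 A3 (2 * k1) (2 * k2) (2 * k3).
Proof.
move=> [[n1 n2 n3] [u1 u2 u3 E]].
have dbl A (k : int) : A ^ (2 * k) = (A *m A) ^ k by rewrite -exprz_exp.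
have neg (k : int) : (2 * k < 0) = (k < 0) by rewrite pmulr_rlt0.
split; first by rewrite !mulf_neq0.
by split; rewrite ?neg ?dbl // -unitmx_square.
Qed.

Variables (A1 A2 A3 P : 'M[R]_2) (d1 d2 d3 : 'rV[R]_2).
Hypotheses (uP : P \in unitmx) (h1 : diagonalizes P A1 d1)
  (h2 : diagonalizes P A2 d2) (h3 : diagonalizes P A3 d3).

Lemma diagonal_power_relation k1 k2 k3 :
  power_relation A1 A2 A3 k1 k2 k3 <->
  [/\ k1 != 0, k2 != 0 & k3 != 0] /\
  [/\ k1 < 0 -> A1 \in unitmx, k2 < 0 -> A2 \in unitmx, k3 < 0 -> A3 \in unitmx &
    forall j, d1 0 j ^ k1 * d2 0 j ^ k2 = d3 0 j ^ k3].
Proof.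
have key (u1 : k1 < 0 -> A1 \in unitmx) (u2 : k2 < 0 -> A2 \in unitmx)
    (u3 : k3 < 0 -> A3 \in unitmx) : A1 ^ k1 *m A2 ^ k2 = A3 ^ k3 <->
    forall j, d1 0 j ^ k1 * d2 0 j ^ k2 = d3 0 j ^ k3.
  have := diagonalizes_inj uP (diagonalizesM (diagonalizesXz uP h1 u1)
    (diagonalizesXz uP h2 u2)) (diagonalizesXz uP h3 u3).
  move=> ->; split=> [/rowP E j|E]; first by have := E j; rewrite !mxE.
  by apply/rowP => j; rewrite !mxE.
by split=> -[nz [u1 u2 u3 /(key u1 u2 u3) E]].
Qed.

End PowerRelations.

(** An eigenbasis of one of the matrices which is not scalar is an eigenbasis of
    all; if there is none, every basis will do. *)
Lemma simultaneously_diagonalizable (R : rcfType) (A : 'I_3 -> 'M[R]_2) :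
    (forall i, (A i)^T = A i) -> (forall i j k, algebraic (A i j k)) ->
    (forall i j, A i *m A j = A j *m A i) ->
  exists P, exists d : 'I_3 -> 'rV[R]_2, [/\ P \in unitmx, forall i, diagonalizes P (A i) (d i),
    forall j k, algebraic (P j k) & forall i j, algebraic (d i 0 j)].
Proof.
move=> sym alg comm.
suff [P [uP /choice[d h] algP]] : exists P, [/\ P \in unitmx,
    forall i, exists d, diagonalizes P (A i) d & forall j k, algebraic (P j k)].
  exists P, d; split=> // i j.
  have [k Pk0] : exists k, P k j != 0.
    apply: contrapT => /forallNP P0; have : (P *m delta_mx j (0 : 'I_1)) = 0.
      apply/matrixP => k l; rewrite mxE (bigD1 j) //= !mxE eqxx (ord1 l) eqxx mulr1.
      rewrite big1 ?addr0 => [|m /negPf mj]; last by rewrite !mxE mj mulr0.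
      by apply/eqP; apply: contrapT => /negP; exact: P0.
    move/(congr1 (mulmx (invmx P))); rewrite mulKmx // mulmx0 => /matrixP/(_ j 0).
    by rewrite !mxE !eqxx => /eqP; rewrite oner_eq0.
  have := h i; move/matrixP/(_ k j); rewrite mul_mx_diag [RHS]mxE mulmx2E => E.
  rewrite -[d i 0 j](mulKf Pk0) -E mulrC; apply: algebraic_div; last exact: algP.
  by apply: algebraic_add; apply: algebraic_mul; first [exact: alg | exact: algP].
have diag i := symmetric_diagonalizable (sym i).
have [[i [P [d [uP h algP dd]]]]|scalar] := pselect (exists i P d, [/\ P \in unitmx,
    diagonalizes P (A i) d, forall j k, algebraic (P j k) & d 0 0 != d 0 1]).
  exists P; split=> // j; exact: (commuting_diagonalizes uP h dd (comm i j)).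
exists 1%:M; split; first exact: unitmx1; last first.
  by move=> j k; rewrite mxE; exact: algebraic_nat.
move=> i; have [P [d [uP h algP]]] := diag i.
have dd : d 0 0 = d 0 1.
  by apply/eqP; apply: contrapT => /negP dd; apply: scalar; exists i, P, d; split; auto.
exists d; rewrite /diagonalizes mulmx1 mul1mx.
(* Every matrix of the family is scalar in this case. *)
have dE : diag_mx d = (d 0 0)%:M by apply: mx2P; rewrite !mxE /= ?mulr1n ?mulr0n.
by apply: (can_inj (mulmxK uP)); rewrite h dE scalar_mxC.
Qed.
(** * Certificates *)

(** Numbers, an isolation of a real algebraic number [t], polynomials to be
    evaluated at [t], an integral polynomial and a candidate solution. *)
Definition witness : countType :=
  ((seq nat * isolation) * ((seq {poly rat} * {poly int}) * (int * int * int)))%type.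

Definition w_num (w : witness) i := nth 0%N w.1.1 i.
Definition w_iso (w : witness) : isolation := w.1.2.
Definition w_poly (w : witness) i : {poly rat} := nth 0 w.2.1.1 i.
Definition w_int_poly (w : witness) : {poly int} := w.2.1.2.
Definition w_sol (w : witness) : int * int * int := w.2.2.

Definition mx_entries (c : mx2_code) : seq algnum_code :=
  [:: c.1.1; c.1.2; c.2.1; c.2.2].

Definition code_entries (c : mx2_triple_code) : seq algnum_code :=
  mx_entries c.1.1 ++ mx_entries c.1.2 ++ mx_entries c.2.

Definition code_entry (c : mx2_triple_code) i : algnum_code :=
  nth (0, (0, 0)) (code_entries c) i.

Definition nonzero (c : isolation) (g : {poly rat}) := positive c g || positive c (- g).

(** If [e] represents a number at all, then it is the value of [q]. *)
Definition root_at (c : isolation) (e : algnum_code) (q : {poly rat}) :=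
  [&& vanishing c (map_poly intr e.1 \Po q), positive c (q - e.2.1%:P)
    & positive c (e.2.2%:P - q)].

(** The four ways in which a code fails to represent a number: no polynomial, no
    interval, no root, or several roots. *)
Definition bad_entry (e : algnum_code) (w : witness) :=
  [|| e.1 == 0, e.2.2 <= e.2.1,
      rootless_witness (map_poly intr e.1) e.2.1 e.2.2 (w_iso w).2.2
        (w_num w 1) (w_num w 2) (w_poly w 0) (w_poly w 1)
    | [&& isolates (w_iso w), root_at (w_iso w) e (w_poly w 0),
          root_at (w_iso w) e (w_poly w 1) & positive (w_iso w) (w_poly w 1 - w_poly w 0)]].

(** Only the twelve positions of a code count: elsewhere [code_entry] has a
    default value, which represents no number. *)
Definition check_bad (c : mx2_triple_code) (w : witness) :=
  (w_num w 0 < 12)%N && bad_entry (code_entry c (w_num w 0)) w.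

(** As the code isolates a root, it is enough to locate the value of the
    polynomial as some root in the interval. *)
Definition check_entries (c : mx2_triple_code) (w : witness) :=
  isolates (w_iso w) &&
  all (fun i => root_at (w_iso w) (code_entry c i) (w_poly w i)) (iota 0 12).

(** Entries of the given matrices, of their squares, of a matrix [P] which
    diagonalizes the squares, their eigenvalues and the inverses of the
    eigenvalues. *)
Definition w_mx (w : witness) i j k := w_poly w (4 * i + (2 * j + k)).
Definition w_sq (w : witness) i j k :=
  w_mx w i j 0 * w_mx w i 0 k + w_mx w i j 1 * w_mx w i 1 k.
Definition w_P (w : witness) j k := w_poly w (12 + (2 * j + k)).
Definition w_eig (w : witness) i j := w_poly w (16 + (2 * i + j)).
Definition w_inv (w : witness) i j := w_poly w (22 + (2 * i + j)).

Definition check_asym (c : mx2_triple_code) (w : witness) :=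
  [&& check_entries c w, (w_num w 0 < 3)%N &
      nonzero (w_iso w) (w_mx w (w_num w 0) 0 1 - w_mx w (w_num w 0) 1 0)].

Definition w_sq_mul (w : witness) i i' j k :=
  w_sq w i j 0 * w_sq w i' 0 k + w_sq w i j 1 * w_sq w i' 1 k.

Definition check_noncomm (c : mx2_triple_code) (w : witness) :=
  check_entries c w &&
  [&& (w_num w 0 < 3)%N, (w_num w 1 < 3)%N, (w_num w 2 < 2)%N, (w_num w 3 < 2)%N &
      nonzero (w_iso w) (w_sq_mul w (w_num w 0) (w_num w 1) (w_num w 2) (w_num w 3) -
                         w_sq_mul w (w_num w 1) (w_num w 0) (w_num w 2) (w_num w 3))].

Definition check_diag (c : mx2_triple_code) (w : witness) :=
  [&& check_entries c w,
      nonzero (w_iso w) (w_P w 0 0 * w_P w 1 1 - w_P w 0 1 * w_P w 1 0),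
      all (fun i => all (fun j => all (fun k => vanishing (w_iso w)
        (w_sq w i j 0 * w_P w 0 k + w_sq w i j 1 * w_P w 1 k - w_P w j k * w_eig w i k))
        (iota 0 2)) (iota 0 2)) (iota 0 3) &
      all (fun i => all (fun j => vanishing (w_iso w) (w_eig w i j) ||
        vanishing (w_iso w) (w_eig w i j * w_inv w i j - 1)) (iota 0 2)) (iota 0 3)].

Definition w_unit (w : witness) i :=
  vanishing (w_iso w) (w_eig w i 0 * w_inv w i 0 - 1) &&
  vanishing (w_iso w) (w_eig w i 1 * w_inv w i 1 - 1).

Definition allowed (w : witness) (k : int * int * int) :=
  [&& [&& k.1.1 != 0, k.1.2 != 0 & k.2 != 0],
      (0 <= k.1.1) || w_unit w 0, (0 <= k.1.2) || w_unit w 1 & (0 <= k.2) || w_unit w 2].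

(** The equation [x1 ^ k1 * x2 ^ k2 = x3 ^ k3] with the negative powers
    moved to the other side. *)
Definition lhs (K : comNzRingType) (x1 x2 x3 : K) (k : int * int * int) :=
  x1 ^+ int_pos k.1.1 * x2 ^+ int_pos k.1.2 * x3 ^+ int_neg k.2.
Definition rhs (K : comNzRingType) (x1 x2 x3 : K) (k : int * int * int) :=
  x1 ^+ int_neg k.1.1 * x2 ^+ int_neg k.1.2 * x3 ^+ int_pos k.2.

Definition w_diff (w : witness) (k : int * int * int) j :=
  lhs (w_eig w 0 j) (w_eig w 1 j) (w_eig w 2 j) k -
  rhs (w_eig w 0 j) (w_eig w 1 j) (w_eig w 2 j) k.

Definition check_yes (c : mx2_triple_code) (w : witness) :=
  [&& check_diag c w, allowed w (w_sol w), vanishing (w_iso w) (w_diff w (w_sol w) 0) &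
      vanishing (w_iso w) (w_diff w (w_sol w) 1)].

(** A bound for the conjugates of the values of [g] at the roots of [M], with
    [e] as a common denominator. *)
Definition bounded_poly (e T : nat) (M : {poly int}) (g : {poly rat}) :=
  all (fun l => denq (e%:R * g`_l) == 1) (iota 0 (size g)) &&
  ((\sum_(l < size g) `|e%:R * g`_l|) * (\sum_(l < size M) `|(M`_l)%:~R|) ^+ size g <= T%:R).

(** The degree of [t] is at most that of the integral polynomial, and its
    conjugates are roots of it. The denominator and the bound are the numbers 0
    and 1 of the witness. *)
Definition check_bounds (w : witness) :=
  [&& lead_coef (w_int_poly w) == 1, vanishing (w_iso w) (map_poly intr (w_int_poly w)),
      (0 < w_num w 0)%N, (w_num w 0 <= w_num w 1)%N &
      all (fun i => bounded_poly (w_num w 0) (w_num w 1) (w_int_poly w) (w_poly w (16 + i)))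
        (iota 0 12)].

Definition w_bound (w : witness) :=
  (3 * relation_bound (size (w_int_poly w)).-1 3 (w_num w 0) (w_num w 1))%N.

Definition fails (w : witness) (k : int * int * int) :=
  [|| ~~ allowed w k, nonzero (w_iso w) (w_diff w k 0) | nonzero (w_iso w) (w_diff w k 1)].

(** For the exponents in the box inequality has to be certified, as [vanishing]
    is only sufficient for equality unless the polynomial of the isolation is
    irreducible, which is not verified. *)
Definition check_no (c : mx2_triple_code) (w : witness) :=
  [&& check_diag c w, check_bounds w &
    all (fun i1 => all (fun i2 => all (fun i3 =>
      fails w (i1%:Z - (w_bound w)%:Z, i2%:Z - (w_bound w)%:Z, i3%:Z - (w_bound w)%:Z))
      (iota 0 (w_bound w * 2).+1)) (iota 0 (w_bound w * 2).+1)) (iota 0 (w_bound w * 2).+1)].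

Definition check (c : mx2_triple_code) (w : witness) :=
  [|| check_bad c w, check_asym c w, check_noncomm c w, check_yes c w | check_no c w].

Definition answer (c : mx2_triple_code) (w : witness) : option (int * int * int) :=
  if check_yes c w then Some (2 * (w_sol w).1.1, 2 * (w_sol w).1.2, 2 * (w_sol w).2)
  else None.

(** * The certificates can be checked mechanically *)

Section CheckComputable.

Implicit Types X : countType.

Lemma computable_w_num X (w : X -> witness) i :
  computable w -> computable (fun x => w_num (w x) i).
Proof. by move=> cw; rewrite /w_num; computability. Qed.

Lemma computable_w_iso X (w : X -> witness) :
  computable w -> computable (fun x => w_iso (w x)).
Proof. by move=> cw; rewrite /w_iso; computability. Qed.

Lemma computable_w_poly X (w : X -> witness) (i : X -> nat) :
  computable w -> computable i -> computable (fun x => w_poly (w x) (i x)).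
Proof. by move=> cw ci; rewrite /w_poly; computability. Qed.

Lemma computable_w_int_poly X (w : X -> witness) :
  computable w -> computable (fun x => w_int_poly (w x)).
Proof. by move=> cw; rewrite /w_int_poly; computability. Qed.

Lemma computable_w_sol X (w : X -> witness) :
  computable w -> computable (fun x => w_sol (w x)).
Proof. by move=> cw; rewrite /w_sol; computability. Qed.

Lemma computable_code_entry X (c : X -> mx2_triple_code) (i : X -> nat) :
  computable c -> computable i -> computable (fun x => code_entry (c x) (i x)).
Proof.
by move=> cc ci; rewrite /code_entry /code_entries /mx_entries /=; computability.
Qed.

Lemma computable_horner X (p : X -> {poly rat}) (u : X -> rat) :
  computable p -> computable u -> computable (fun x => (p x).[u x]).
Proof.
move=> cp cu; apply: (@computable_ext _ _ (fun x => (p x \Po (u x)%:P)`_0)).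
  by move=> x; rewrite comp_polyCr coefC.
by computability; apply: computable_comp_poly => //; exact: computable_polyC.
Qed.

Lemma computable_positive_on X (u h : X -> rat) (g : X -> {poly rat}) :
  computable u -> computable h -> computable g ->
  computable (fun x => positive_on (u x) (h x) (g x)).
Proof.
move=> cu ch cg.
have cf : computable (fun x => g x \Po ((u x)%:P + (h x)%:P * 'X)).
  apply: computable_comp_poly => //; apply: computable_addp; first exact: computable_polyC.
  by apply: computable_mulp; [exact: computable_polyC | exact: computable_const].
rewrite /positive_on /coef_pos.
apply: computable_ltq; last by computability.
apply: (@computable_sumq _ (fun x i => `|(g x \Po ((u x)%:P + (h x)%:P * 'X))`_i.+1|));
  last by computability.
by computability; apply: (computable_comp cf); computability.
Qed.

End CheckComputable.

Ltac computable_polynomial := lazymatch goal with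
| |- computable (fun x => int_pos (@?f x)) => apply: (@computable_int_pos _ f)
| |- computable (fun x => int_neg (@?f x)) => apply: (@computable_int_neg _ f)
| |- computable (fun x => (Posz (@?f x)) - (Posz (@?g x))) => apply: (@computable_subz _ f g)
| |- computable (fun x => (@?f x)%:P) => apply: (@computable_polyC _ f)
| |- computable (fun x => @?f x + @?g x) => apply: (@computable_addp _ f g)
| |- computable (fun x => @?f x * @?g x) => first
    [ apply: (@computable_mulp _ f g) | apply: (@computable_mulz _ f g) ]
| |- computable (fun x => - (@?f x)) => apply: (@computable_oppp _ f)
| |- computable (fun x => @?f x <= @?g x) => apply: (@computable_lez _ f g)
| |- computable (fun x => @?f x ^+ @?n x) => apply: (@computable_exprp _ f n)
| |- computable (fun x => @?f x \Po @?g x) => apply: (@computable_comp_poly _ f g)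
| |- computable (fun x => map_poly intr (@?f x)) => apply: (@computable_intr_poly _ f)
| |- computable (fun x => monic_rem (@?f x) (@?g x)) => apply: (@computable_monic_rem _ f g)
| |- computable (fun x => horner (@?f x) (@?g x)) => apply: (@computable_horner _ f g)
| |- computable (fun x => positive_on (@?f x) (@?g x) (@?h x)) =>
    apply: (@computable_positive_on _ f g h)
| |- computable (fun x => w_num (@?w x) ?i) => apply: (@computable_w_num _ w i)
| |- computable (fun x => w_iso (@?w x)) => apply: (@computable_w_iso _ w)
| |- computable (fun x => w_poly (@?w x) (@?i x)) => apply: (@computable_w_poly _ w i)
| |- computable (fun x => w_int_poly (@?w x)) => apply: (@computable_w_int_poly _ w)
| |- computable (fun x => w_sol (@?w x)) => apply: (@computable_w_sol _ w)
| |- computable (fun x => code_entry (@?c x) (@?i x)) => apply: (@computable_code_entry _ c i)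
| |- computable (fun x => all (fun i => @?P x i) (iota 0 (@?n x))) =>
    apply: (@computable_all_lt _ P n)
end.

Ltac computable_custom ::= first [computable_rational | computable_polynomial].

Section CheckersComputable.

Implicit Types X : countType.

Lemma computable_isolates X (c : X -> isolation) :
  computable c -> computable (fun x => isolates (c x)).
Proof. by move=> cc; rewrite /isolates /lead_coef; computability. Qed.

Lemma computable_vanishing X (c : X -> isolation) (g : X -> {poly rat}) :
  computable c -> computable g -> computable (fun x => vanishing (c x) (g x)).
Proof. by move=> cc cg; rewrite /vanishing; computability. Qed.

Lemma computable_positive X (c : X -> isolation) (g : X -> {poly rat}) :
  computable c -> computable g -> computable (fun x => positive (c x) (g x)).
Proof. by move=> cc cg; rewrite /positive; computability. Qed.

Lemma computable_nonzero X (c : X -> isolation) (g : X -> {poly rat}) :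
  computable c -> computable g -> computable (fun x => nonzero (c x) (g x)).
Proof.
by move=> cc cg; apply: computable_or; apply: computable_positive; computability.
Qed.

End CheckersComputable.

Ltac computable_isolation := lazymatch goal with
| |- computable (fun x => isolates (@?c x)) => apply: (@computable_isolates _ c)
| |- computable (fun x => vanishing (@?c x) (@?g x)) => apply: (@computable_vanishing _ c g)
| |- computable (fun x => positive (@?c x) (@?g x)) => apply: (@computable_positive _ c g)
| |- computable (fun x => nonzero (@?c x) (@?g x)) => apply: (@computable_nonzero _ c g)
end.

Ltac computable_custom ::=
  first [computable_rational | computable_polynomial | computable_isolation].

Section ChecksComputable.

Implicit Types X : countType.

Lemma computable_root_at X (c : X -> isolation) (e : X -> algnum_code) (q : X -> {poly rat}) :
  computable c -> computable e -> computable q ->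
  computable (fun x => root_at (c x) (e x) (q x)).
Proof. by move=> cc ce cq; rewrite /root_at; computability. Qed.

Notation arg := (mx2_triple_code * witness)%type.

Lemma computable_check_bad : computable (fun p : arg => check_bad p.1 p.2).
Proof.
rewrite /check_bad /bad_entry /rootless_witness; computability;
  apply: computable_root_at; computability.
Qed.

Lemma computable_check_entries : computable (fun p : arg => check_entries p.1 p.2).
Proof.
rewrite /check_entries; computability; apply: computable_root_at; computability.
Qed.

Lemma computable_check_asym : computable (fun p : arg => check_asym p.1 p.2).
Proof.
rewrite /check_asym /w_mx; computability; exact: computable_check_entries.
Qed.

Lemma computable_check_noncomm : computable (fun p : arg => check_noncomm p.1 p.2).
Proof.
rewrite /check_noncomm /w_sq_mul /w_sq /w_mx; computability.
exact: computable_check_entries.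
Qed.

Lemma computable_check_diag : computable (fun p : arg => check_diag p.1 p.2).
Proof.
rewrite /check_diag /w_sq /w_mx /w_P /w_eig /w_inv; computability.
exact: computable_check_entries.
Qed.

Lemma computable_allowed X (w : X -> witness) (k : X -> int * int * int) :
  computable w -> computable k -> computable (fun x => allowed (w x) (k x)).
Proof. by move=> cw ck; rewrite /allowed /w_unit /w_eig /w_inv; computability. Qed.

Lemma computable_w_diff X (w : X -> witness) (k : X -> int * int * int) j :
  computable w -> computable k -> computable (fun x => w_diff (w x) (k x) j).
Proof. by move=> cw ck; rewrite /w_diff /lhs /rhs /w_eig; computability. Qed.

Lemma computable_check_yes : computable (fun p : arg => check_yes p.1 p.2).
Proof.
rewrite /check_yes; computability; first exact: computable_check_diag.
- by apply: computable_allowed; computability.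
- by apply: computable_w_diff; computability.
- by apply: computable_w_diff; computability.
Qed.

Lemma computable_fails X (w : X -> witness) (k : X -> int * int * int) :
  computable w -> computable k -> computable (fun x => fails (w x) (k x)).
Proof.
move=> cw ck; rewrite /fails; computability; first exact: computable_allowed;
  exact: computable_w_diff.
Qed.

Lemma computable_bounded_poly X (e T : X -> nat) (M : X -> {poly int}) (g : X -> {poly rat}) :
  computable e -> computable T -> computable M -> computable g ->
  computable (fun x => bounded_poly (e x) (T x) (M x) (g x)).
Proof.
move=> ce cT cM cg; rewrite /bounded_poly; apply: computable_and.
  by computability; first [apply: (computable_comp ce) | apply: (computable_comp cg)];
    computability.
apply: computable_leq_rat; last by computability.
apply: computable_mulq.
  apply: (@computable_sumq _ (fun x l => `|(e x)%:R * (g x)`_l|)); computability.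
    by apply: (computable_comp ce); computability.
  by apply: (computable_comp cg); computability.
have cs : computable (fun x => \sum_(l < size (M x)) `|((M x)`_l)%:~R : rat|).
  apply: (@computable_sumq _ (fun x l => `|((M x)`_l)%:~R : rat|)); computability.
  by apply: (computable_comp cM); computability.
apply: computable_ext (computable_nat_rect (n := fun x => size (g x)) (z := fun=> 1 : rat)
  (s := fun x _ a => (\sum_(l < size (M x)) `|((M x)`_l)%:~R|) * a) _ (computable_const _ _) _).
- by move=> x; elim: (size (g x)) => //= n ->; rewrite exprS.
- by computability.
- apply: computable_mulq; first exact: (computable_comp cs (computable_fst (computable_id _))).
  by computability.
Qed.

Lemma computable_w_bound X (w : X -> witness) :
  computable w -> computable (fun x => w_bound (w x)).
Proof.
by move=> cw; rewrite /w_bound /relation_bound /relation_count; computability.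
Qed.

Lemma computable_check_bounds : computable (fun p : arg => check_bounds p.2).
Proof.
rewrite /check_bounds /lead_coef; computability.
by apply: computable_bounded_poly; computability.
Qed.

Lemma computable_check_no : computable (fun p : arg => check_no p.1 p.2).
Proof.
have cB (Y : countType) (w : Y -> witness) : computable w ->
    computable (fun x => (w_bound (w x) * 2).+1).
  by move=> cw; computability; exact: computable_w_bound.
rewrite /check_no; apply: computable_and; first exact: computable_check_diag.
apply: computable_and; first exact: computable_check_bounds.
apply: (computable_all_lt _ (cB _ _ (computable_snd (computable_id _)))).
apply: (computable_all_lt _ (cB _ (fun p => p.1.2) _)); last by computability.
apply: (computable_all_lt _ (cB _ (fun p => p.1.1.2) _)); last by computability.
by apply: computable_fails; computability; apply: computable_w_bound; computability.
Qed.

Lemma computable_check : computable (fun p : arg => check p.1 p.2).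
Proof.
rewrite /check; apply: computable_or; first exact: computable_check_bad.
apply: computable_or; first exact: computable_check_asym.
apply: computable_or; first exact: computable_check_noncomm.
by apply: computable_or; [exact: computable_check_yes | exact: computable_check_no].
Qed.

Lemma computable_answer : computable (fun p : arg => answer p.1 p.2).
Proof.
rewrite /answer; apply: computable_if; [exact: computable_check_yes| | exact: computable_const].
by computability.
Qed.

Lemma decodable_code : decodable mx2_triple_code.
Proof.
have da : decodable algnum_code.
  apply: decodable_pair; first exact: (decodable_poly decodable_int).
  by apply: decodable_pair; exact: decodable_rat.
have dm : decodable mx2_code by apply: decodable_pair; apply: decodable_pair.
by apply: decodable_pair => //; apply: decodable_pair.
Qed.

Lemma decodable_witness : decodable witness.
Proof.
have dq : decodable {poly rat} := decodable_poly decodable_rat.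
apply: decodable_pair; apply: decodable_pair.
- exact: decodable_seq decodable_nat.
- by apply: decodable_pair => //; apply: decodable_pair; exact: decodable_rat.
- by apply: decodable_pair; [exact: decodable_seq | exact: (decodable_poly decodable_int)].
- by apply: decodable_pair; [apply: decodable_pair|]; exact: decodable_int.
Qed.

End ChecksComputable.
(** * Soundness of the certificates *)

Section Soundness.

Variables (R : realType) (c : mx2_triple_code) (A1 A2 A3 : 'M[R]_2).
Hypotheses (c1 : mx2_repr c.1.1 A1) (c2 : mx2_repr c.1.2 A2) (c3 : mx2_repr c.2 A3).

Definition mxs (i : nat) : 'M[R]_2 := nth 0 [:: A1; A2; A3] i.

Lemma code_entry_repr i (j k : 'I_2) : (i < 3)%N ->
  algnum_repr (code_entry c (4 * i + (2 * j + k))) (mxs i j k).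
Proof.
have [c100 c101 c110 c111] := c1; have [c200 c201 c210 c211] := c2.
have [c300 c301 c310 c311] := c3.
by case: i => [|[|[|]]] // _; move: j k; apply: ord2P; apply: ord2P.
Qed.

Lemma root_at_sound (iso : isolation) (t : R) e q :
    (forall g, vanishing iso g -> qev t g = 0) -> (forall g, positive iso g -> 0 < qev t g) ->
    root_at iso e q ->
  root (map_poly intr e.1) (qev t q) /\ ratr e.2.1 < qev t q < ratr e.2.2.
Proof.
move=> tv tp /and3P[/tv + /tp + /tp].
rewrite qev_comp qev_int !rmorphB /= !qevC !subr_gt0 => e0 -> ->; split=> //.
exact/eqP.
Qed.

Lemma algnum_repr_unique (e : algnum_code) (x y : R) : algnum_repr e x ->
  root (map_poly intr e.1) y -> ratr e.2.1 < y < ratr e.2.2 -> y = x.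
Proof. by move=> [_ _ _ uniq] ry iy; apply: uniq. Qed.

Lemma code_entryP i : (i < 12)%N -> exists x : R, algnum_repr (code_entry c i) x.
Proof.
have [c100 c101 c110 c111] := c1; have [c200 c201 c210 c211] := c2.
have [c300 c301 c310 c311] := c3.
by case: i => [|[|[|[|[|[|[|[|[|[|[|[|]]]]]]]]]]]] // _; eexists; eassumption.
Qed.

Lemma check_bad_sound w : ~~ check_bad c w.
Proof.
apply/negP => /andP[lt_n].
have [x [e0 ex rx uniq]] := code_entryP lt_n.
move: (code_entry c _) e0 ex rx uniq => e e0 /= ex rx uniq.
have int_root y : root (map_poly (intr : int -> R) e.1) y = (qev y (map_poly intr e.1) == 0).
  by rewrite qev_int.
case/or4P.
- by rewrite (negPf e0).
- by case/andP: ex => l1 l2; rewrite -(@ler_rat R) leNgt (lt_trans l1 l2).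
- move/(rootless_sound) => /(_ R x ex); rewrite -int_root rx //.
case/and4P => /(isolates_sound R)[t [tv tp]] /(root_at_sound tv tp)[r0 i0].
move=> /(root_at_sound tv tp)[r1 i1] /tp; rewrite rmorphB /= (uniq _ i0 r0) (uniq _ i1 r1).
by rewrite subrr ltxx.
Qed.

Lemma check_entries_sound w : check_entries c w -> exists t : R,
  [/\ forall g, vanishing (w_iso w) g -> qev t g = 0,
      forall g, positive (w_iso w) g -> 0 < qev t g &
      forall i (j k : 'I_2), (i < 3)%N -> mxs i j k = qev t (w_mx w i j k)].
Proof.
move=> /andP[/(isolates_sound R)[t [tv tp]] /allP ents]; exists t; split=> // i j k lt_i.
have lt12 : (4 * i + (2 * j + k) < 12)%N.
  by move: (ltn_ord j) (ltn_ord k) lt_i; lia.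
have := ents (4 * i + (2 * j + k))%N; rewrite mem_iota => /(_ lt12).
move=> /(root_at_sound tv tp)[rt it]; apply/esym.
exact: algnum_repr_unique (code_entry_repr j k lt_i) rt it.
Qed.

Lemma nonzero_sound (iso : isolation) (t : R) g :
  (forall g, positive iso g -> 0 < qev t g) -> nonzero iso g -> qev t g != 0.
Proof.
move=> tp /orP[/tp|/tp]; first by move/gt_eqF => ->.
by rewrite rmorphN /= oppr_gt0 => /lt_eqF ->.
Qed.

Lemma sq_sound w (t : R) i (j k : 'I_2) :
  (forall i (j k : 'I_2), (i < 3)%N -> mxs i j k = qev t (w_mx w i j k)) ->
  (i < 3)%N -> (mxs i *m mxs i) j k = qev t (w_sq w i j k).
Proof. by move=> E lt_i; rewrite mulmx2E !E // /w_sq rmorphD !rmorphM. Qed.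

Lemma check_asym_sound w : A1^T = A1 -> A2^T = A2 -> A3^T = A3 -> ~~ check_asym c w.
Proof.
move=> s1 s2 s3; apply/negP => /and3P[/check_entries_sound[t [tv tp E]] lt3].
move/(nonzero_sound tp); rewrite rmorphB /=.
have sym : (mxs (w_num w 0))^T = mxs (w_num w 0).
  by case: (w_num w 0) lt3 => [|[|[|]]].
have := E _ 0 1 lt3; have := E _ 1 0 lt3; rewrite /= => <- <-.
by rewrite -{1}sym mxE subrr eqxx.
Qed.

Lemma check_noncomm_sound w k1 k2 k3 : A1^T = A1 -> A2^T = A2 -> A3^T = A3 ->
  power_relation A1 A2 A3 k1 k2 k3 -> ~~ check_noncomm c w.
Proof.
move=> s1 s2 s3 rel; apply/negP => /andP[/check_entries_sound[t [tv tp E]]].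
case/and5P => lt0 lt1 lt2 lt3 /(nonzero_sound tp); rewrite rmorphB /=.
have [_ [c12 c13 c23]] := power_relation_squares s1 s2 s3 rel.
have comm i i' : (i < 3)%N -> (i' < 3)%N ->
    (mxs i *m mxs i) *m (mxs i' *m mxs i') = (mxs i' *m mxs i') *m (mxs i *m mxs i).
  by case: i => [|[|[|]]]; case: i' => [|[|[|]]] // _ _; rewrite /mxs /=;
    first [exact: c12 | exact: c13 | exact: c23 | exact: esym c12 | exact: esym c13
      | exact: esym c23].
have mulE i i' (j k : 'I_2) : (i < 3)%N -> (i' < 3)%N ->
    qev t (w_sq_mul w i i' j k) = ((mxs i *m mxs i) *m (mxs i' *m mxs i')) j k.
  by move=> lt_i lt_i'; rewrite [RHS]mulmx2E !(sq_sound _ _ E) // /w_sq_mul rmorphD !rmorphM.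
rewrite -[w_num w 2]/(nat_of_ord (Ordinal lt2)) -[w_num w 3]/(nat_of_ord (Ordinal lt3)).
by rewrite !mulE // comm // subrr eqxx.
Qed.

Lemma check_diag_sound w : check_diag c w -> exists (t : R) P (d : nat -> 'rV[R]_2),
  [/\ [/\ forall g, vanishing (w_iso w) g -> qev t g = 0,
      forall g, positive (w_iso w) g -> 0 < qev t g & P \in unitmx],
      forall i, (i < 3)%N -> diagonalizes P (mxs i *m mxs i) (d i),
      forall i (j : 'I_2), (i < 3)%N -> d i 0 j = qev t (w_eig w i j),
      forall i (j : 'I_2), (i < 3)%N -> d i 0 j = 0 \/ d i 0 j * qev t (w_inv w i j) = 1 &
      forall i, (i < 3)%N -> w_unit w i = (mxs i *m mxs i \in unitmx)].
Proof.
case/and4P => /check_entries_sound[t [tv tp E]] /(nonzero_sound tp) det0 /allP eig /allP inv.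
pose P : 'M[R]_2 := \matrix_(j, k) qev t (w_P w j k).
have PE j k : P j k = qev t (w_P w j k) by rewrite mxE.
have uP : P \in unitmx.
  by rewrite unitmxE unitfE det2E !PE /=; move: det0; rewrite rmorphB !rmorphM.
have diagP i : (i < 3)%N -> diagonalizes P (mxs i *m mxs i) (\row_j qev t (w_eig w i j)).
  move=> lt_i; rewrite /diagonalizes mul_mx_diag; apply/matrixP => j k.
  rewrite mulmx2E !(sq_sound _ _ E) // [RHS]mxE !PE [X in _ = _ * X]mxE.
  have /eig/allP : i \in iota 0 3 by rewrite mem_iota.
  move/(_ (j : nat)); rewrite mem_iota => /(_ (ltn_ord j))/allP/(_ (k : nat)).
  rewrite mem_iota => /(_ (ltn_ord k))/tv/eqP; rewrite rmorphB rmorphD !rmorphM /=.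
  by rewrite subr_eq0 => /eqP.
exists t, P, (fun i => \row_j qev t (w_eig w i j)); split=> //.
- by move=> i j _; rewrite mxE.
- move=> i j lt_i; have /inv/allP : i \in iota 0 3 by rewrite mem_iota.
  move/(_ (j : nat)); rewrite mem_iota mxE => /(_ (ltn_ord j))/orP[/tv|/tv/eqP]; first by left.
  by rewrite rmorphB rmorph1 rmorphM subr_eq0 => /eqP; right.
move=> i lt_i; rewrite (diagonalizes_unit uP (diagP i lt_i)) !mxE /w_unit.
have unitE j : (j < 2)%N -> vanishing (w_iso w) (w_eig w i j * w_inv w i j - 1) =
    (qev t (w_eig w i j) != 0).
  move=> lt_j; have /inv/allP : i \in iota 0 3 by rewrite mem_iota.
  move/(_ j); rewrite mem_iota => /(_ lt_j) inv_j; apply/idP/idP => [/tv|].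
    rewrite rmorphB rmorph1 rmorphM /=; apply: contra_eqN => /eqP ->.
    by rewrite mul0r sub0r oppr_eq0 oner_eq0.
  by move=> d0; case/orP: inv_j => // /tv/eqP; rewrite (negPf d0).
by rewrite !unitE.
Qed.

End Soundness.

(** [int_pos] and [int_neg] vanish on exponents of the other sign, so that no
    division by zero is cleared. *)
Lemma lhs_rhsP (F : fieldType) (x1 x2 x3 : F) k1 k2 k3 :
  (k1 < 0 -> x1 != 0) -> (k2 < 0 -> x2 != 0) -> (k3 < 0 -> x3 != 0) ->
  x1 ^ k1 * x2 ^ k2 = x3 ^ k3 <->
  lhs x1 x2 x3 (k1, k2, k3) = rhs x1 x2 x3 (k1, k2, k3).
Proof.
have powE (x : F) (k : int) : x ^ k = x ^+ int_pos k / x ^+ int_neg k.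
  by case: k => n; rewrite /= ?divr1 // mul1r NegzE exprnN.
have neg0 (x : F) (k : int) : (k < 0 -> x != 0) -> x ^+ int_neg k != 0.
  by case: k => n xk; rewrite ?oner_eq0 // expf_neq0 // xk.
move=> /neg0 n1 /neg0 n2 /neg0 n3; rewrite /lhs /rhs /= !powE mulf_div.
split=> [/eqP|E]; first by rewrite eqr_div ?mulf_neq0 // => /eqP ->; rewrite mulrC.
by apply/eqP; rewrite eqr_div ?mulf_neq0 // E mulrC.
Qed.

(** Where one of the numbers vanishes, the equation only says that both sides
    vanish, whatever the nonzero exponents are. *)
Lemma power_column_zero (F : fieldType) (x1 x2 x3 : F) k1 k2 k3 k1' k2' k3' :
    [/\ k1 != 0, k2 != 0 & k3 != 0] -> [/\ k1' != 0, k2' != 0 & k3' != 0] ->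
    [|| x1 == 0, x2 == 0 | x3 == 0] -> x1 ^ k1 * x2 ^ k2 = x3 ^ k3 ->
  x1 ^ k1' * x2 ^ k2' = x3 ^ k3'.
Proof.
move=> [n1 n2 n3] [m1 m2 m3] x0 E.
have lhs0 : (x1 == 0) || (x2 == 0) = (x3 == 0).
  move/(congr1 (fun y => y == 0)): E.
  by rewrite mulf_eq0 !expfz_eq0 n1 n2 n3.
have x30 : x3 = 0 by apply/eqP; move: x0; rewrite orbA lhs0 orbb.
rewrite x30 exp0rz (negPf m3); apply/eqP; rewrite mulf_eq0 !expfz_eq0 m1 m2 /= lhs0.
by rewrite x30.
Qed.

(** Cauchy's bound. *)
Lemma root_bound (M : {poly int}) (z : algC) : M \is monic ->
  root (map_poly intr M) z -> `|z| <= \sum_(l < size M) `|(M`_l)%:~R|.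
Proof.
move=> mon rz; have M0 := monic_neq0 mon.
case E : (size M) => [|n]; first by move/eqP: E; rewrite size_poly_eq0 (negPf M0).
have Mn : M`_n = 1 by move/monicP: mon; rewrite lead_coefE E.
rewrite big_ord_recr /= Mn normr1.
have [z1|z1] := real_leP (normr_real z) (real1 _); first by rewrite (le_trans z1) // lerDr sumr_ge0.
have z0 : 0 < `|z| by exact: lt_trans z1.
move/rootP: rz; rewrite horner_coef size_map_poly_id0 ?intr_eq0 ?lead_coef_eq0 // E.
rewrite big_ord_recr /= coef_map /= Mn mul1r => /eqP; rewrite addr_eq0 => /eqP rz.
apply: ler_wpDr => //.
case: n E Mn rz => [|n] E Mn rz.
  by move/eqP: rz; rewrite big_ord0 expr0 eq_sym oppr_eq0 oner_eq0.
rewrite -(ler_pM2r (exprn_gt0 n z0)) -exprS -normrX -[`|z ^+ _|]normrN -rz.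
rewrite (le_trans (ler_norm_sum _ _ _)) // mulr_suml; apply: ler_sum => l _.
rewrite coef_map normrM normrX ler_wpM2l // ler_eXn2l //.
by rewrite -ltnS.
Qed.

Lemma bounded_poly_conj (F : numFieldType) (t : F) (mu : {poly rat}) e T (M : {poly int}) g :
    is_minpoly t mu -> M \is monic -> qev t (map_poly intr M) = 0 ->
    bounded_poly e T M g ->
  conj_bounded mu T (e%:R *: g).
Proof.
move=> mumin mon Mt /andP[/allP int_g le_T] z z0.
have rz : root (map_poly intr M) z.
  by apply/rootP; rewrite -qev_int; exact: minpoly_conj mumin z0 Mt.
have iz : algint z by exists M.
set L : rat := \sum_(l < size M) `|(M`_l)%:~R|.
have zL : `|z| <= ratr L.
  rewrite /L rmorph_sum (le_trans (root_bound mon rz)) //= ler_sum // => l _.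
  by rewrite ratr_norm ratr_int.
have L0 : 0 <= L by rewrite sumr_ge0.
have L1 : 1 <= L.
  rewrite /L; case E : (size M) => [|n].
    by move/eqP: E; rewrite size_poly_eq0 (negPf (monic_neq0 mon)).
  move/monicP: mon; rewrite lead_coefE E big_ord_recr /= => ->.
  by rewrite normr1 lerDr sumr_ge0.
have -> : qev z (e%:R *: g) = \sum_(l < size g) ratr (e%:R * g`_l) * z ^+ l.
  by rewrite qevZ qev_sum mulr_sumr; apply: eq_bigr => l _; rewrite rmorphM mulrA.
split.
  apply: (big_ind algint) => [||l _]; [exact: (algint_nat 0) | exact: integral_add |].
  apply: integral_mul; last exact: algint_expr.
  have : (l : nat) \in iota 0 (size g) by rewrite mem_iota /=.
  move/int_g => /eqP dq; rewrite -[e%:R * _]divq_num_den dq divr1 ratr_int.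
  exact: integral_id.
apply: le_trans (_ : ratr ((\sum_(l < size g) `|e%:R * g`_l|) * L ^+ size g) <= _); last first.
  by rewrite -(ratr_nat algC) ler_rat.
rewrite (le_trans (ler_norm_sum _ _ _)) // rmorphM rmorph_sum /= mulr_suml.
apply: ler_sum => l _; rewrite normrM normrX ratr_norm ler_wpM2l // rmorphXn.
apply: le_trans (_ : ratr L ^+ l <= _).
  by rewrite lerXn2r ?nnegrE // ler0q.
apply: ler_weXn2l; last exact: ltnW.
have : (ratr 1 : algC) <= ratr L by rewrite ler_rat.
by rewrite rmorph1.
Qed.

Lemma relation_bound_leq d d' n e T : (0 < e)%N -> (0 < T)%N -> (d <= d')%N ->
  (relation_bound d n e T <= relation_bound d' n e T)%N.
Proof.
move=> e0 T0 dd; rewrite /relation_bound leq_exp2r // /relation_count leq_mul //.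
rewrite (@leq_trans ((2 * (1 + (e * T) ^ n) ^ d' + 1) ^ d)) //.
  case: d dd => // d dd; rewrite leq_exp2r // leq_add2r leq_mul2l /=.
  by rewrite leq_pexp2l.
by rewrite leq_pexp2l // addn1.
Qed.

Lemma prod_ord3 (K : comNzRingType) (f : nat -> K) : \prod_(i < 3) f i = f 0 * f 1 * f 2.
Proof. by rewrite !big_ord_recr big_ord0 /= mul1r. Qed.

Section SoundAnswers.

Variables (R : realType) (c : mx2_triple_code) (A1 A2 A3 : 'M[R]_2).
Hypotheses (c1 : mx2_repr c.1.1 A1) (c2 : mx2_repr c.1.2 A2) (c3 : mx2_repr c.2 A3).

Lemma check_yes_sound w k1 k2 k3 : check_yes c w -> w_sol w = (k1, k2, k3) ->
  power_relation A1 A2 A3 (2 * k1) (2 * k2) (2 * k3).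
Proof.
case/and4P => /(check_diag_sound c1 c2 c3)[t [P [d [[tv tp uP] hd dE inv unitE]]]].
move=> al v0 v1 wE; move: al v0 v1; rewrite wE; case/and4P => /= /and3P[n1 n2 n3]; rewrite !unitE //= => l1 l2 l3 v0 v1.
have u1 : k1 < 0 -> A1 *m A1 \in unitmx by rewrite ltNge; move: l1; case: (0 <= k1).
have u2 : k2 < 0 -> A2 *m A2 \in unitmx by rewrite ltNge; move: l2; case: (0 <= k2).
have u3 : k3 < 0 -> A3 *m A3 \in unitmx by rewrite ltNge; move: l3; case: (0 <= k3).
apply: squares_power_relation.
apply/(diagonal_power_relation uP (hd 0%N isT) (hd 1%N isT) (hd 2%N isT)).
split=> //; split=> // j.
have unit_neq0 i : (i < 3)%N -> mxs A1 A2 A3 i *m mxs A1 A2 A3 i \in unitmx -> d i 0 j != 0.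
  by move=> lt_i; rewrite (diagonalizes_unit uP (hd i lt_i)); move: j; apply: ord2P => /andP[].
apply/lhs_rhsP => [/u1|||].
- exact: (unit_neq0 0%N).
- by move/u2; exact: (unit_neq0 1%N).
- by move/u3; exact: (unit_neq0 2%N).
rewrite !dE //; have : vanishing (w_iso w) (w_diff w (k1, k2, k3) j).
  by move: j {unit_neq0}; apply: ord2P.
move/tv/eqP; rewrite /w_diff rmorphB subr_eq0 /lhs /rhs !rmorphM !rmorphXn /= => /eqP.
by [].
Qed.

(** Up to sign the exponents of a solution form a relation between the
    eigenvalues or their inverses, for each eigenvector. If an eigenvalue
    vanishes, the relation is replaced by one between ones, and
    [power_column_zero] takes care of the equation. [small_relation] then gives a
    solution with exponents of the same signs in the box. *)
Lemma check_no_sound w k1 k2 k3 : A1^T = A1 -> A2^T = A2 -> A3^T = A3 ->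
  check_no c w -> ~ power_relation A1 A2 A3 k1 k2 k3.
Proof.
move=> s1 s2 s3 /and3P[diag bounds /allP fail] rel.
have [t [P [d [[tv tp uP] hd dE inv unitE]]]] := check_diag_sound c1 c2 c3 diag.
have [relS _] := power_relation_squares s1 s2 s3 rel.
have [nz [u1 u2 u3 E]] := (diagonal_power_relation uP (hd 0%N isT) (hd 1%N isT)
  (hd 2%N isT) k1 k2 k3).1 relS.
have [n1 n2 n3] := nz.
case/and5P: bounds => /eqP mon /tv Mt; set e := w_num w 0; set T := w_num w 1.
set M := w_int_poly w in mon Mt *; move=> e0 eT /allP bnd.
have T0 : (0 < T)%N by exact: leq_trans eT.
have {}mon : M \is monic by rewrite monicE mon.
have [mu mumin] : exists mu, is_minpoly t mu.
  by apply: minpoly_exists; exact: monic_root_algebraic Mt.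
have bnd_poly i : (i < 12)%N -> conj_bounded mu T (e%:R *: w_poly w (16 + i)).
  move=> lt_i; apply: (bounded_poly_conj mumin mon Mt); apply: bnd.
  by rewrite mem_iota.
pose zero (j : 'I_2) := [|| d 0%N 0 j == 0, d 1%N 0 j == 0 | d 2%N 0 j == 0].
have nzero j : ~~ zero j -> forall i, (i < 3)%N -> d i 0 j != 0.
  by rewrite !negb_or => /and3P[z0 z1 z2] [|[|[|]]].
pose s : nat -> int := nth 0 [:: sgz k1; sgz k2; - sgz k3].
pose b : nat -> nat := nth 0%N [:: absz k1; absz k2; absz k3].
pose y (j : 'I_2) (i : nat) := if zero j then 1 else d i 0 j ^ s i.
have s1P (k : int) : k != 0 -> sgz k = 1 \/ sgz k = -1.
  by move=> k0; case: (ltgtP k 0) k0 => // h _; [right; rewrite ltr0_sgz | left; rewrite gtr0_sgz].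
have sP i : (i < 3)%N -> s i = 1 \/ s i = -1.
  case: i => [|[|[|]]] // _; rewrite /s /=; [exact: s1P | exact: s1P |].
  by have [->|->] := s1P _ n3; rewrite ?opprK; [right | left].
have yu j (i : 'I_3) : bounded_unit t mu e T (y j i).
  have lt_i := ltn_ord i; rewrite /y; case: ifPn => [_|/nzero/(_ i lt_i) d0].
    exists 1, 1; split; rewrite ?rmorph1 ?mul1r // => z _.
    rewrite qevZ (ratr_nat algC) rmorph1 mulr1; split; first exact: algint_nat.
    by rewrite normr_nat ler_nat.
  have dv : d i 0 j * qev t (w_inv w i j) = 1.
    by have [dij|//] := inv i j lt_i; move: d0; rewrite dij eqxx.
  have lt12 : (2 * i + j < 6)%N by move: lt_i (ltn_ord j); lia.
  have be : conj_bounded mu T (e%:R *: w_eig w i j).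
    by apply: bnd_poly; exact: ltn_trans lt12 _.
  have bi : conj_bounded mu T (e%:R *: w_inv w i j).
    have := bnd_poly (6 + (2 * i + j))%N; rewrite /w_inv addnA; apply.
    by move: lt12; lia.
  have [->|->] := sP i lt_i.
    by exists (w_eig w i j), (w_inv w i j); rewrite expr1z -dE.
  exists (w_inv w i j), (w_eig w i j); split=> //.
    by rewrite -invr_expz expr1z; apply: (mulfI d0); rewrite dv divff.
  by rewrite -invr_expz expr1z -dE // mulVf.
have powE (x : R) (k : int) (n : nat) : (x ^ sgz k) ^+ n = x ^ (sgz k * n%:Z).
  by rewrite -exprz_exp.
have relE (n : nat -> nat) j : ~~ zero j -> \prod_(i < 3) y j i ^+ n i = 1 <->
    d 0%N 0 j ^ (sgz k1 * (n 0%N)%:Z) * d 1%N 0 j ^ (sgz k2 * (n 1%N)%:Z) =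
    d 2%N 0 j ^ (sgz k3 * (n 2%N)%:Z).
  move=> zj; have d20 : d 2%N 0 j != 0 by exact: nzero.
  rewrite (prod_ord3 (fun i => y j i ^+ n i)) /y (negPf zj) /s /= -!powE.
  rewrite -invr_expz exprVn; split=> [/divr1_eq //|->].
  by rewrite divff // expf_neq0 // expfz_neq0.
have EE j : \prod_(i < 3) y j i ^+ b i = 1.
  have [zj|zj] := boolP (zero j).
    by rewrite big1 // => i _; rewrite /y zj expr1n.
  apply/(relE b) => //; rewrite /b /=.
  have absE (k : int) : sgz k * (absz k)%:Z = k by rewrite abszE -intEsg.
  by rewrite !absE E.
have [|k' [k'0 k'1] k'P] := small_relation mumin e0 T0 (yu 0) (yu 1)
  (b := fun i => b i) (conj (EE 0) (EE 1)).
  by case=> [[|[|[|]]]] // lt_i; rewrite /b /= absz_gt0.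
pose n i := k' (inord i).
have nE (i : 'I_3) : n i = k' i by rewrite /n inord_val.
have nP i : (0 < n i <= w_bound w)%N.
  rewrite /n; have /andP[-> le] := k'P (inord i); apply: leq_trans le _.
  rewrite leq_mul // relation_bound_leq //.
  have /dvdp_leq le : mu %| map_poly intr M by rewrite -(mumin.2) Mt.
  rewrite -!subn1 leq_sub2r // -(size_map_poly_id0 (f := intr : int -> rat)) ?le //.
    exact/map_intr_neq0/monic_neq0.
  by rewrite intr_eq0 lead_coef_eq0 monic_neq0.
pose K (k : int) i : int := sgz k * (n i)%:Z.
have K0 k i : k != 0 -> K k i != 0.
  move=> k0; rewrite mulf_neq0 // ?sgz_eq0 // eqz_nat.
  by have /andP[] := nP i; rewrite lt0n.
have Kneg k i : (K k i < 0) = (k < 0).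
  have /andP[n_gt0 _] := nP i.
  by rewrite pmulr_llt0 ?ltz_nat // sgz_lt0.
have Kbound k i : exists2 m : nat, (m < (w_bound w * 2).+1)%N & K k i = m%:Z - (w_bound w)%:Z.
  exists (absz (K k i + (w_bound w)%:Z)).
    have /andP[_ n_le] := nP i; rewrite /K /sgz; case: eqP => _; first by lia.
    by case: ifP => _; lia.
  have /andP[_ n_le] := nP i; rewrite /K /sgz; case: eqP => _; first by lia.
  by case: ifP => _; lia.
have relK j : d 0%N 0 j ^ K k1 0 * d 1%N 0 j ^ K k2 1 = d 2%N 0 j ^ K k3 2.
  have [zj|zj] := boolP (zero j).
    by apply: (power_column_zero nz _ zj (E j)); rewrite !K0.
  apply/(relE n j zj); transitivity (\prod_(i < 3) y j i ^+ k' i).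
    by apply: eq_bigr => i _; rewrite nE.
  by move: j {zj}; apply: ord2P.
have [m1 m1P K1] := Kbound k1 0%N; have [m2 m2P K2] := Kbound k2 1%N.
have [m3 m3P K3] := Kbound k3 2%N.
have /fail/allP/(_ m2) : m1 \in iota 0 (w_bound w * 2).+1 by rewrite mem_iota.
rewrite mem_iota => /(_ m2P)/allP/(_ m3); rewrite mem_iota => /(_ m3P).
rewrite -K1 -K2 -K3.
have diffE (j : 'I_2) : qev t (w_diff w (K k1 0, K k2 1, K k3 2) j)%N = 0.
  have unit_neq0 i k : (i < 3)%N -> (k < 0 -> mxs A1 A2 A3 i *m mxs A1 A2 A3 i \in unitmx) ->
      K k i < 0 -> d i 0 j != 0.
    move=> lt_i ui; rewrite Kneg => /ui.
    by rewrite (diagonalizes_unit uP (hd i lt_i)); move: j; apply: ord2P => /andP[].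
  have /lhs_rhsP := relK j; rewrite !dE // => lr.
  rewrite /w_diff rmorphB /lhs /rhs !rmorphM !rmorphXn /=; apply/eqP; rewrite subr_eq0.
  apply/eqP; apply: lr; rewrite -dE //.
  - exact: (unit_neq0 0%N).
  - exact: (unit_neq0 1%N).
  - exact: (unit_neq0 2%N).
case/or3P => [/negP[]|/(nonzero_sound tp)|/(nonzero_sound tp)].
- rewrite /allowed /= !K0 //= !unitE //= !leNgt !Kneg.
  by apply/and3P; split; rewrite -implybE; apply/implyP.
- by rewrite (diffE 0) eqxx.
- by rewrite (diffE 1) eqxx.
Qed.

End SoundAnswers.
(** * Every input has a certificate *)

Section Completeness.

Variable R : realType.

Lemma algnum_repr_algebraic (e : algnum_code) (x : R) : algnum_repr e x -> algebraic x.
Proof.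
case=> e0 _ rx _; exists (map_poly intr e.1).
  exact: map_intr_neq0.
have : qev x (map_poly intr e.1) = 0 by rewrite qev_int; apply/rootP.
by move/eqP.
Qed.

Lemma presentation (xs : seq R) : (forall x, x \in xs -> algebraic x) ->
  exists t mu (M : {poly int}) qs, [/\ is_minpoly t mu, M \is monic,
    qev t (map_poly intr M) = 0, size qs = size xs &
    forall i, (i < size xs)%N -> qev t (nth 0 qs i) = nth 0 xs i].
Proof.
move=> /integral_primitive_element[t [mu [M [mumin mon Mt xsP]]]].
have [q qP] : exists q : R -> {poly rat}, forall x, x \in xs -> x = qev t (q x).
  have : forall x : R, exists q, x \in xs -> x = qev t q.
    by move=> x; have [/xsP[q ->]|] := boolP (x \in xs); [exists q | exists 0].
  by move/choice => [q qP]; exists q.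
exists t, mu, M, (map q xs); split=> //; first by rewrite size_map.
by move=> i lt_i; rewrite (nth_map 0) // -qP // mem_nth.
Qed.

Lemma root_at_complete (iso : isolation) (t : R) e q x :
    (forall g, qev t g = 0 -> vanishing iso g) -> algnum_repr e x -> qev t q = x ->
    (0 < qev t (q - e.2.1%:P) -> positive iso (q - e.2.1%:P)) ->
    (0 < qev t (e.2.2%:P - q) -> positive iso (e.2.2%:P - q)) ->
  root_at iso e q.
Proof.
move=> tv [e0 /andP[l1 l2] rx _] qx p1 p2; apply/and3P; split.
- by apply: tv; rewrite qev_comp qx qev_int; apply/rootP.
- by apply: p1; rewrite rmorphB /= qevC qx subr_gt0.
- by apply: p2; rewrite rmorphB /= qevC qx subr_gt0.
Qed.

Lemma bad_entry_complete (e : algnum_code) n : ~ (exists x : R, algnum_repr e x) ->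
  exists2 w, w_num w 0 = n & bad_entry e w.
Proof.
move=> norepr; pose mk k N iso qs : witness := (([:: n; k; N], iso), ((qs, 0), (0, 0, 0))).
have [e0|e0] := eqVneq e.1 0.
  by exists (mk 0%N 0%N (0, (0, 0)) [::]); rewrite // /bad_entry e0 eqxx.
have [ba|ab] := leP e.2.2 e.2.1.
  by exists (mk 0%N 0%N (0, (0, 0)) [::]); rewrite // /bad_entry ba orbT.
pose p := map_poly intr e.1 : {poly rat}.
have p0 : p != 0 by exact: map_intr_neq0.
have [[x [/andP[x1 x2] /eqP px]]|nox] :=
    pselect (exists x : R, ratr e.2.1 < x < ratr e.2.2 /\ qev x p == 0); last first.
  have [|h [k [N [r [s wit]]]]] := @rootless_complete R p e.2.1 e.2.2 p0 ab.
    by move=> y yab; apply/negP => py; apply: nox; exists y.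
  by exists (mk k N (0, (0, h)) [:: r; s]); rewrite // /bad_entry wit !orbT.
have rootE (z : R) : root (map_poly intr e.1) z = (qev z p == 0) by rewrite qev_int.
have [y [[/andP[y1 y2] /eqP py] yx]] :
    exists y : R, (ratr e.2.1 < y < ratr e.2.2 /\ qev y p == 0) /\ y != x.
  apply: contrapT => /forallNP uniq; apply: norepr; exists x; split=> //.
  - by rewrite /= x1.
  - by rewrite rootE px.
  - move=> y yab; rewrite rootE => py; apply: contrapT => /eqP yx.
    by apply: (uniq y).
wlog lt_xy : x y x1 x2 px y1 y2 py yx / x < y.
  move=> W; case: (ltgtP x y) => [lt|lt|E]; last by rewrite E eqxx in yx.
    exact: (W x y).
  by apply: (W y x) => //; rewrite eq_sym.
have algp z : qev z p = 0 -> algebraic z by move=> pz; exists p => //; apply/eqP.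
have [z zxy|t [mu [M [qs [mumin _ _ sq qsE]]]]] := @presentation [:: x; y].
  by apply: algp; move: zxy; rewrite !inE => /orP[] /eqP ->.
have q0 := qsE 0%N isT; have q1 := qsE 1%N isT.
set f0 := nth 0 qs 0 in q0; set f1 := nth 0 qs 1 in q1; rewrite /= in q0 q1.
have [iso [is_iso tvE tp]] := isolates_complete
  [:: f0 - e.2.1%:P; e.2.2%:P - f0; f1 - e.2.1%:P; e.2.2%:P - f1; f1 - f0] mumin.
have tv g : qev t g = 0 -> vanishing iso g by move/tvE.
have root_at_q f z : qev t f = z -> ratr e.2.1 < z -> z < ratr e.2.2 -> qev z p = 0 ->
    f \in [:: f0; f1] -> root_at iso e f.
  move=> fz z1 z2 pz fin; apply/and3P; split.
  - by apply: tv; rewrite qev_comp fz.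
  - by apply: tp; rewrite ?rmorphB /= ?qevC ?fz ?subr_gt0 // !inE;
      move: fin; rewrite !inE => /orP[] /eqP ->; rewrite eqxx ?orbT.
  - by apply: tp; rewrite ?rmorphB /= ?qevC ?fz ?subr_gt0 // !inE;
      move: fin; rewrite !inE => /orP[] /eqP ->; rewrite eqxx ?orbT.
exists (mk 0%N 0%N iso [:: f0; f1]) => //; rewrite /bad_entry; apply/orP; right.
apply/orP; right; apply/orP; right; apply/and4P; split=> //.
- by apply: (root_at_q _ x) => //; rewrite !inE eqxx.
- by apply: (root_at_q _ y) => //; rewrite !inE eqxx orbT.
- by apply: tp; rewrite ?rmorphB /= ?q0 ?q1 ?subr_gt0 // !inE eqxx !orbT.
Qed.

Lemma common_denominator (s : seq rat) :
  exists2 e : nat, (0 < e)%N & forall a, a \in s -> denq (e%:R * a) == 1.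
Proof.
elim: s => [|a s [e e0 eP]]; first by exists 1%N.
exists (e * absz (denq a))%N; first by rewrite muln_gt0 e0 absz_gt0 denq_neq0.
move=> b; rewrite inE natrM -Qint_def => /predU1P[->|/eP].
  rewrite -mulrA rpredM //; first exact: rpred_nat.
  by rewrite pmulrn absz_denq mulrC -numqE; exact: intr_int.
by rewrite -Qint_def mulrAC => eb; rewrite rpredM //; exact: rpred_nat.
Qed.

Lemma bounds_exist (M : {poly int}) (gs : seq {poly rat}) :
  exists e T : nat, [/\ (0 < e)%N, (e <= T)%N & forall g, g \in gs -> bounded_poly e T M g].
Proof.
have [e e0 eP] := common_denominator (flatten (map (@polyseq _) gs)).
have [T TP] : exists T : nat, forall g, g \in gs ->
    (\sum_(l < size g) `|e%:R * g`_l|) * (\sum_(l < size M) `|(M`_l)%:~R|) ^+ size g <= T%:R :> rat.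
  elim: gs {eP} => [|g gs [T TP]]; first by exists 0%N.
  set v := (\sum_(l < size g) `|e%:R * g`_l|) * (\sum_(l < size M) `|(M`_l)%:~R|) ^+ size g : rat.
  exists (T + (Num.trunc v).+1)%N => g'; rewrite inE natrD => /predU1P[->|/TP le].
    rewrite ler_wpDl ?ler0n // ltW //; rewrite -/v.
    have v0 : 0 <= v by rewrite mulr_ge0 ?exprn_ge0 ?sumr_ge0.
    by have /andP[] := truncn_itv v0.
  by rewrite (le_trans le) // lerDl ler0n.
exists e, (e + T)%N; split=> // [|g gin]; first exact: leq_addr.
apply/andP; split; last by rewrite (le_trans (TP g gin)) // natrD lerDr ler0n.
apply/allP => l; rewrite mem_iota => /= lt_l; apply: eP.
by apply/flattenP; exists (g : seq rat); [exact: map_f | exact: mem_nth].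
Qed.

End Completeness.

Section CompletenessValid.

Variables (R : realType) (c : mx2_triple_code) (A1 A2 A3 : 'M[R]_2).
Hypotheses (c1 : mx2_repr c.1.1 A1) (c2 : mx2_repr c.1.2 A2) (c3 : mx2_repr c.2 A3).

Let A := mxs A1 A2 A3.

Definition entry_values : seq R :=
  [:: A1 0 0; A1 0 1; A1 1 0; A1 1 1; A2 0 0; A2 0 1; A2 1 0; A2 1 1;
      A3 0 0; A3 0 1; A3 1 0; A3 1 1].

Lemma nth_entry_values i (j k : 'I_2) : (i < 3)%N ->
  nth 0 entry_values (4 * i + (2 * j + k)) = A i j k.
Proof. by case: i => [|[|[|]]] // _; move: j k; apply: ord2P; apply: ord2P. Qed.

Lemma entry_valuesP i : (i < 12)%N -> algnum_repr (code_entry c i) (nth 0 entry_values i).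
Proof.
have [c100 c101 c110 c111] := c1; have [c200 c201 c210 c211] := c2.
have [c300 c301 c310 c311] := c3.
by case: i => [|[|[|[|[|[|[|[|[|[|[|[|]]]]]]]]]]]].
Qed.

Lemma entry_values_algebraic x : x \in entry_values -> algebraic x.
Proof.
by move/(nthP 0) => [i lt_i <-]; apply: algnum_repr_algebraic (entry_valuesP lt_i).
Qed.

Lemma mx_algebraic i j k : (i < 3)%N -> algebraic (A i j k).
Proof.
move=> lt_i; rewrite -nth_entry_values //; apply: entry_values_algebraic.
by apply: mem_nth; move: (ltn_ord j) (ltn_ord k) lt_i; rewrite /=; lia.
Qed.

(** The positivity facts by which the entries are identified. *)
Definition entry_tests (qs : seq {poly rat}) :=
  [seq nth 0 qs i - (code_entry c i).2.1%:P | i <- iota 0 12] ++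
  [seq (code_entry c i).2.2%:P - nth 0 qs i | i <- iota 0 12].

Lemma check_entries_complete (w : witness) (t : R) :
    isolates (w_iso w) -> (forall g, qev t g = 0 -> vanishing (w_iso w) g) ->
    (forall g, g \in entry_tests w.2.1.1 -> 0 < qev t g -> positive (w_iso w) g) ->
    (forall i, (i < 12)%N -> qev t (w_poly w i) = nth 0 entry_values i) ->
  check_entries c w.
Proof.
move=> is_iso tv tp E; rewrite /check_entries is_iso; apply/allP => i.
rewrite mem_iota /= add0n => lt_i.
apply: (root_at_complete tv (entry_valuesP lt_i) (E i lt_i)); apply: tp;
  rewrite mem_cat; apply/orP; [left | right]; apply/mapP; exists i => //;
  by rewrite mem_iota.
Qed.

Lemma nonzero_complete (iso : isolation) (t : R) g :
    (0 < qev t g -> positive iso g) -> (0 < qev t (- g) -> positive iso (- g)) ->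
  qev t g != 0 -> nonzero iso g.
Proof.
move=> p1 p2 g0; rewrite /nonzero; case: (ltgtP (qev t g) 0) g0 => // h _.
  by rewrite p2 ?orbT // rmorphN /= oppr_gt0.
by rewrite p1.
Qed.

Lemma asym_complete i : (i < 3)%N -> (A i)^T <> A i -> exists w, check_asym c w.
Proof.
move=> lt_i asym.
have [t [mu [M [qs [mumin _ _ sq qsE]]]]] := presentation entry_values_algebraic.
pose w iso : witness := (([:: i], iso), ((qs, 0), (0, 0, 0))).
pose g := w_mx (w (0, (0, 0))) i 0 1 - w_mx (w (0, (0, 0))) i 1 0.
have [iso [is_iso tvE tp]] := isolates_complete (entry_tests qs ++ [:: g; - g]) mumin.
have tv h : qev t h = 0 -> vanishing iso h by move/tvE.
exists (w iso); apply/and3P; split=> //.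
  by apply: (check_entries_complete (t := t)) => // h hin; apply: tp; rewrite mem_cat hin.
apply: (nonzero_complete (t := t)).
- by apply: tp; rewrite mem_cat !inE eqxx orbT.
- by apply: tp; rewrite mem_cat !inE eqxx !orbT.
rewrite rmorphB /= /w_mx /w_poly /=.
have := nth_entry_values 0 1 lt_i; have := nth_entry_values 1 0 lt_i => /= E10 E01.
rewrite !qsE ?E10 ?E01; try by rewrite -[w_num _ _]/i /=; move: lt_i; lia.
apply: contra_notN asym => /eqP/subr0_eq E; apply/matrixP.
by apply: ord2P; apply: ord2P; rewrite mxE.
Qed.

Lemma noncomm_complete i i' : (i < 3)%N -> (i' < 3)%N ->
    (A i *m A i) *m (A i' *m A i') <> (A i' *m A i') *m (A i *m A i) ->
  exists w, check_noncomm c w.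
Proof.
move=> lt_i lt_i' /matrixP/existsNP[j /existsNP[k /eqP ne]].
have [t [mu [M [qs [mumin _ _ sq qsE]]]]] := presentation entry_values_algebraic.
pose w iso : witness := (([:: i; i'; j : nat; k : nat], iso), ((qs, 0), (0, 0, 0))).
pose g := w_sq_mul (w (0, (0, 0))) i i' j k - w_sq_mul (w (0, (0, 0))) i' i j k.
have [iso [is_iso tvE tp]] := isolates_complete (entry_tests qs ++ [:: g; - g]) mumin.
have tv h : qev t h = 0 -> vanishing iso h by move/tvE.
exists (w iso); apply/andP; split.
  by apply: (check_entries_complete (t := t)) => // h hin; apply: tp; rewrite mem_cat hin.
apply/and5P; split=> //; try exact: ltn_ord.
apply: (nonzero_complete (t := t)).
- by apply: tp; rewrite mem_cat !inE eqxx orbT.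
- by apply: tp; rewrite mem_cat !inE eqxx !orbT.
have E l (m n : 'I_2) : (l < 3)%N -> A l m n = qev t (w_mx (w iso) l m n).
  move=> lt_l; rewrite -nth_entry_values // qsE //.
  by move: lt_l (ltn_ord m) (ltn_ord n); rewrite /=; lia.
have mulE l l' (m n : 'I_2) : (l < 3)%N -> (l' < 3)%N ->
    qev t (w_sq_mul (w iso) l l' m n) = ((A l *m A l) *m (A l' *m A l')) m n.
  by move=> lt_l lt_l'; rewrite [RHS]mulmx2E !(sq_sound _ _ E) // /w_sq_mul rmorphD !rmorphM.
by rewrite rmorphB /= !mulE // subr_eq0.
Qed.

Section Diagonal.

Variables (P : 'M[R]_2) (d : nat -> 'rV[R]_2).
Hypotheses (uP : P \in unitmx)
  (hd : forall i, (i < 3)%N -> diagonalizes P (A i *m A i) (d i))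
  (algP : forall j k, algebraic (P j k))
  (algd : forall i j, (i < 3)%N -> algebraic (d i 0 j)).

Definition diagonal_values : seq R := entry_values ++ [:: P 0 0; P 0 1; P 1 0; P 1 1] ++
  [:: d 0%N 0 0; d 0%N 0 1; d 1%N 0 0; d 1%N 0 1; d 2%N 0 0; d 2%N 0 1] ++
  [:: (d 0%N 0 0)^-1; (d 0%N 0 1)^-1; (d 1%N 0 0)^-1; (d 1%N 0 1)^-1;
      (d 2%N 0 0)^-1; (d 2%N 0 1)^-1].

Lemma diagonal_values_algebraic x : x \in diagonal_values -> algebraic x.
Proof.
rewrite !mem_cat => /or4P[]; first exact: entry_values_algebraic.
- by rewrite !inE => /or4P[] /eqP ->.
- by rewrite !inE => /or4P[/eqP->|/eqP->|/eqP->|/or3P[] /eqP->]; exact: algd.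
- by rewrite !inE => /or4P[/eqP->|/eqP->|/eqP->|/or3P[] /eqP->];
    apply: algebraic_inv; exact: algd.
Qed.

Definition presented (w : witness) (t : R) :=
  forall i, (i < 28)%N -> qev t (w_poly w i) = nth 0 diagonal_values i.

Definition det_test (w : witness) := w_P w 0 0 * w_P w 1 1 - w_P w 0 1 * w_P w 1 0.

Lemma presented_mx w t i (j k : 'I_2) : presented w t -> (i < 3)%N ->
  A i j k = qev t (w_mx w i j k).
Proof.
move=> E lt_i; have lt12 : (4 * i + (2 * j + k) < 12)%N.
  by move: lt_i (ltn_ord j) (ltn_ord k); lia.
by rewrite /w_mx E ?(leq_trans lt12) // nth_cat lt12 nth_entry_values.
Qed.

Lemma presented_P w t (j k : 'I_2) : presented w t -> qev t (w_P w j k) = P j k.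
Proof.
by move=> E; rewrite /w_P E; move: j k; apply: ord2P; apply: ord2P.
Qed.

Lemma presented_eig w t i (j : 'I_2) : presented w t -> (i < 3)%N ->
  qev t (w_eig w i j) = d i 0 j.
Proof.
by move=> E lt_i; rewrite /w_eig E; case: i lt_i => [|[|[|]]] // _; move: j; apply: ord2P.
Qed.

Lemma presented_inv w t i (j : 'I_2) : presented w t -> (i < 3)%N ->
  qev t (w_inv w i j) = (d i 0 j)^-1.
Proof.
by move=> E lt_i; rewrite /w_inv E; case: i lt_i => [|[|[|]]] // _; move: j; apply: ord2P.
Qed.

Lemma check_diag_complete (w : witness) (t : R) :
    isolates (w_iso w) -> (forall g, qev t g = 0 -> vanishing (w_iso w) g) ->
    (forall g, g \in entry_tests w.2.1.1 ++ [:: det_test w; - det_test w] ->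
      0 < qev t g -> positive (w_iso w) g) ->
    presented w t -> check_diag c w.
Proof.
move=> is_iso tv tp pw; have sqE := sq_sound _ _ (fun i j k => @presented_mx w t i j k pw).
apply/and4P; split.
- apply: (check_entries_complete (t := t)) => // [g gin|i lt_i].
    by apply: tp; rewrite mem_cat gin.
  by rewrite pw ?(leq_trans lt_i) // nth_cat lt_i.
- apply: (nonzero_complete (t := t)).
  + by apply: tp; rewrite mem_cat !inE eqxx orbT.
  + by apply: tp; rewrite mem_cat !inE eqxx !orbT.
  rewrite rmorphB !rmorphM /= (presented_P 0 0 pw) (presented_P 0 1 pw).
  rewrite (presented_P 1 0 pw) (presented_P 1 1 pw) -det2E.
  by move: uP; rewrite unitmxE unitfE.
- apply/allP => i; rewrite mem_iota => /andP[_ lt_i].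
  apply/allP => j; rewrite mem_iota => /andP[_ lt_j].
  apply/allP => k; rewrite mem_iota => /andP[_ lt_k]; apply: tv.
  rewrite rmorphB rmorphD !rmorphM /=.
  rewrite -(sqE i (Ordinal lt_j) 0 lt_i) -(sqE i (Ordinal lt_j) 1 lt_i).
  rewrite (presented_P 0 (Ordinal lt_k) pw) (presented_P 1 (Ordinal lt_k) pw).
  rewrite (presented_P (Ordinal lt_j) (Ordinal lt_k) pw).
  rewrite (presented_eig (Ordinal lt_k) pw lt_i) -mulmx2E (hd lt_i) mul_mx_diag mxE.
  by rewrite subrr.
- apply/allP => i; rewrite mem_iota => /andP[_ lt_i].
  apply/allP => j; rewrite mem_iota => /andP[_ lt_j].
  have eE := presented_eig (Ordinal lt_j) pw lt_i.
  have iE := presented_inv (Ordinal lt_j) pw lt_i; rewrite /= in eE iE.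
  have [d0|d0] := eqVneq (d i 0 (Ordinal lt_j)) 0.
    by rewrite tv // eE.
  by rewrite orbC tv // rmorphB rmorph1 rmorphM /= eE iE divff // subrr.
Qed.

Lemma qev_diff (w : witness) (t : R) k (j : 'I_2) : presented w t ->
  qev t (w_diff w k j) =
  lhs (d 0%N 0 j) (d 1%N 0 j) (d 2%N 0 j) k - rhs (d 0%N 0 j) (d 1%N 0 j) (d 2%N 0 j) k.
Proof.
move=> pw; rewrite -!(presented_eig _ pw) //.
by rewrite /w_diff rmorphB /lhs /rhs !rmorphM !rmorphXn.
Qed.

Lemma w_unitE (w : witness) (t : R) i :
    (forall g, vanishing (w_iso w) g <-> qev t g = 0) -> presented w t -> (i < 3)%N ->
  w_unit w i = (A i *m A i \in unitmx).
Proof.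
move=> tvE pw lt_i; rewrite (diagonalizes_unit uP (hd lt_i)).
have key (j : 'I_2) : vanishing (w_iso w) (w_eig w i j * w_inv w i j - 1) = (d i 0 j != 0).
  apply/idP/idP => [/tvE|d0]; last first.
    apply/tvE; rewrite rmorphB rmorph1 rmorphM /= (presented_eig j pw lt_i).
    by rewrite (presented_inv j pw lt_i) divff // subrr.
  rewrite rmorphB rmorph1 rmorphM /= (presented_eig j pw lt_i) => /eqP.
  by apply: contraTneq => ->; rewrite mul0r sub0r oppr_eq0 oner_eq0.
by rewrite /w_unit (key 0) (key 1).
Qed.

Lemma allowedE (w : witness) (t : R) k1 k2 k3 :
    (forall g, vanishing (w_iso w) g <-> qev t g = 0) -> presented w t ->
  allowed w (k1, k2, k3) <-> [/\ k1 != 0, k2 != 0 & k3 != 0] /\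
    [/\ k1 < 0 -> A1 *m A1 \in unitmx, k2 < 0 -> A2 *m A2 \in unitmx &
        k3 < 0 -> A3 *m A3 \in unitmx].
Proof.
move=> tvE pw; rewrite /allowed /= !(w_unitE tvE pw) // !leNgt -!implybE.
split=> [/and4P[/and3P[n1 n2 n3] /implyP u1 /implyP u2 /implyP u3] //|].
by case=> [[-> -> ->] [u1 u2 u3]]; apply/and4P; split=> //; exact/implyP.
Qed.

Lemma solution_of_diffs (w : witness) (t : R) k1 k2 k3 :
    (forall g, vanishing (w_iso w) g <-> qev t g = 0) -> presented w t ->
  (allowed w (k1, k2, k3) /\ forall j : 'I_2, qev t (w_diff w (k1, k2, k3) j) = 0) <->
  power_relation (A1 *m A1) (A2 *m A2) (A3 *m A3) k1 k2 k3.
Proof.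
move=> tvE pw; have h0 := hd (isT : (0 < 3)%N); have h1 := hd (isT : (1 < 3)%N).
have h2 := hd (isT : (2 < 3)%N).
have neq0 i (k : int) (j : 'I_2) (lt_i : (i < 3)%N) : (k < 0 -> A i *m A i \in unitmx) ->
    k < 0 -> d i 0 j != 0.
  move=> ui /ui; rewrite (diagonalizes_unit uP (hd lt_i)).
  by move: j; apply: ord2P => /andP[].
split=> [[/(allowedE _ _ _ tvE pw)[nz [u1 u2 u3]] diff]|/(diagonal_power_relation uP h0 h1 h2)].
  apply/(diagonal_power_relation uP h0 h1 h2); split=> //; split=> // j.
  apply/lhs_rhsP; [exact: (neq0 0%N _ j isT u1) | exact: (neq0 1%N _ j isT u2)
    | exact: (neq0 2%N _ j isT u3) |].
  by have := diff j; rewrite (qev_diff _ _ pw) => /subr0_eq.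
case=> nz [u1 u2 u3 E]; split; first exact/(allowedE _ _ _ tvE pw).
move=> j; rewrite (qev_diff _ _ pw); apply/eqP; rewrite subr_eq0; apply/eqP.
have /lhs_rhsP := E j; apply; [exact: (neq0 0%N _ j isT u1) | exact: (neq0 1%N _ j isT u2)
  | exact: (neq0 2%N _ j isT u3)].
Qed.

Lemma diag_presented (t : R) qs ns iso M k :
    (forall i, (i < size diagonal_values)%N -> qev t (nth 0 qs i) = nth 0 diagonal_values i) ->
  presented ((ns, iso), ((qs, M), k)) t.
Proof. by move=> E i lt_i; exact: E. Qed.

Lemma yes_complete k1 k2 k3 :
    power_relation (A1 *m A1) (A2 *m A2) (A3 *m A3) k1 k2 k3 ->
  exists w, check_yes c w.
Proof.
move=> rel; have [t [mu [M [qs [mumin _ _ sq qsE]]]]] := presentation diagonal_values_algebraic.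
pose w iso : witness := (([::], iso), ((qs, 0), (k1, k2, k3))).
have pw iso : presented (w iso) t by exact: diag_presented.
have [iso [is_iso tvE tp]] := isolates_complete
  (entry_tests qs ++ [:: det_test (w (0, (0, 0))); - det_test (w (0, (0, 0)))]) mumin.
have tv h : qev t h = 0 -> vanishing iso h by move/tvE.
exists (w iso); have [al diff] := (solution_of_diffs k1 k2 k3 (w := w iso) tvE (pw iso)).2 rel.
apply/and4P; split=> //.
- exact: (check_diag_complete (t := t)).
- exact/tv/(diff 0).
- exact/tv/(diff 1).
Qed.

(** The polynomials and the bound for the exponents are chosen before the
    isolating interval. Only finitely many inequalities are left then, and
    a single short interval verifies them all. *)
Lemma no_complete :
    (forall k1 k2 k3, ~ power_relation (A1 *m A1) (A2 *m A2) (A3 *m A3) k1 k2 k3) ->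
  exists w, check_no c w.
Proof.
move=> norel; have [t [mu [M [qs [mumin mon Mt sq qsE]]]]] :=
  presentation diagonal_values_algebraic.
have [e [T [e0 eT eTP]]] := bounds_exist M [seq nth 0 qs (16 + i) | i <- iota 0 12].
pose w iso : witness := (([:: e; T], iso), ((qs, M), (0, 0, 0))).
have pw iso : presented (w iso) t by exact: diag_presented.
pose w0 := w (0, (0, 0)); pose B := w_bound w0.
pose r := [seq i%:Z - B%:Z | i <- iota 0 (B * 2).+1].
pose box := [seq (p, k) | p <- [seq (i, j) | i <- r, j <- r], k <- r].
pose tests := flatten [seq [:: w_diff w0 k 0; - w_diff w0 k 0; w_diff w0 k 1; - w_diff w0 k 1]
  | k <- box].
have [iso [is_iso tvE tp]] := isolates_complete
  ((entry_tests qs ++ [:: det_test w0; - det_test w0]) ++ tests) mumin.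
have tv h : qev t h = 0 -> vanishing iso h by move/tvE.
exists (w iso); apply/and3P; split.
- apply: (check_diag_complete (t := t)) => // h hin.
  by apply: tp; rewrite mem_cat hin.
- apply/and5P; split=> //; first exact: tv.
  apply/allP => i i12; apply: eTP; apply/mapP; by exists i.
apply/allP => i1 h1; apply/allP => i2 h2; apply/allP => i3 h3.
set k1 := i1%:Z - _; set k2 := i2%:Z - _; set k3 := i3%:Z - _.
have kbox : (k1, k2, k3) \in box.
  by apply: allpairs_f; [apply: allpairs_f |]; apply/mapP; [exists i1 | exists i2 | exists i3].
have test g : g \in [:: w_diff w0 (k1, k2, k3) 0; - w_diff w0 (k1, k2, k3) 0;
    w_diff w0 (k1, k2, k3) 1; - w_diff w0 (k1, k2, k3) 1] -> 0 < qev t g -> positive iso g.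
  move=> gin; apply: tp; rewrite mem_cat; apply/orP; right; apply/flattenP.
  by exists [:: w_diff w0 (k1, k2, k3) 0; - w_diff w0 (k1, k2, k3) 0;
    w_diff w0 (k1, k2, k3) 1; - w_diff w0 (k1, k2, k3) 1] => //; apply/mapP; exists (k1, k2, k3).
apply: contrapT => /negP/norP[/negbNE al /norP[nz0 nz1]].
apply: (norel k1 k2 k3); apply/(solution_of_diffs k1 k2 k3 (w := w iso) tvE (pw iso)).
split=> //; apply: ord2P; apply/eqP.
  apply: contraNT nz0 => d0; apply: (nonzero_complete (t := t)) => //; apply: test;
    by rewrite !inE eqxx ?orbT.
apply: contraNT nz1 => d0; apply: (nonzero_complete (t := t)) => //; apply: test;
  by rewrite !inE eqxx ?orbT.
Qed.

End Diagonal.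

End CompletenessValid.

(** Whether [c] represents symmetric matrices, whether their squares commute and
    whether a solution exists is decided classically; each case has its
    certificate. *)
Lemma check_complete (R : realType) (c : mx2_triple_code) : exists w, check c w.
Proof.
have [valid|/existsNP[i /not_implyP[lt_i norepr]]] :=
    pselect (forall i, (i < 12)%N -> exists x : R, algnum_repr (code_entry c i) x); last first.
  have [w wi bad] := bad_entry_complete i norepr; exists w.
  by rewrite /check /check_bad wi lt_i bad.
have [x xP] : exists x : nat -> R, forall i, (i < 12)%N -> algnum_repr (code_entry c i) (x i).
  have : forall i, exists x : R, (i < 12)%N -> algnum_repr (code_entry c i) x.
    by move=> i; have [/valid[x]|] := boolP (i < 12)%N; [exists x | exists 0].
  by move/choice => [x]; exists x.
pose A i : 'M[R]_2 := \matrix_(j, k) x (4 * i + (2 * j + k))%N.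
have c1 : mx2_repr c.1.1 (A 0%N).
  by split; rewrite mxE; [exact: (xP 0%N) | exact: (xP 1%N) | exact: (xP 2%N) | exact: (xP 3%N)].
have c2 : mx2_repr c.1.2 (A 1%N).
  by split; rewrite mxE; [exact: (xP 4%N) | exact: (xP 5%N) | exact: (xP 6%N) | exact: (xP 7%N)].
have c3 : mx2_repr c.2 (A 2%N).
  by split; rewrite mxE; [exact: (xP 8%N) | exact: (xP 9%N) | exact: (xP 10%N) | exact: (xP 11%N)].
pose As := mxs (A 0%N) (A 1%N) (A 2%N).
have [sym|/existsNP[i /not_implyP[lt_i asym]]] :=
    pselect (forall i, (i < 3)%N -> (As i)^T = As i); last first.
  by have [w cw] := asym_complete c1 c2 c3 lt_i asym; exists w; rewrite /check cw orbT.
have [comm|/existsNP[i /existsNP[i' /not_implyP[lt_i /not_implyP[lt_i' ncomm]]]]] :=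
    pselect (forall i i', (i < 3)%N -> (i' < 3)%N ->
      (As i *m As i) *m (As i' *m As i') = (As i' *m As i') *m (As i *m As i)); last first.
  by have [w cw] := noncomm_complete c1 c2 c3 lt_i lt_i' ncomm; exists w;
    rewrite /check cw !orbT.
have [|||P [d [uP hd algP algd]]] :=
    @simultaneously_diagonalizable R (fun i : 'I_3 => As i *m As i).
- by move=> i; rewrite trmx_mul sym.
- move=> i j k; rewrite mulmx2E; apply: algebraic_add; apply: algebraic_mul;
    exact: (mx_algebraic c1 c2 c3).
- by move=> i j; exact: comm.
pose d' i := d (inord i).
have hd' i : (i < 3)%N -> diagonalizes P (As i *m As i) (d' i).
  by move=> lt_i; have := hd (inord i); rewrite inordK.
have algd' i j : (i < 3)%N -> algebraic (d' i 0 j) by move=> _; exact: algd.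
have [[k1 [k2 [k3 rel]]]|norel] := pselect (exists k1 k2 k3,
    power_relation (As 0%N *m As 0%N) (As 1%N *m As 1%N) (As 2%N *m As 2%N) k1 k2 k3).
  have [w cw] := yes_complete c1 c2 c3 uP hd' algP algd' rel.
  by exists w; rewrite /check cw !orbT.
have [|w cw] := no_complete c1 c2 c3 uP hd' algP algd'.
  by move=> k1 k2 k3 rel; apply: norel; exists k1, k2, k3.
by exists w; rewrite /check cw !orbT.
Qed.

(** * The decision procedure *)

Lemma answer_sound (R : realType) (c : mx2_triple_code) (A1 A2 A3 : 'M[R]_2) w :
    mx2_repr c.1.1 A1 -> mx2_repr c.1.2 A2 -> mx2_repr c.2 A3 ->
    A1^T = A1 -> A2^T = A2 -> A3^T = A3 -> check c w ->
  match answer c w with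
  | Some (k1, k2, k3) => power_relation A1 A2 A3 k1 k2 k3
  | None => ~ exists k1 k2 k3 : int, power_relation A1 A2 A3 k1 k2 k3
  end.
Proof.
move=> c1 c2 c3 s1 s2 s3; rewrite /answer /check (negPf (check_bad_sound c1 c2 c3 w)).
rewrite (negPf (check_asym_sound c1 c2 c3 w s1 s2 s3)) /=.
case: ifP => [yes _|_].
  by apply: (check_yes_sound c1 c2 c3 yes); case: (w_sol w) => [[]].
move=> cw [k1 [k2 [k3 rel]]]; case/orP: cw => [|no].
  by rewrite (negPf (check_noncomm_sound c1 c2 c3 w s1 s2 s3 rel)).
exact: (check_no_sound c1 c2 c3 s1 s2 s3 no rel).
Qed.

Definition max_exponent (o : option (int * int * int)) : nat :=
  if o is Some k then maxn (maxn (absz k.1.1) (absz k.1.2)) (absz k.2) else 0%N.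

Lemma computable_max_exponent (X : countType) (o : X -> option (int * int * int)) :
  computable o -> computable (fun x => max_exponent (o x)).
Proof.
move=> co; apply: (@computable_obind _ _ _ o
  (fun _ k => maxn (maxn (absz k.1.1) (absz k.1.2)) (absz k.2)) (fun=> 0%N)) => //.
  by do 2?apply: computable_maxn; computability.
exact: computable_const.
Qed.

Theorem theorem10 (R : realType) :
  (exists C : mx2_triple_code * rat -> nat, computable C /\
    forall (c : mx2_triple_code) (A1 A2 A3 : 'M[R]_2) (H : rat),
      mx2_repr c.1.1 A1 -> mx2_repr c.1.2 A2 -> mx2_repr c.2 A3 ->
      A1^T = A1 -> A2^T = A2 -> A3^T = A3 ->
      mx_log_height A1 <= ratr H -> mx_log_height A2 <= ratr H ->
      mx_log_height A3 <= ratr H ->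
      (exists k1 k2 k3 : int, power_relation A1 A2 A3 k1 k2 k3) ->
      exists k1 k2 k3 : int,
        [/\ `|k1| <= (C (c, H))%:Z, `|k2| <= (C (c, H))%:Z,
            `|k3| <= (C (c, H))%:Z & power_relation A1 A2 A3 k1 k2 k3])
  /\
  (exists f : mx2_triple_code -> option (int * int * int), computable f /\
    forall (c : mx2_triple_code) (A1 A2 A3 : 'M[R]_2),
      mx2_repr c.1.1 A1 -> mx2_repr c.1.2 A2 -> mx2_repr c.2 A3 ->
      A1^T = A1 -> A2^T = A2 -> A3^T = A3 ->
      match f c with
      | Some (k1, k2, k3) => power_relation A1 A2 A3 k1 k2 k3
      | None => ~ exists k1 k2 k3 : int, power_relation A1 A2 A3 k1 k2 k3
      end).
Proof.
have [W cW WP] := computable_search decodable_code decodable_witness computable_check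
  (check_complete R).
pose f c := answer c (W c).
have cf : computable f := computable_comp (f := fun c => (c, W c)) computable_answer
  (computable_pair (computable_id _) cW).
split; last first.
  by exists f; split=> // c A1 A2 A3 c1 c2 c3 s1 s2 s3; exact: answer_sound.
exists (fun x => max_exponent (f x.1)); split.
  by apply: computable_max_exponent; exact: computable_comp cf (computable_fst (computable_id _)).
move=> c A1 A2 A3 H c1 c2 c3 s1 s2 s3 _ _ _ sol; move: (answer_sound c1 c2 c3 s1 s2 s3 (WP c)).
rewrite -/(f c) /=; case: (f c) => [[[k1 k2] k3]|] // rel; exists k1, k2, k3; split=> //.
- by rewrite -abszE lez_nat /= !leq_max leqnn.
- by rewrite -abszE lez_nat /= !leq_max leqnn orbT.
- by rewrite -abszE lez_nat /= !leq_max leqnn orbT.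
Qed.
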